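(* Let $M$ be a connected submanifold of dimension $m\ge 2$ of the probability simplex $(\Delta^n,g^F,\nabla^{(\mathrm{e})})$. Then $M$ is doubly totally-umbilical if and only if it is contained in a $\nabla^{(\mathrm{m})}$-autoparallel submanifold of the form $$\Xi=\Xi_{a_{i_1},\ldots,a_{i_{\mathcal A}},b_{j_1},\ldots,b_{j_{\mathcal B}},\phi}=\left\{p\in\Delta^n \;\middle|\; p(i_k)=a_{i_k}\,p(\phi(i_k))\ (1\le k\le\mathcal A),\quad p(j_l)=b_{j_l}\ (1\le l\le \mathcal B)\right\},$$ where $i_1,\ldots,i_{\mathcal A},j_1,\ldots,j_{\mathcal B}\in\{1,\ldots,n+1\}$ are $\mathcal A+\mathcal B=n-m$ distinct integers ($\mathcal A,\mathcal B\ge 0$), $\phi:\{i_1,\ldots,i_{\mathcal A}\}\to\{1,\ldots,n+1\}\setminus\{i_1,\ldots,i_{\mathcal A},j_1,\ldots,j_{\mathcal B}\}$ is a map, $a_{i_1},\ldots,a_{i_{\mathcal A}}$ are positive real numbers, and $b_{j_1},\ldots,b_{j_{\mathcal B}}\in(0,1)$. Moreover, for such $M\subset\Xi$, denoting by $(g,\nabla)$ the statistical structure induced on $\Xi$ by $(g^F,\nabla^{(\mathrm{e})})$, the following hold: (1) $M$ is doubly autoparallel if and only if $\mathcal B=0$. If $M$ is doubly autoparallel, then there exists a statistical diffeomorphism $f:(\Delta^m,g^F,\nabla^{(\mathrm{e})})\to(\Xi,g,\nabla)$ such that $\iota\circ f$ is a Markov embedding, where $\iota:\Xi\to\Delta^n$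 is the inclusion map. (2) If $\mathcal B\ne0$, there exists a Markov embedding $f:\Delta^{m+1}\to\Delta^n$ such that $\Xi\subset f(\Delta^{m+1})$, and, if $f(\Delta^{m+1})$ is identified with $\Delta^{m+1}$ via $f$, then $(\Xi,g,\nabla)$ is a doubly totally-umbilical statistical submanifold of $(\Delta^{m+1},g^F,\nabla^{(\mathrm{e})})$. (3) The affine connection $\nabla|_M$ is complete if and only if $M=\Xi$.
   Context: All objects are smooth. Statistical manifolds. A statistical manifold $(M,g,\nabla)$ is a manifold $M$ with a Riemannian metric $g$ and a torsion-free affine connection $\nabla$ such that $(\nabla_Xg)(Y,Z)=(\nabla_Yg)(X,Z)$ for all vector fields. Its conjugate connection $\nabla^*$ is the torsion-free affine connection defined by $Xg(Y,Z)=g(\nabla_XY,Z)+g(Y,\nabla^*_XZ)$. Statistical immersions. Given an immersion $\iota:M\to\widetilde M$ into a statistical manifold $(\widetilde M,\widetilde g,\widetilde\nabla)$, the induced statistical structure $(g,\nabla)$ on $M$ is $g=\iota^*\widetilde g$, $g(\nabla_XY,Z)=\widetilde g(\widetilde\nabla_X\iota_*Y,\iota_*Z)$. An immersion between statistical manifolds is a statistical immersion if the structure on the source is the induced one (the source is then a statistical submanifold); a statistical diffeomorphism is a statistical immersion that is a diffeomorphism. Let $B$ and $B^*$ be the second fundamental forms of $\iota$ with respect to $\widetilde\nabla$ and $\widetilde\nabla^*$, i.e. the components of $\widetilde\nabla_X\iota_*Y$ and $\widetilde\nabla^*_X\iota_*Y$ normal to $M$ (with respect to $\widetilde g$), and let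 $H=\frac1m\sum_iB(e_i,e_i)$, $H^*=\frac1m\sum_iB^*(e_i,e_i)$ for a $g$-orthonormal frame $(e_i)$, $m=\dim M$. $M$ is doubly autoparallel if $B=B^*=0$; it is doubly totally-umbilical if $B=H\otimes g$ and $B^*=H^*\otimes g$ (so doubly autoparallel submanifolds are doubly totally-umbilical). $M$ is $\widetilde\nabla$-autoparallel if $B=0$, and $\widetilde\nabla^*$-autoparallel if $B^*=0$. Probability simplex. $\Omega_{n+1}=\{1,\ldots,n+1\}$ and $\Delta^n=\{p:\Omega_{n+1}\to(0,1)\mid\sum_{\omega=1}^{n+1}p(\omega)=1\}$, an $n$-manifold with global coordinates $\eta^i(p)=p(i)$, $1\le i\le n$. The Fisher metric $g^F$ and exponential connection $\nabla^{(\mathrm e)}$ are given by, with $\partial_i=\partial/\partial\eta^i$, $$g^F(\partial_i,\partial_j)=\sum_{\omega=1}^{n+1}\partial_i\log p(\omega)\,\partial_j\log p(\omega)\,p(\omega),\qquad g^F(\nabla^{(\mathrm e)}_{\partial_i}\partial_j,\partial_k)=\sum_{\omega=1}^{n+1}\partial_i\partial_j\log p(\omega)\,\partial_k\log p(\omega)\,p(\omega).$$ The mixture connection $\nabla^{(\mathrm m)}$ is the conjugate connection of $\nabla^{(\mathrm e)}$ with respect to $g^F$; $(\eta^1,\dots,\eta^n)$ are affine coordinates for it. Markov embeddings. For $m\le n$, an embedding $\iota:\Delta^m\to\Delta^n$ is a Markov embedding if there are non-empty subsets $C_1,\ldots,C_{m+1}\subset\Omega_{n+1}$ with $\Omega_{n+1}=\bigsqcup_{l=1}^{m+1}C_l$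 and functions $Q_l:\Omega_{n+1}\to[0,\infty)$ with support contained in $C_l$, $1\le l\le m+1$, such that $\iota(p)=\sum_{l=1}^{m+1}p(l)Q_l$ for all $p\in\Delta^m$. Completeness. An affine connection on a manifold is complete if for every tangent vector $(p,v)$ there is a geodesic $\gamma:\mathbb R\to M$ with $\gamma(0)=p$, $\dot\gamma(0)=v$. *)

(* Defs.v *)
From HB Require Import structures.
From mathcomp Require Import all_boot all_order all_algebra.
From mathcomp Require Import all_classical all_reals all_analysis.

Set Implicit Arguments.
Unset Strict Implicit.
Unset Printing Implicit Defensive.

Import Order.TTheory GRing.Theory Num.Theory.
Import numFieldNormedType.Exports.

Local Open Scope classical_set_scope.
Local Open Scope ring_scope.

(* The simplex carries a global chart, and all tensors and connections below
   are given by their components in local coordinates.  Coordinate vectors and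
   tangent vectors are row vectors; indices are 0-based, so that Omega_{n+1}
   is 'I_n.+1 and the last outcome is ord_max. *)

(* C^oo on an open set U: every iterated directional derivative is Frechet
   differentiable at every point of U.  (V is always finite-dimensional.) *)
Definition smooth_on (R : realType) (V W : normedModType R)
    (U : set V) (f : V -> W) : Prop :=
  forall (s : seq V) (x : V), U x ->
    differentiable (foldr (fun v h => 'D_v h) f s) x.

Definition basis_vec (R : realType) (d : nat) (i : 'I_d) : 'rV[R]_d :=
  delta_mx 0 i.
Arguments basis_vec {R d} i.

Section LocalCoordinates.
Variable R : realType.

(* g x i j = g(d_i, d_j) at x *)
Definition metric (d : nat) := 'rV[R]_d -> 'M[R]_d.

(* The k-th entry of G x i j is g(nabla_{d_i} d_j, d_k) at x, i.e. connections
   are given by Christoffel symbols of the first kind. *)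
Definition connection (d : nat) := 'rV[R]_d -> 'I_d -> 'I_d -> 'rV[R]_d.

(* The vector nabla_{d_i} d_j at x. *)
Definition nabla_basis d (g : metric d) (G : connection d) (x : 'rV[R]_d)
    (i j : 'I_d) : 'rV[R]_d :=
  G x i j *m invmx (g x).

(* d_i g_{kj} = g(nabla_i d_k, d_j) + g(d_k, nabla*_i d_j) *)
Definition conjugate d (g : metric d) (G : connection d) : connection d :=
  fun x i j => \row_k ('D_(basis_vec i) (fun y => g y k j : R) x - G x i k 0 j).

Section Immersion.
(* x is the coordinate expression of an immersion of an m-manifold into a
   d-manifold with metric g and connection G; row a of 'J x u is the image of
   the a-th coordinate vector of the source. *)
Variables (d m : nat) (g : metric d) (G : connection d).
Variable x : 'rV[R]_m -> 'rV[R]_d.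
Implicit Type u : 'rV[R]_m.

(* nabla_{d_a} (x_* d_b), derivative along x of a vector field along x *)
Definition nabla_along u (a b : 'I_m) : 'rV[R]_d :=
  'D_(basis_vec a) ('D_(basis_vec b) x) u
  + \sum_(i < d) \sum_(j < d)
      ('J x u a i * 'J x u b j) *: nabla_basis g G (x u) i j.

Definition induced_metric u : 'M[R]_m := 'J x u *m g (x u) *m ('J x u)^T.

Definition induced_connection u (a b : 'I_m) : 'rV[R]_m :=
  nabla_along u a b *m g (x u) *m ('J x u)^T.

(* w minus its g-orthogonal projection onto the row space of 'J x u *)
Definition normal_part u (w : 'rV[R]_d) : 'rV[R]_d :=
  w - w *m g (x u) *m ('J x u)^T *m invmx (induced_metric u) *m 'J x u.

(* B(v, w) for tangent vectors v, w of the source *)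
Definition second_fundamental_form u (v w : 'rV[R]_m) : 'rV[R]_d :=
  \sum_(a < m) \sum_(b < m)
    (v 0 a * w 0 b) *: normal_part u (nabla_along u a b).

(* The rows of E form an orthonormal basis of the tangent space. *)
Definition orthonormal_frame u (E : 'M[R]_m) : Prop :=
  E *m induced_metric u *m E^T = 1%:M.

Definition mean_curvature u (E : 'M[R]_m) : 'rV[R]_d :=
  m%:R^-1 *: \sum_(i < m) second_fundamental_form u (row i E) (row i E).

End Immersion.

End LocalCoordinates.

Section Simplex.
Variable R : realType.

Definition simplex (n : nat) : set 'rV[R]_n.+1 :=
  [set p | (forall w, 0 < p 0 w < 1) /\ \sum_w p 0 w = 1].

Definition eta (n : nat) (p : 'rV[R]_n.+1) : 'rV[R]_n :=
  \row_i p 0 (lift ord_max i).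

(* The inverse of the chart eta. *)
Definition prob (n : nat) (x : 'rV[R]_n) : 'rV[R]_n.+1 :=
  \row_w (if unlift ord_max w is Some i then x 0 i else 1 - \sum_i x 0 i).

Definition log_prob (n : nat) (w : 'I_n.+1) (x : 'rV[R]_n) : R :=
  ln (prob x 0 w).

Definition fisher (n : nat) : metric R n := fun x =>
  \matrix_(i, j) \sum_(w < n.+1)
    'D_(basis_vec i) (@log_prob n w) x * 'D_(basis_vec j) (@log_prob n w) x
    * prob x 0 w.

Definition econn (n : nat) : connection R n := fun x i j =>
  \row_k \sum_(w < n.+1)
    'D_(basis_vec i) ('D_(basis_vec j) (@log_prob n w)) x
    * 'D_(basis_vec k) (@log_prob n w) x * prob x 0 w.

Definition mconn (n : nat) : connection R n := conjugate (@fisher n) (@econn n).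

End Simplex.
Arguments simplex {R} n.
Arguments fisher {R n}.
Arguments econn {R n}.
Arguments mconn {R n}.

Section Submanifold.
Variables (R : realType) (n m : nat) (T : topologicalType).
Variable iota : T -> 'rV[R]_n.+1.

Definition coord_expr (phi : 'rV[R]_m -> T) : 'rV[R]_m -> 'rV[R]_n :=
  fun u => eta (iota (phi u)).

(* Inverse of a chart of T, relevant on U only.  As iota is an immersion, the
   topology of T determines its smooth structure: phi is an inverse chart iff
   it is a homeomorphism onto an open set and iota \o phi is an immersion. *)
Definition parametrization (U : set 'rV[R]_m) (phi : 'rV[R]_m -> T) : Prop :=
  [/\ open U,
      forall u, U u -> {for u, continuous phi},
      set_inj U phi,
      (forall V : set 'rV[R]_m, open V -> V `<=` U -> open (phi @` V))
    & smooth_on U (coord_expr phi)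
      /\ forall u, U u -> row_free ('J (coord_expr phi) u)].

(* Immersed submanifold of dimension m of the simplex; T is Hausdorff because
   iota is continuous and injective.  An embedded submanifold is the case where
   T is a set of points with the subspace topology and iota = set_val. *)
Definition submanifold : Prop :=
  [/\ forall t, simplex n (iota t),
      injective iota
    & forall t, exists U phi u, [/\ parametrization U phi, U u & phi u = t]].

Definition autoparallel (G : connection R n) : Prop :=
  forall U phi, parametrization U phi -> forall u, U u -> forall v w,
    second_fundamental_form fisher G (coord_expr phi) u v w = 0.

Definition umbilical (G : connection R n) : Prop :=
  forall U phi, parametrization U phi -> forall u, U u ->
  forall E, orthonormal_frame fisher (coord_expr phi) u E -> forall v w,
    second_fundamental_form fisher G (coord_expr phi) u v w
    = (v *m induced_metric fisher (coord_expr phi) u *m w^T) 0 0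
      *: mean_curvature fisher G (coord_expr phi) u E.

Definition doubly_autoparallel : Prop := autoparallel econn /\ autoparallel mconn.

Definition doubly_umbilical : Prop := umbilical econn /\ umbilical mconn.

(* The components, in the coordinates given by phi, of the statistical
   structure induced on T by the Fisher metric and the e-connection. *)
Definition sub_metric (phi : 'rV[R]_m -> T) : metric R m :=
  induced_metric fisher (coord_expr phi).

Definition sub_connection (phi : 'rV[R]_m -> T) : connection R m :=
  induced_connection fisher econn (coord_expr phi).

(* gamma is a geodesic of the induced connection near the time s, where it is
   represented by the smooth curve c in the coordinates phi. *)
Definition geodesic_near (gamma : R -> T) (s : R)
    (U : set 'rV[R]_m) (phi : 'rV[R]_m -> T) (c : R -> 'rV[R]_m) : Prop :=
  exists I : set R, [/\ open I, I s, @smooth_on R R^o 'rV[R]_m I c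
    & forall r, I r ->
      [/\ U (c r), gamma r = phi (c r)
        & derive1 (derive1 c) r + \sum_(a < m) \sum_(b < m)
            (derive1 c r 0 a * derive1 c r 0 b)
            *: nabla_basis (sub_metric phi) (sub_connection phi) (c r) a b
          = 0]].

Definition geodesic (gamma : R -> T) : Prop :=
  forall s, exists U phi c, parametrization U phi /\ geodesic_near gamma s U phi c.

(* The tangent vector (p, v) ranges over p = phi u and the vectors with
   components v in the coordinates phi. *)
Definition complete_connection : Prop :=
  forall U phi, parametrization U phi -> forall u, U u -> forall v,
    exists gamma c, [/\ geodesic gamma, geodesic_near gamma 0 U phi c,
      c 0 = u & derive1 c 0 = v].

End Submanifold.

Section StatisticalMaps.
Variable R : realType.

(* j is a statistical immersion into the simplex of dimension k of the manifold
   T equipped with the statistical structure induced by iota. *)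
Definition statistical_immersion (n k m : nat) (T : topologicalType)
    (iota : T -> 'rV[R]_n.+1) (j : T -> 'rV[R]_k.+1) : Prop :=
  (forall t, simplex k (j t)) /\
  forall (U : set 'rV[R]_m) phi, parametrization iota U phi ->
    parametrization j U phi /\
    forall u, U u ->
      sub_metric iota phi u = sub_metric j phi u /\
      forall a b, sub_connection iota phi u a b = sub_connection j phi u a b.

(* f, relevant on the simplex only, is a statistical diffeomorphism onto T
   equipped with the statistical structure induced by iota.  f is a
   diffeomorphism iff f \o prob is a parametrization of the whole of T. *)
Definition statistical_diffeo (n m : nat) (T : topologicalType)
    (iota : T -> 'rV[R]_n.+1) (f : 'rV[R]_m.+1 -> T) : Prop :=
  [/\ parametrization iota (@eta R m @` simplex m) (f \o @prob R m),
      f @` simplex m = setT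
    & forall u, (@eta R m @` simplex m) u ->
      fisher u = sub_metric iota (f \o @prob R m) u /\
      forall a b, econn u a b = sub_connection iota (f \o @prob R m) u a b].

Definition simplex_embedding (m n : nat) (f : 'rV[R]_m.+1 -> 'rV[R]_n.+1) : Prop :=
  let x := fun u : 'rV[R]_m => eta (f (prob u)) in
  [/\ f @` simplex m `<=` simplex n,
      smooth_on (@eta R m @` simplex m) x,
      (forall u, (@eta R m @` simplex m) u -> row_free ('J x u)),
      {within simplex m, continuous f}
    & set_inj (simplex m) f /\
      forall V : set 'rV[R]_m.+1, open V -> exists2 W, open W &
        f @` (V `&` simplex m) = W `&` f @` simplex m].

Definition markov_embedding (m n : nat) (f : 'rV[R]_m.+1 -> 'rV[R]_n.+1) : Prop :=
  [/\ (m <= n)%N, simplex_embedding f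
    & exists (C : 'I_m.+1 -> {set 'I_n.+1}) (Q : 'I_m.+1 -> 'rV[R]_n.+1),
      [/\ forall l, C l != finset.set0,
          forall l l' w, w \in C l -> w \in C l' -> l = l',
          forall w, exists l, w \in C l,
          forall l w, 0 <= Q l 0 w /\ (Q l 0 w != 0 -> w \in C l)
        & forall p, simplex m p -> f p = \sum_l p 0 l *: Q l]].

End StatisticalMaps.

(* phi k, a k, b l stand for phi(i_k), a_{i_k}, b_{j_l}. *)
Record xi_data (R : realType) (n m : nat) := XiData {
  xi_A : nat;
  xi_B : nat;
  xi_i : 'I_xi_A -> 'I_n.+1;
  xi_j : 'I_xi_B -> 'I_n.+1;
  xi_phi : 'I_xi_A -> 'I_n.+1;
  xi_a : 'I_xi_A -> R;
  xi_b : 'I_xi_B -> R;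
  xi_dim : (xi_A + xi_B = n - m)%N;
  xi_i_inj : injective xi_i;
  xi_j_inj : injective xi_j;
  xi_ij : forall k l, xi_i k != xi_j l;
  xi_phi_i : forall k k', xi_phi k != xi_i k';
  xi_phi_j : forall k l, xi_phi k != xi_j l;
  xi_a_gt0 : forall k, 0 < xi_a k;
  xi_b_01 : forall l, 0 < xi_b l < 1
}.

Arguments xi_i {R n m} x k.
Arguments xi_j {R n m} x l.
Arguments xi_phi {R n m} x k.
Arguments xi_a {R n m} x k.
Arguments xi_b {R n m} x l.

Definition Xi (R : realType) (n m : nat) (X : xi_data R n m) : set 'rV[R]_n.+1 :=
  [set p | [/\ simplex n p,
    forall k, p 0 (xi_i X k) = xi_a X k * p 0 (xi_phi X k)
  & forall l, p 0 (xi_j X l) = xi_b X l]].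

(* The inclusion of Xi, which carries the subspace topology. *)
Definition Xi_incl (R : realType) (n m : nat) (X : xi_data R n m) :
  set_type (Xi X) -> 'rV[R]_n.+1 := set_val.
Arguments Xi_incl {R n m} X.

(* Main.v *)
From HB Require Import structures.
Require Import Defs.
From mathcomp Require Import all_boot all_order all_algebra.
From mathcomp Require Import all_classical all_reals all_analysis.
From mathcomp Require Import ring lra zify.
Import Order.TTheory GRing.Theory Num.Theory.
Import numFieldNormedType.Exports.
Local Open Scope classical_set_scope.
Local Open Scope ring_scope.

Set Implicit Arguments.
Unset Strict Implicit.
Unset Printing Implicit Defensive.

(* Tangent vectors at p are represented by their scores v / p, functions on the
   outcomes with mean zero; the Fisher metric is then the L^2(p) product, the
   m-derivative of a vector along the submanifold has score (d_a d_b p) / p and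
   the e-derivative has score (d_a d_b p) / p - (d_a p / p) (d_b p / p).  Hence
   for a doubly totally-umbilical submanifold there is a function k with
   f h - <f, h> k in V for all f, h in the space V of scores.  As m >= 2, the
   span A of V and k is closed under products, so it is spanned by the
   indicators of m + 1 disjoint cells of outcomes.  The ties f_i = f_j and the
   zeros f_j = 0 that hold on V can only disappear nearby, but then the rank
   m + 1 of A would grow; so they are locally constant, and integrating them
   gives the equations of Xi.

   Conversely, on Xi the hessian of p is tangent and the e-form is <., .> times
   a vector that vanishes exactly when no coordinate is frozen.  The cell masses
   q_l obey the geodesic equation iff all (ln q_l)'' coincide, so the ratios of
   the q_l along a geodesic are exponentials of affine functions.  This joins
   any two points of Xi, which forces a complete M to be all of Xi; conversely
   these explicit curves lift to any chart by the inverse function theorem. *)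

(** * Calculus on row vectors *)

(** In the direct implication only the difference of the two umbilicity equations is used:
    subtracting them cancels the second derivatives of the immersion, so a pointwise algebraic
    condition on scores remains. The function [k] has mean 1, hence lies outside V, which fixes the
    rank of A at every point without any continuity of [k]; this is why a rank comparison can
    replace an argument on how A varies. Pairings with tangent vectors see a function only modulo
    constants, so identities between scores come with an additive constant that is found by taking
    means. A is not unital as soon as some outcome is frozen, so separating functions have to be
    built from polynomials without constant term. In the completeness statement the chart of M is
    arbitrary: explicit curves of cell masses must be lifted into it, and the lift must have all
    iterated derivatives differentiable. A contraction argument gives the lift; a function algebra
    closed under derivation gives its smoothness. *)

Section RowCalculus.
Variable R : realType.
Implicit Types (V W : normedModType R).

Lemma differentiable_row V n (f : V -> 'rV[R]_n) x :
  (forall j, differentiable (fun y => f y 0 j : R) x) -> differentiable f x.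
Proof.
move=> df.
have -> : f = \sum_j (fun y => f y 0 j *: delta_mx 0 j).
  by apply/funext => y; rewrite fct_sumE; exact: row_sum_delta.
by apply: differentiable_sum => j; exact: differentiableZl.
Qed.

Lemma differentiable_entry V n (f : V -> 'rV[R]_n) x j :
  differentiable f x -> differentiable (fun y => f y 0 j : R) x.
Proof.
move=> df; exact: (@differentiable_comp _ _ _ _ f (fun M : 'rV[R]_n => M 0 j) x df
  (differentiable_coord _ _ _)).
Qed.

Lemma derive_entry V n (f : V -> 'rV[R]_n) x v j :
  differentiable f x -> 'D_v (fun y => f y 0 j : R) x = 'D_v f x 0 j.
Proof. by move=> df; rewrite derive_mx ?mxE//; exact: diff_derivable. Qed.

Lemma differentiable_mulmxr m n (A : 'M[R]_(m, n)) (x : 'rV[R]_m) :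
  differentiable (mulmxr A : 'rV[R]_m -> 'rV[R]_n) x.
Proof.
apply: differentiable_row => j.
have -> : (fun y => mulmxr A y 0 j : R) =
    \sum_i (fun y : 'rV[R]_m => A i j * y 0 i).
  apply/funext => y; rewrite fct_sumE /= mxE.
  by apply: eq_bigr => i _; rewrite mulrC.
apply: differentiable_sum => i.
by apply: differentiableM; [exact: differentiable_cst|exact: differentiable_coord].
Qed.

Lemma continuous_mulmxr m n (A : 'M[R]_(m, n)) :
  continuous (mulmxr A : 'rV[R]_m -> 'rV[R]_n).
Proof. by move=> x; apply: differentiable_continuous; exact: differentiable_mulmxr. Qed.

Lemma differentiable_affine V m n (f : V -> 'rV[R]_m) (A : 'M[R]_(m, n)) c x :
  differentiable f x -> differentiable (fun y => f y *m A + c) x.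
Proof.
move=> df; apply: differentiableD; last exact: differentiable_cst.
exact: (differentiable_comp df (differentiable_mulmxr A _)).
Qed.

Lemma derive_affine V m n (f : V -> 'rV[R]_m) (A : 'M[R]_(m, n)) c x v :
  differentiable f x -> 'D_v (fun y => f y *m A + c) x = 'D_v f x *m A.
Proof.
move=> df; apply/rowP => j.
rewrite -derive_entry; last exact: differentiable_affine.
have -> : (fun y => (f y *m A + c) 0 j) =
    \sum_i (fun y => f y 0 i * A i j : R) + cst (c 0 j).
  by apply/funext => y; rewrite fctE fct_sumE /= !mxE.
have dfi i : derivable (fun y => f y 0 i : R) x v.
  by apply: diff_derivable; exact: differentiable_entry.
have dZ i : derivable (fun y => f y 0 i * A i j : R) x v.
  exact: (derivableM (dfi i) (derivable_cst (A i j) x v)).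
rewrite deriveD; [|exact: derivable_sum|exact: derivable_cst].
rewrite derive_cst addr0 derive_sum// mxE; apply: eq_bigr => i _.
by rewrite (deriveMr (A i j) (dfi i)) derive_entry// mulrC.
Qed.

Lemma jacobian_affine k m n (f : 'rV[R]_k -> 'rV[R]_m) (A : 'M[R]_(m, n)) c x :
  differentiable f x -> 'J (fun y => f y *m A + c) x = 'J f x *m A.
Proof.
move=> df; apply/row_matrixP => i; rewrite row_mul !rowE.
by rewrite -!deriveEjacobian ?derive_affine//; exact: differentiable_affine.
Qed.

Lemma row_jacobian m n (f : 'rV[R]_m -> 'rV[R]_n) x a :
  differentiable f x -> row a ('J f x) = 'D_(basis_vec a) f x.
Proof. by move=> df; rewrite deriveEjacobian// rowE. Qed.

Lemma jacobian_entry m n (f : 'rV[R]_m -> 'rV[R]_n) x a j :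
  differentiable f x -> 'J f x a j = 'D_(basis_vec a) f x 0 j.
Proof. by move=> df; rewrite -row_jacobian// [RHS]mxE. Qed.

Lemma differentiable_epsP V W (f : V -> W) x :
  differentiable f x <-> exists L : {linear V -> W}, continuous L /\
    forall e, 0 < e -> \forall h \near 0, `|f (h + x) - f x - L h| <= e * `|h|.
Proof.
split=> [df|[L [Lc dL]]].
  exists ('d f x); split; first exact: diff_continuous.
  move=> e e0; have /eqaddoP/(_ e e0) := diff_locally df.
  by apply: filterS => h; rewrite !fctE opprD addrA.
have dL' : f \o shift x = cst (f x) + L +o_ 0 id.
  apply/eqaddoP => e e0; apply: filterS (dL e e0) => h.
  by rewrite !fctE opprD addrA.
by apply/diff_locallyP; rewrite (diff_unique Lc dL').
Qed.

Lemma near_eq_differentiable V W (f g : V -> W) x :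
  (\forall y \near x, f y = g y) -> differentiable f x -> differentiable g x.
Proof.
move=> fg /differentiable_epsP[L [Lc dL]]; apply/differentiable_epsP.
exists L; split => // e e0; rewrite -(nbhs_singleton fg).
have fg0 : \forall h \near 0, f (h + x) = g (h + x).
  by move: fg; rewrite (near_shift 0 x) subr0.
by apply: filterS2 fg0 (dL e e0) => h <-.
Qed.

(** A derivative depends only on the germ of the function, and an open [U] is a neighbourhood of
    each of its points; so agreement on [U] survives every further derivative. *)
Lemma differentiable_foldr_eq V W (U : set V) (f g : V -> W) s x : open U ->
  (forall x, U x -> f x = g x) -> U x ->
  differentiable (foldr (fun v h => 'D_v h) f s) x ->
  differentiable (foldr (fun v h => 'D_v h) g s) x.
Proof.
move=> oU fg Ux.
have nU y : U y -> \forall z \near y, U z by move=> Uy; exact: open_nbhs_nbhs.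
have H : forall y, U y -> foldr (fun v h => 'D_v h) f s y =
    foldr (fun v h => 'D_v h) g s y.
  elim: s => [|v s IH] y Uy /=; first exact: fg.
  by apply: near_eq_derive; apply: filterS (nU y Uy).
by apply: near_eq_differentiable; apply: filterS (nU x Ux).
Qed.

Lemma smooth_on_eq V W (U : set V) (f g : V -> W) : open U ->
  (forall x, U x -> f x = g x) -> smooth_on U f -> smooth_on U g.
Proof.
by move=> oU fg sf s x Ux; exact: (differentiable_foldr_eq oU fg Ux (sf s x Ux)).
Qed.

Lemma smooth_on_sub V W (U U' : set V) (f : V -> W) :
  U' `<=` U -> smooth_on U f -> smooth_on U' f.
Proof. by move=> UU sf s x /UU; exact: sf. Qed.

Lemma smooth_on_differentiable V W (U : set V) (f : V -> W) x :
  smooth_on U f -> U x -> differentiable f x.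
Proof. by move=> /(_ [::]) /[apply]. Qed.

Lemma smooth_on_derive V W (U : set V) (f : V -> W) v :
  smooth_on U f -> smooth_on U ('D_v f).
Proof. by move=> sf s x Ux; have := sf (rcons s v) x Ux; rewrite foldr_rcons. Qed.

Lemma smooth_onP V W (U : set V) (f : V -> W) :
  smooth_on U f <-> (forall x, U x -> differentiable f x) /\
    forall v, smooth_on U ('D_v f).
Proof.
split=> [sf|[df sDf]].
  by split=> [x|v]; [exact: smooth_on_differentiable|exact: smooth_on_derive].
by elim/last_ind => [|s v _]//= x Ux; rewrite foldr_rcons; exact: sDf.
Qed.

Lemma smooth_on_cst V W (U : set V) (c : W) : smooth_on U (cst c).
Proof.
move=> s x _.
suff [c' ->] : exists c' : W, foldr (fun v h => 'D_v h) (cst c) s = cst c'.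
  exact: differentiable_cst.
elim: s => [|v s [c' /= ->]]; first by exists c.
by exists 0; apply/funext => y; exact: derive_cst.
Qed.

Lemma smooth_on_id V (U : set V) : smooth_on U (@id V).
Proof.
apply/smooth_onP; split => [x _|v]; first exact: ex_diff.
have -> : 'D_v (@id V) = cst v by apply/funext => y; exact: derive_id.
exact: smooth_on_cst.
Qed.

Lemma smooth_on_affine V m n (U : set V) (f : V -> 'rV[R]_m)
    (A : 'M[R]_(m, n)) c : open U ->
  smooth_on U f -> smooth_on U (fun y => f y *m A + c).
Proof.
(* The last vector of [s] is differentiated first, and the derivative of an affine image is the
   linear image of the derivative: hence induction from the right, with the constant reset to 0. *)
move=> oU sf s; elim/last_ind: s f c sf => [|s v IH] f c sf x Ux /=.
  by apply: differentiable_affine; exact: smooth_on_differentiable Ux.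
rewrite foldr_rcons.
apply: (differentiable_foldr_eq oU _ Ux) (IH ('D_v f) 0 (smooth_on_derive v sf) x Ux).
move=> y Uy; rewrite derive_affine ?addr0//.
exact: smooth_on_differentiable sf Uy.
Qed.

Lemma derive2_affine V m n (f : V -> 'rV[R]_m) (A : 'M[R]_(m, n)) c x v w :
  (\forall y \near x, differentiable f y) -> differentiable ('D_w f) x ->
  'D_v ('D_w (fun y => f y *m A + c)) x = 'D_v ('D_w f) x *m A.
Proof.
move=> df dDf; rewrite -(derive_affine A 0)//.
by apply: near_eq_derive; apply: filterS df => y dy; rewrite derive_affine ?addr0.
Qed.

Lemma derive2_affine_smooth V m n (U : set V) (f : V -> 'rV[R]_m)
    (A : 'M[R]_(m, n)) c x v w : open U -> smooth_on U f -> U x ->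
  'D_v ('D_w (fun y => f y *m A + c)) x = 'D_v ('D_w f) x *m A.
Proof.
move=> oU sf Ux; apply: derive2_affine.
  apply: filterS (open_nbhs_nbhs (conj oU Ux)) => y.
  exact: smooth_on_differentiable.
by apply: smooth_on_differentiable Ux; exact: smooth_on_derive.
Qed.

End RowCalculus.

(** * The simplex in its global chart *)

Section SimplexChart.
Variables (R : realType) (n : nat).

(** The constant differential of the affine map [prob]. Its rows form a basis of the vectors of sum
    zero, the tangent space of the simplex. *)
Definition prob_mx : 'M[R]_(n, n.+1) :=
  \matrix_(i, w) (if unlift ord_max w is Some j then (i == j)%:R else -1).

Definition eta_mx : 'M[R]_(n.+1, n) := \matrix_(w, i) (w == lift ord_max i)%:R.

Lemma probE (x : 'rV[R]_n) : prob x = x *m prob_mx + delta_mx 0 ord_max.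
Proof.
apply/rowP => w; rewrite !mxE eqxx /=.
case: unliftP => [j ->|->].
  rewrite (bigD1 j)//= mxE liftK eqxx mulr1 big1 ?addr0; last first.
    by move=> i /negPf ij; rewrite mxE liftK ij mulr0.
  by rewrite eq_sym (negPf (neq_lift _ _)) addr0.
rewrite eqxx addrC; congr (_ + _); rewrite -sumrN.
by apply: eq_bigr => i _; rewrite mxE unlift_none mulrN1.
Qed.

Lemma etaE (p : 'rV[R]_n.+1) : eta p = p *m eta_mx.
Proof.
apply/rowP => i; rewrite !mxE (bigD1 (lift ord_max i))//= mxE eqxx mulr1.
by rewrite big1 ?addr0// => w /negPf h; rewrite mxE h mulr0.
Qed.

Lemma prob_mx_eta : prob_mx *m eta_mx = 1%:M.
Proof.
apply/matrixP => i j; rewrite !mxE (bigD1 (lift ord_max j))//= !mxE eqxx mulr1.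
by rewrite liftK big1 ?addr0// => w /negPf h; rewrite !mxE h mulr0.
Qed.

Lemma probK : cancel (@prob R n) (@eta R n).
Proof. by move=> x; apply/rowP => i; rewrite !mxE liftK. Qed.

Lemma sum_unlift (F : 'I_n.+1 -> R) :
  \sum_w F w = \sum_i F (lift ord_max i) + F ord_max.
Proof.
rewrite big_ord_recr /=; congr (_ + _); apply: eq_bigr => i _; congr (F _).
by apply: val_inj; rewrite /= /bump leqNgt ltn_ord.
Qed.

Lemma etaK (p : 'rV[R]_n.+1) : \sum_w p 0 w = 1 -> prob (eta p) = p.
Proof.
move=> p1; apply/rowP => w; rewrite !mxE.
case: unliftP => [j ->|->]; first by rewrite mxE.
rewrite -p1 sum_unlift; under [in X in _ - X]eq_bigr do rewrite mxE.
by rewrite addrC addKr.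
Qed.

Lemma sum_prob (x : 'rV[R]_n) : \sum_w prob x 0 w = 1.
Proof.
rewrite sum_unlift !mxE unlift_none; under eq_bigr do rewrite mxE liftK.
by rewrite addrC subrK.
Qed.

Lemma eta_simplexP (x : 'rV[R]_n) : (0 < n)%N ->
  (@eta R n @` simplex n) x <-> forall w, 0 < prob x 0 w.
Proof.
move=> n0; split=> [[p [p0 p1] <-] w|x0].
  by rewrite etaK//; case/andP: (p0 w).
exists (prob x); last exact: probK.
split; last exact: sum_prob.
move=> w; rewrite x0 /= -(sum_prob x) (bigD1 w)//= ltrDl.
(* The bound [prob x 0 w < 1] comes from the positive mass of a second outcome, which exists because
   [0 < n]. *)
have [w' ww'] : exists w', w' != w.
  case: (eqVneq w ord0) => [->|h]; last by exists ord0; rewrite eq_sym.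
  by exists ord_max; apply/eqP => /(congr1 val) /=; case: (n) n0.
rewrite (bigD1 w')//= ltr_wpDr//; apply: sumr_ge0 => i _; exact: ltW.
Qed.

Lemma open_eta_simplex : (0 < n)%N -> open (@eta R n @` simplex n).
Proof.
move=> n0; rewrite openE => x /eta_simplexP => /(_ n0) x0.
have : \forall y \near x, forall w, 0 < prob y 0 w.
  apply: (@filter_forall _ _ (fun w y => 0 < prob y 0 w) (nbhs x)) => w.
  have cw : {for x, continuous (fun y : 'rV[R]_n => prob y 0 w : R)}.
    apply: differentiable_continuous; apply: differentiable_entry.
    have -> : @prob R n = (fun y : 'rV[R]_n => id y *m prob_mx + delta_mx 0 ord_max).
      by apply/funext => y; exact: probE.
    by apply: differentiable_affine; exact: ex_diff.
  by apply: (cw [set r | 0 < r]); apply: open_nbhs_nbhs; split; [exact: open_gt|exact: x0].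
by apply: filterS => y h; apply/eta_simplexP.
Qed.

End SimplexChart.

(** * Chain rule with a scalar outer function *)

Section ScalarChain.
Variables (R : realType) (V : normedModType R).

Lemma differentiable_comp1 (f : R -> R) (g : V -> R) x :
  differentiable g x -> derivable f (g x) 1 ->
  differentiable (fun y => f (g y)) x.
Proof.
move=> dg df; apply: (@differentiable_comp _ _ _ _ g f x dg).
exact/derivable1_diffP.
Qed.

Lemma derive_comp1 (f : R -> R) (g : V -> R) x v :
  differentiable g x -> derivable f (g x) 1 ->
  'D_v (fun y => f (g y)) x = derive1 f (g x) * 'D_v g x.
Proof.
move=> dg df; have df' : differentiable f (g x) by exact/derivable1_diffP.
rewrite deriveE; last exact: differentiable_comp1.
have -> : 'd (fun y => f (g y)) x v = 'd f (g x) ('d g x v).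
  exact: (congr1 (fun F => F v) (diff_comp dg df')).
by rewrite (deriv1E df) deriveE// mulrC.
Qed.

End ScalarChain.

(** * Components of the Fisher metric and of the e- and m-connections *)

Section FisherFormulas.
Variables (R : realType) (n : nat).
Implicit Type x : 'rV[R]_n.

Definition positive_at x := forall w, 0 < prob x 0 w.

Lemma prob_fun : @prob R n = (fun y : 'rV[R]_n => id y *m prob_mx R n + delta_mx 0 ord_max).
Proof. by apply/funext => y; exact: probE. Qed.

Lemma differentiable_prob x : differentiable (@prob R n) x.
Proof. by rewrite prob_fun; apply: differentiable_affine; exact: ex_diff. Qed.

Lemma derive_prob x v : 'D_v (@prob R n) x = v *m prob_mx R n.
Proof. by rewrite prob_fun derive_affine ?derive_id//; exact: ex_diff. Qed.

Lemma near_positive x : positive_at x -> \forall y \near x, positive_at y.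
Proof.
move=> x0; apply: (@filter_forall _ _ (fun w y => 0 < prob y 0 w) (nbhs x)) => w.
have cw : {for x, continuous (fun y : 'rV[R]_n => prob y 0 w : R)}.
  apply: differentiable_continuous; apply: differentiable_entry.
  exact: differentiable_prob.
by apply: (cw [set r | 0 < r]); apply: open_nbhs_nbhs; split; [exact: open_gt|exact: x0].
Qed.

Lemma derive_log_prob x w v : 0 < prob x 0 w ->
  'D_v (@log_prob R n w) x = (v *m prob_mx R n) 0 w / prob x 0 w.
Proof.
move=> x0; have [dl <-] := is_derive1_ln x0.
rewrite /log_prob derive_comp1 ?derive_entry ?derive_prob ?derive1E 1?mulrC//.
  exact: differentiable_prob.
by apply: differentiable_entry; exact: differentiable_prob.
Qed.

Lemma derive2_log_prob x w u v : 0 < prob x 0 w ->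
  'D_u ('D_v (@log_prob R n w)) x =
    - ((u *m prob_mx R n) 0 w * (v *m prob_mx R n) 0 w / prob x 0 w ^+ 2).
Proof.
move=> x0.
have dp : differentiable (fun y : 'rV[R]_n => prob y 0 w : R) x.
  by apply: differentiable_entry; exact: differentiable_prob.
have nx : \forall y \near x, 0 < prob y 0 w.
  have cw := differentiable_continuous dp.
  by apply: (cw [set r | 0 < r]); apply: open_nbhs_nbhs; split; [exact: open_gt|exact: x0].
rewrite (near_eq_derive (g := (v *m prob_mx R n) 0 w \*o
    (fun y => (prob y 0 w)^-1))); last first.
  by apply: filterS nx => y y0; rewrite derive_log_prob.
have n0 : prob x 0 w != 0 by rewrite gt_eqF.
rewrite deriveMl; last by apply: derivableV => //; exact: diff_derivable.
rewrite deriveV//; last exact: diff_derivable.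
rewrite derive_entry ?derive_prob; last exact: differentiable_prob.
by rewrite /GRing.scale/=; field.
Qed.

Lemma fisherE x : positive_at x -> fisher x =
  \matrix_(i, j) \sum_w prob_mx R n i w * prob_mx R n j w / prob x 0 w.
Proof.
move=> x0; apply/matrixP => i j; rewrite [LHS]mxE [RHS]mxE; apply: eq_bigr => w _.
have n0 : prob x 0 w != 0 by rewrite gt_eqF.
by rewrite !derive_log_prob// -!rowE ![row _ _ _ _]mxE; field.
Qed.

Lemma econnE x i j : positive_at x -> econn x i j =
  \row_k - \sum_w prob_mx R n i w * prob_mx R n j w * prob_mx R n k w
     / prob x 0 w ^+ 2.
Proof.
move=> x0; apply/rowP => k; rewrite [LHS]mxE [RHS]mxE -sumrN; apply: eq_bigr => w _.
have n0 : prob x 0 w != 0 by rewrite gt_eqF.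
rewrite derive_log_prob// derive2_log_prob// -!rowE ![row _ _ _ _]mxE.
by field.
Qed.

(** Differentiating [1 / p] in the Fisher metric produces the same cubic sum as [econnE], and the
    two cancel: the coordinates eta are affine for the mixture connection. *)
Lemma mconnE x i j : positive_at x -> mconn x i j = 0.
Proof.
move=> x0; apply/rowP => k; rewrite [LHS]mxE econnE// [X in _ - X]mxE [RHS]mxE.
rewrite (near_eq_derive (g := \sum_w (prob_mx R n k w * prob_mx R n j w \*o
    (fun y => (prob y 0 w)^-1)))); last first.
  by apply: filterS (near_positive x0) => y y0; rewrite fisherE// mxE fct_sumE.
have dp w : differentiable (fun y : 'rV[R]_n => prob y 0 w : R) x.
  by apply: differentiable_entry; exact: differentiable_prob.
have n0 w : prob x 0 w != 0 by rewrite gt_eqF.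
have dV w : derivable (fun y => (prob y 0 w)^-1) x (basis_vec i).
  by apply: derivableV => //; exact: diff_derivable.
rewrite derive_sum; last first.
  by move=> w; exact: (derivableM (derivable_cst _ x (basis_vec i)) (dV w)).
rewrite opprK -big_split big1// => w _ /=.
rewrite deriveMl// deriveV//; last exact: diff_derivable.
rewrite derive_entry ?derive_prob; last exact: differentiable_prob.
by rewrite /GRing.scale/= -rowE [row _ _ _ _]mxE; field.
Qed.

End FisherFormulas.

(** * Weighted Gram matrices *)

Section WeightedGram.
Variables (R : realType) (N : nat) (p : 'rV[R]_N).

(** Turns tangent vectors at [p], stored as rows, into their scores; [gram] is then the matrix of
    their Fisher inner products. *)
Definition wdiv m (A : 'M[R]_(m, N)) : 'M[R]_(m, N) :=
  \matrix_(i, w) (A i w / p 0 w).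

Lemma wdivM k m (B : 'M[R]_(k, m)) (A : 'M[R]_(m, N)) :
  wdiv (B *m A) = B *m wdiv A.
Proof.
apply/matrixP => i w; rewrite !mxE mulr_suml.
by apply: eq_bigr => j _; rewrite mxE mulrA.
Qed.

Definition gram m (A : 'M[R]_(m, N)) : 'M[R]_m := wdiv A *m A^T.

Lemma gramE m (A : 'M[R]_(m, N)) i j :
  gram A i j = \sum_w A i w * A j w / p 0 w.
Proof. by rewrite mxE; apply: eq_bigr => w _; rewrite !mxE mulrAC. Qed.

Lemma gramM k m (B : 'M[R]_(k, m)) (A : 'M[R]_(m, N)) :
  gram (B *m A) = B *m gram A *m B^T.
Proof. by rewrite /gram wdivM trmx_mul !mulmxA. Qed.

Hypothesis p_gt0 : forall w, 0 < p 0 w.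

Lemma wdiv_inj m (A B : 'M[R]_(m, N)) : wdiv A = wdiv B -> A = B.
Proof.
move=> /matrixP AB; apply/matrixP => i w; have := AB i w; rewrite !mxE.
by apply: mulIf; rewrite invr_eq0 gt_eqF.
Qed.

Lemma row_free_wdiv m (A : 'M[R]_(m, N)) : row_free A -> row_free (wdiv A).
Proof.
move=> rA; apply: inj_row_free => v; rewrite -wdivM => h.
apply/eqP; rewrite -(mulmx_free_eq0 v rA); apply/eqP/wdiv_inj.
by rewrite h; apply/matrixP => i j; rewrite !mxE mul0r.
Qed.

Lemma gram_ge0 (v : 'rV[R]_N) : 0 <= gram v 0 0.
Proof.
rewrite gramE; apply: sumr_ge0 => w _.
by apply: divr_ge0; [rewrite -expr2 sqr_ge0|exact: ltW].
Qed.

Lemma gram_eq0 (v : 'rV[R]_N) : gram v 0 0 = 0 -> v = 0.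
Proof.
rewrite gramE => /eqP; rewrite psumr_eq0; last first.
  by move=> w _; apply: divr_ge0; [rewrite -expr2 sqr_ge0|exact: ltW].
move=> /allP h; apply/rowP => w; have := h w (mem_index_enum w).
by rewrite mxE /= mulf_eq0 invr_eq0 (gt_eqF (p_gt0 w)) orbF -expr2 sqrf_eq0 => /eqP.
Qed.

Lemma gram_unit m (A : 'M[R]_(m, N)) : row_free A -> gram A \in unitmx.
Proof.
move=> rA; rewrite -row_free_unit; apply: inj_row_free => v h.
apply/eqP; rewrite -(mulmx_free_eq0 v rA); apply/eqP/gram_eq0.
by rewrite gramM h mul0mx mxE.
Qed.

End WeightedGram.

(** * Constants as the kernel of the pairing with tangent vectors *)

Section Constants.
Variables (R : realType) (n : nat).
Local Notation L := (prob_mx R n).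

Lemma row_free_prob_mx : row_free L.
Proof. by apply/row_freeP; exists (eta_mx R n); exact: prob_mx_eta. Qed.

Lemma sum_mul_prob_mx (v : 'rV[R]_n) : \sum_w (v *m L) 0 w = 0.
Proof.
have s1 : \sum_w (delta_mx 0 ord_max : 'rV[R]_n.+1) 0 w = 1.
  rewrite (bigD1 ord_max)//= mxE !eqxx big1 ?addr0// => w /negPf h.
  by rewrite mxE h andbF.
have := sum_prob v; rewrite -[RHS]s1 -[RHS]add0r.
under eq_bigr do rewrite probE mxE.
by rewrite big_split /= => /addIr.
Qed.

Lemma const_mulT_prob_mx (c : R) : (const_mx c : 'rV[R]_n.+1) *m L^T = 0.
Proof.
apply/rowP => i; rewrite !mxE.
under eq_bigr do rewrite !mxE.
rewrite -mulr_sumr; have := sum_mul_prob_mx (delta_mx 0 i).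
rewrite -rowE; under eq_bigr do rewrite mxE mxE.
by move=> ->; rewrite mulr0.
Qed.

(** Multiplication by the transpose of [prob_mx] pairs a function with the vectors of sum zero, so
    only constants are lost. Identities of scores obtained this way carry an unknown constant. *)
Lemma mulT_prob_mx_eq0 (r : 'rV[R]_n.+1) : r *m L^T = 0 -> exists c, r = const_mx c.
Proof.
move=> h; exists (r 0 ord_max); apply/rowP => w; rewrite mxE.
case: (unliftP ord_max w) => [j ->|->//].
have := congr1 (fun M : 'rV[R]_n => M 0 j) h.
rewrite mxE sum_unlift !mxE unlift_none mulrN1 => /eqP; rewrite subr_eq0 => /eqP <-.
rewrite (bigD1 j)//= !mxE liftK eqxx mulr1 big1 ?addr0// => i ij.
by rewrite !mxE liftK eq_sym (negPf ij) mulr0.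
Qed.

Lemma etaT_prob_mxT : (eta_mx R n)^T *m L^T = 1%:M.
Proof. by rewrite -trmx_mul prob_mx_eta trmx1. Qed.

End Constants.

(** * Second fundamental forms through scores *)

Section Scores.
Variables (R : realType) (n m : nat) (x : 'rV[R]_m -> 'rV[R]_n) (u : 'rV[R]_m).
Hypothesis x_pos : positive_at (x u).
Local Notation L := (prob_mx R n).
Local Notation p := (prob (x u)).
Local Notation g := (fisher (x u)).

Definition tangent_mx : 'M[R]_(m, n.+1) := 'J x u *m L.
Local Notation T := tangent_mx.
Definition score_mx : 'M[R]_(m, n.+1) := wdiv p T.
Local Notation F := score_mx.
Definition hess a b : 'rV[R]_n.+1 := 'D_(basis_vec a) ('D_(basis_vec b) x) u *m L.

Definition mscore a b : 'rV[R]_n.+1 := wdiv p (hess a b).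
Definition escore a b : 'rV[R]_n.+1 :=
  \row_w (mscore a b 0 w - F a w * F b w).

Lemma fisher_gram : g = gram p L.
Proof. by rewrite fisherE//; apply/matrixP => i j; rewrite gramE mxE. Qed.

Lemma fisher_unit : g \in unitmx.
Proof. by rewrite fisher_gram gram_unit//; exact: row_free_prob_mx. Qed.

Lemma mul_fisher k (z : 'M[R]_(k, n)) : z *m g = wdiv p (z *m L) *m L^T.
Proof. by rewrite fisher_gram /gram wdivM mulmxA. Qed.

Lemma induced_metricE : induced_metric fisher x u = gram p T.
Proof. by rewrite /induced_metric fisher_gram gramM. Qed.

Lemma nabla_along_mconn a b :
  nabla_along fisher mconn x u a b *m g = mscore a b *m L^T.
Proof.
rewrite /nabla_along mulmxDl [X in _ + X *m _]big1 ?mul0mx ?addr0; last first.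
  by move=> i _; rewrite big1// => j _; rewrite /nabla_basis mconnE// mul0mx scaler0.
exact: mul_fisher.
Qed.

(** Multiplying by [g] cancels the inverse metric in [nabla_basis] and leaves Christoffel symbols of
    the first kind; once the sum over outcomes is outermost, the sums over [i] and [j] factor into a
    product of two scores. *)
Lemma nabla_along_econn a b :
  nabla_along fisher econn x u a b *m g = escore a b *m L^T.
Proof.
rewrite /nabla_along mulmxDl mul_fisher.
have -> : escore a b = mscore a b - \row_w (F a w * F b w).
  by apply/rowP => w; rewrite !mxE.
rewrite mulmxBl; congr (_ + _).
rewrite mulmx_suml; under eq_bigr => i _.
  rewrite mulmx_suml; under eq_bigr => j _.
    rewrite -scalemxAl mulmxKV ?fisher_unit// econnE//.
  over.
over.
apply/rowP => k; rewrite summxE; under eq_bigr do rewrite summxE.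
transitivity (\sum_(i < n) \sum_(j < n) \sum_w
    - ('J x u a i * L i w * ('J x u b j * L j w) * (L k w / p 0 w ^+ 2))).
  apply: eq_bigr => i _; apply: eq_bigr => j _.
  rewrite [LHS]mxE [X in _ * X]mxE mulrN mulr_sumr -sumrN.
  by apply: eq_bigr => w _; congr (- _); field; rewrite gt_eqF.
under eq_bigr do rewrite exchange_big /=.
rewrite exchange_big /= !mxE -sumrN; apply: eq_bigr => w _.
have -> : (\row_w (F a w * F b w)) 0 w * L^T w k =
    T a w * T b w * (L k w / p 0 w ^+ 2).
  rewrite [X in X * _]mxE [L^T w k]mxE [F a w]mxE [F b w]mxE; field.
  by rewrite gt_eqF.
rewrite [T a w]mxE [T b w]mxE big_distrlr /= mulr_suml -sumrN.
apply: eq_bigr => i _; rewrite mulr_suml -sumrN; apply: eq_bigr => j _ //.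
Qed.

Lemma jac_fisher : 'J x u *m g = F *m L^T.
Proof. exact: mul_fisher. Qed.

Lemma mean_tangent (v : 'rV[R]_m) : \sum_w (v *m T) 0 w = 0.
Proof. by rewrite mulmxA sum_mul_prob_mx. Qed.

Lemma mulF_p (v : 'rV[R]_m) w : (v *m F) 0 w * p 0 w = (v *m T) 0 w.
Proof. by rewrite -wdivM mxE divfK// gt_eqF. Qed.

Lemma induced_econnE a b :
  induced_connection fisher econn x u a b = escore a b *m T^T.
Proof.
by rewrite /induced_connection nabla_along_econn /tangent_mx trmx_mul mulmxA.
Qed.

Lemma normal_partD w w' :
  normal_part fisher x u (w + w') = normal_part fisher x u w + normal_part fisher x u w'.
Proof. by rewrite /normal_part !mulmxDl opprD addrACA. Qed.

Lemma normal_partZ c w :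
  normal_part fisher x u (c *: w) = c *: normal_part fisher x u w.
Proof. by rewrite /normal_part -!scalemxAl scalerBr. Qed.

Lemma normal_part0 : normal_part fisher x u 0 = 0.
Proof. by rewrite /normal_part !mul0mx subr0. Qed.

Lemma second_fundamental_formE G (v w : 'rV[R]_m) :
  second_fundamental_form fisher G x u v w = normal_part fisher x u
    (\sum_a \sum_b (v 0 a * w 0 b) *: nabla_along fisher G x u a b).
Proof.
rewrite (big_morph _ normal_partD normal_part0); apply: eq_bigr => a _.
rewrite (big_morph _ normal_partD normal_part0); apply: eq_bigr => b _.
by rewrite normal_partZ.
Qed.

Lemma mul_score_prod (v w : 'rV[R]_m) om :
  (v *m F) 0 om * (w *m F) 0 om =
  \sum_a \sum_b (v 0 a * w 0 b) * (F a om * F b om).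
Proof.
rewrite !mxE big_distrlr /=; apply: eq_bigr => a _; apply: eq_bigr => b _.
by rewrite mulrACA.
Qed.

Lemma induced_metric_score (v w : 'rV[R]_m) :
  (v *m induced_metric fisher x u *m w^T) 0 0 =
  \sum_om p 0 om * ((v *m F) 0 om * (w *m F) 0 om).
Proof.
rewrite induced_metricE /gram mulmxA -mulmxA -trmx_mul mxE.
by apply: eq_bigr => om _; rewrite [(w *m T)^T _ _]mxE -mulF_p; ring.
Qed.

(** The m- and e-derivatives differ exactly by the product of two scores, so subtracting the two
    umbilicity equations says that this product, up to a multiple of a fixed normal vector, is
    tangent. *)
Lemma umbilical_score_algebra (H1 H2 : 'rV[R]_n) :
  (forall v w, second_fundamental_form fisher mconn x u v w =
     (v *m induced_metric fisher x u *m w^T) 0 0 *: H1) ->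
  (forall v w, second_fundamental_form fisher econn x u v w =
     (v *m induced_metric fisher x u *m w^T) 0 0 *: H2) ->
  exists k : 'rV[R]_n.+1, forall v w : 'rV[R]_m, exists tau : 'rV[R]_m,
    forall om, (v *m F) 0 om * (w *m F) 0 om = (tau *m F) 0 om +
      (\sum_om' p 0 om' * ((v *m F) 0 om' * (w *m F) 0 om')) * k 0 om.
Proof.
move=> B1 B2.
(* A function representing the covector dual to [H1 - H2]: by [etaT_prob_mxT], pairing it with the
   tangent basis returns [(H1 - H2) *m g]. *)
pose kap : 'rV[R]_n.+1 := (H1 - H2) *m g *m (eta_mx R n)^T.
(* The added constant gives [k] mean 1, as the mean of a product of scores requires. *)
exists (kap + const_mx (1 - \sum_om p 0 om * kap 0 om)) => v w.
rewrite -induced_metric_score; set s := (v *m _ *m _) 0 0.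
set z := \sum_a \sum_b (v 0 a * w 0 b) *:
  (nabla_along fisher mconn x u a b - nabla_along fisher econn x u a b).
have zN : normal_part fisher x u z = s *: (H1 - H2).
  rewrite scalerBr -B1 -B2 !second_fundamental_formE -[X in _ - X]scale1r -scalerN.
  rewrite scalerN -scaleNr -normal_partZ -normal_partD; congr normal_part.
  rewrite scaleN1r -sumrB; apply: eq_bigr => a _; rewrite -sumrB.
  by apply: eq_bigr => b _; rewrite scalerBr.
pose fvw := \row_om ((v *m F) 0 om * (w *m F) 0 om).
have zg : z *m g = fvw *m L^T.
  rewrite mulmx_suml; under eq_bigr => a _.
    rewrite mulmx_suml; under eq_bigr => b _.
      rewrite -scalemxAl mulmxBl nabla_along_mconn nabla_along_econn -mulmxBl scalemxAl.
    over.
  rewrite -mulmx_suml; over.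
  rewrite -mulmx_suml; congr (_ *m _).
  apply/rowP => om; rewrite [RHS]mxE mul_score_prod summxE; apply: eq_bigr => a _.
  rewrite summxE; apply: eq_bigr => b _.
  by rewrite [LHS]mxE [X in _ * X = _]mxE [X in _ * (_ + X) = _]mxE [escore _ _ _ _]mxE opprB addrC subrK.
exists (z *m g *m ('J x u)^T *m invmx (induced_metric fisher x u)).
set tau := _ *m invmx _.
have h : (fvw - tau *m F - s *: kap) *m L^T = 0.
  rewrite !mulmxBl -zg -[tau *m F *m _]mulmxA -jac_fisher -scalemxAl.
  rewrite -[kap *m _]mulmxA etaT_prob_mxT mulmx1 scalemxAl -zN /normal_part -/tau.
  by rewrite mulmxBl mulmxA subrr.
have [c hc] := mulT_prob_mx_eq0 h.
have E om : fvw 0 om = (tau *m F) 0 om + s * kap 0 om + c.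
  have := congr1 (fun M : 'rV[R]_n.+1 => M 0 om) hc.
  have -> : (fvw - tau *m F - s *: kap) 0 om =
      fvw 0 om - (tau *m F) 0 om - s * kap 0 om by rewrite !mxE.
  by rewrite [const_mx _ _ _]mxE => <-; ring.
(* The constant is found by taking means: the product has mean [s] and the tangent score has mean
   0. *)
have cE : c = s * (1 - \sum_om p 0 om * kap 0 om).
  have : s = \sum_om p 0 om * fvw 0 om.
    by rewrite /s induced_metric_score; apply: eq_bigr => om _; rewrite [fvw _ _]mxE.
  under eq_bigr do rewrite E !mulrDr.
  rewrite !big_split /= -mulr_suml sum_prob mul1r.
  under eq_bigr do rewrite mulrC mulF_p.
  rewrite mean_tangent add0r mulrBr mulr1 mulr_sumr => {1}->.
  by rewrite addrAC (eq_bigr _ (fun om _ => mulrCA _ _ _)) subrr add0r.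
move=> om; have -> : (kap + const_mx (1 - \sum_om p 0 om * kap 0 om)) 0 om =
  kap 0 om + (1 - \sum_om p 0 om * kap 0 om) by rewrite !mxE.
by rewrite mulrDr -cE addrA -E [fvw _ _]mxE.
Qed.

Lemma normal_part_tangent (r : 'rV[R]_m) : row_free T ->
  normal_part fisher x u (r *m 'J x u) = 0.
Proof.
move=> rT; have uG : induced_metric fisher x u \in unitmx.
  by rewrite induced_metricE gram_unit.
rewrite /normal_part.
have -> : r *m 'J x u *m g *m ('J x u)^T *m invmx (induced_metric fisher x u) = r.
  by rewrite -!(mulmxA r) mulmxV ?mulmx1.
by rewrite subrr.
Qed.

Lemma normal_part_eq0 (z : 'rV[R]_n) :
  normal_part fisher x u z = 0 -> exists r, z = r *m 'J x u.
Proof. by move=> /subr0_eq ->; eexists. Qed.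

(** Tangent scores have no normal part and constants pair to zero with tangent vectors, so only the
    [kap] term of the decomposition survives. Cellular families use this for both connections. *)
Lemma second_fundamental_form_decomp G (rho : 'I_m -> 'I_m -> 'rV[R]_n.+1) kap :
  row_free T ->
  (forall a b, nabla_along fisher G x u a b *m g = rho a b *m L^T) ->
  (forall a b, exists r c, rho a b = r *m F + gram p T a b *: kap + const_mx c) ->
  forall v w, second_fundamental_form fisher G x u v w =
    (v *m induced_metric fisher x u *m w^T) 0 0
      *: normal_part fisher x u (kap *m L^T *m invmx g).
Proof.
move=> rT nab dec v w; set N := normal_part _ _ _ _.
have nN a b : normal_part fisher x u (nabla_along fisher G x u a b) =
    induced_metric fisher x u a b *: N.
  have [r [c rhoE]] := dec a b.
  have -> : nabla_along fisher G x u a b =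
      r *m 'J x u + gram p T a b *: (kap *m L^T *m invmx g).
    apply: (can_inj (mulmxK fisher_unit)).
    rewrite nab rhoE !mulmxDl const_mulT_prob_mx addr0 -mulmxA -jac_fisher mulmxA.
    by rewrite -!scalemxAl mulmxKV ?fisher_unit.
  by rewrite normal_partD normal_part_tangent// add0r normal_partZ induced_metricE.
rewrite /second_fundamental_form; under eq_bigr => a _.
  under eq_bigr => b _ do rewrite nN scalerA.
  rewrite -scaler_suml; over.
rewrite -scaler_suml; congr (_ *: _); rewrite mxE exchange_big /=.
apply: eq_bigr => b _; rewrite mxE mulr_suml; apply: eq_bigr => a _.
by rewrite [w^T _ _]mxE mulrAC.
Qed.

Lemma mean_curvature_umbilic G N E : (0 < m)%N ->
  orthonormal_frame fisher x u E ->
  (forall v w, second_fundamental_form fisher G x u v w =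
     (v *m induced_metric fisher x u *m w^T) 0 0 *: N) ->
  mean_curvature fisher G x u E = N.
Proof.
move=> m0 oE sN; rewrite /mean_curvature; under eq_bigr => i _.
  rewrite sN; have -> : (row i E *m induced_metric fisher x u *m (row i E)^T) 0 0 =
    (E *m induced_metric fisher x u *m E^T) i i.
    rewrite -row_mul [LHS]mxE [RHS]mxE; apply: eq_bigr => j _.
    by rewrite [row _ _ _ _]mxE [(row i E)^T _ _]mxE [row _ _ _ _]mxE [E^T _ _]mxE.
  rewrite oE mxE eqxx scale1r; over.
rewrite sumr_const card_ord -[N *+ m]scaler_nat scalerA mulVf ?scale1r//.
by rewrite pnatr_eq0 -lt0n.
Qed.

End Scores.

(** [umbilical] speaks only about given frames, so one must exist. Rows are added one at a time:
    while [k < m], a rank count leaves a nonzero vector orthogonal to the first [k] rows, which is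
    then normalised. *)
Lemma orthonormal_exists (R : realType) m (G : 'M[R]_m) : G^T = G ->
  (forall v : 'rV[R]_m, v != 0 -> 0 < (v *m G *m v^T) 0 0) ->
  exists E : 'M[R]_m, E *m G *m E^T = 1%:M.
Proof.
move=> sG pG.
have H k : (k <= m)%N -> exists E : 'M[R]_(k, m), E *m G *m E^T = 1%:M.
  elim: k => [_|k IH km].
    by exists 0; apply/matrixP => -[].
  have [E EE] := IH (ltnW km).
  have : kermx (G *m E^T) != 0.
    rewrite -mxrank_eq0 mxrank_ker subn_eq0 -ltnNge.
    exact: leq_ltn_trans (rank_leq_col _) km.
  move=> /rowV0Pn[v /sub_kermxP vk v0].
  have vv := pG v v0; set c := (v *m G *m v^T) 0 0 in vv.
  pose w := (Num.sqrt c)^-1 *: v.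
  have wE : w *m G *m E^T = 0 by rewrite -!scalemxAl -mulmxA vk scaler0.
  have ww : w *m G *m w^T = 1%:M.
    rewrite [LHS]mx11_scalar; congr (_%:M).
    rewrite /w linearZ /= -scalemxAr -!scalemxAl scalerA mxE -/c.
    by rewrite -invfM -expr2 sqr_sqrtr ?mulVf ?gt_eqF// ltW.
  have Ew : E *m G *m w^T = 0.
    by apply: trmx_inj; rewrite trmx0 !trmx_mul trmxK sG mulmxA.
  have h : col_mx w E *m G *m (col_mx w E)^T = 1%:M.
    by rewrite mul_col_mx tr_col_mx mul_col_row ww wE Ew EE -scalar_mx_block.
  by exists (col_mx w E); exact: h.
exact: H.
Qed.

(** * Subalgebras of functions on a finite set *)

Section ScoreAlgebra.
Variables (R : realType) (N m : nat) (p : 'rV[R]_N) (F : 'M[R]_(m, N)) (k : 'rV[R]_N).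
Hypothesis m_ge2 : (2 <= m)%N.
Hypothesis p_gt0 : forall w, 0 < p 0 w.
Hypothesis F_free : row_free F.
Hypothesis F_mean : forall v : 'rV[R]_m, \sum_w p 0 w * (v *m F) 0 w = 0.

Definition hadamard (f h : 'rV[R]_N) : 'rV[R]_N := \row_w (f 0 w * h 0 w).
Definition weighted_dot (f h : 'rV[R]_N) := \sum_w p 0 w * (f 0 w * h 0 w).

Hypothesis F_alg : forall v w : 'rV[R]_m, exists tau : 'rV[R]_m,
  forall om, (v *m F) 0 om * (w *m F) 0 om = (tau *m F) 0 om +
      (\sum_om' p 0 om' * ((v *m F) 0 om' * (w *m F) 0 om')) * k 0 om.

Definition score_span : 'M[R]_(m + 1, N) := col_mx F k.
Local Notation A := score_span.

Lemma score_spanP (f : 'rV[R]_N) :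
  reflect (exists v c, f = v *m F + c *: k) (f <= A)%MS.
Proof.
apply: (iffP idP) => [/submxP[D ->]|[v [c ->]]].
  rewrite -[D]hsubmxK mul_row_col; exists (lsubmx D), (rsubmx D 0 0).
  by rewrite [rsubmx D in LHS]mx11_scalar mul_scalar_mx.
by apply/submxP; exists (row_mx v c%:M); rewrite mul_row_col mul_scalar_mx.
Qed.

Lemma weighted_dot_gt0 f : f != 0 -> 0 < weighted_dot f f.
Proof.
move=> f0; have h0 w : 0 <= p 0 w * (f 0 w * f 0 w).
  by apply: mulr_ge0; [exact: ltW|rewrite -expr2 sqr_ge0].
rewrite lt_def sumr_ge0 ?andbT//; apply: contraNneq f0 => /eqP.
rewrite psumr_eq0// => /allP h; apply/eqP/rowP => w; have := h w (mem_index_enum w).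
by rewrite mxE /= mulf_eq0 (gt_eqF (p_gt0 w)) -expr2 sqrf_eq0 => /eqP.
Qed.

Lemma weighted_dotC f h : weighted_dot f h = weighted_dot h f.
Proof. by apply: eq_bigr => w _; rewrite [f 0 w * _]mulrC. Qed.

Lemma weighted_dotZ f c h : weighted_dot f (c *: h) = c * weighted_dot f h.
Proof.
by rewrite mulr_sumr; apply: eq_bigr => w _; rewrite mxE; ring.
Qed.

Lemma hadamard_score (f h : 'rV[R]_N) : (f <= F)%MS -> (h <= F)%MS ->
  exists2 g, (g <= F)%MS & hadamard f h = g + weighted_dot f h *: k.
Proof.
move=> /submxP[v ->] /submxP[w ->]; have [tau E] := F_alg v w.
exists (tau *m F); first exact: submxMl.
by apply/rowP => om; rewrite [LHS]mxE E [RHS]mxE [X in _ = _ + X]mxE.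
Qed.

Lemma score_sub_span (f : 'rV[R]_N) : (f <= F)%MS -> (f <= A)%MS.
Proof. by move=> /submxP[v ->]; apply/score_spanP; exists v, 0; rewrite scale0r addr0. Qed.

Lemma k_sub_span : (k <= A)%MS.
Proof. by apply/score_spanP; exists 0, 1; rewrite mul0mx add0r scale1r. Qed.

Lemma hadamardC f h : hadamard f h = hadamard h f.
Proof. by apply/rowP => w; rewrite !mxE mulrC. Qed.

Lemma hadamardA f g h : hadamard f (hadamard g h) = hadamard (hadamard f g) h.
Proof. by apply/rowP => w; rewrite !mxE mulrA. Qed.

Lemma hadamardDr f g h : hadamard f (g + h) = hadamard f g + hadamard f h.
Proof. by apply/rowP => w; rewrite !mxE mulrDr. Qed.

Lemma hadamardZr f c h : hadamard f (c *: h) = c *: hadamard f h.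
Proof. by apply/rowP => w; rewrite !mxE mulrCA. Qed.

(* [2 <= m] is needed here only; elsewhere [0 < m] suffices. *)
Lemma orthogonal_score (h : 'rV[R]_N) :
  exists f : 'rV[R]_N, [/\ (f <= F)%MS, f != 0 & weighted_dot f h = 0].
Proof.
pose c : 'cV[R]_m := \col_i weighted_dot (row i F) h.
have : kermx c != 0.
  rewrite -mxrank_eq0 mxrank_ker subn_eq0 -ltnNge.
  exact: leq_ltn_trans (rank_leq_col _) m_ge2.
move=> /rowV0Pn[v /sub_kermxP vc v0]; exists (v *m F); split.
- exact: submxMl.
- by rewrite mulmx_free_eq0.
have := congr1 (fun M : 'M[R]_1 => M 0 0) vc; rewrite !mxE => <-.
rewrite /weighted_dot; under eq_bigr do rewrite mxE mulr_suml mulr_sumr.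
rewrite exchange_big; apply: eq_bigr => i _; rewrite mxE mulr_sumr.
by apply: eq_bigr => w _; rewrite mxE; ring.
Qed.

(** In the mean of [f f = g + <f, f> k] for a nonzero score [f], the term [g] drops out. *)
Lemma mean_k : \sum_w p 0 w * k 0 w = 1.
Proof.
have [f [fF f0 _]] := orthogonal_score 0.
have [g /submxP[tau ->] E] := hadamard_score fF fF.
have : weighted_dot f f = weighted_dot f f * \sum_w p 0 w * k 0 w.
  rewrite mulr_sumr -[RHS]add0r -[X in _ = X + _](F_mean tau) -big_split /=.
  apply: eq_bigr => w _; have := congr1 (fun M : 'rV[R]_N => M 0 w) E.
  rewrite [LHS]mxE [RHS]mxE [X in _ = _ + X]mxE => ->; ring.
rewrite -{1}[weighted_dot f f]mulr1 => /mulfI <-//.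
by rewrite gt_eqF// weighted_dot_gt0.
Qed.

(** Scores have mean 0 and [k] has mean 1, so [k] is independent of them. *)
Lemma rank_score_span : \rank A = m.+1.
Proof.
have -> : \rank A = \rank (F + k)%MS by rewrite addsmxE.
have k0 : k != 0.
  apply/eqP => k0; have := mean_k; rewrite big1 => [/eqP|w _].
    by rewrite eq_sym oner_eq0.
  by rewrite k0 mxE mulr0.
have kF : (F :&: k = 0)%MS.
  apply/eqP/rowV0P => f; rewrite sub_capmx => /andP[/submxP[v ->] /sub_rVP[c fc]].
  have c0 : c = 0.
    rewrite -[c]mulr1 -mean_k mulr_sumr -[RHS](F_mean v).
    by apply: eq_bigr => w _; rewrite fc mxE mulrCA.
  by rewrite fc c0 scale0r.
rewrite mxrank_disjoint_sum// (eqP F_free) rank_rV k0 addn1//.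
Qed.

(** For a score [f] orthogonal to [h], the product [f h] has no [k] component and is again a score.
    Eliminating [k] through [f f = g + <f, f> k] then expresses [k h] by the products [f (f h)] and
    [g h] of scores. *)
Lemma k_mul_score (h : 'rV[R]_N) : (h <= F)%MS -> (hadamard k h <= A)%MS.
Proof.
move=> hF; have [f [fF f0 fh]] := orthogonal_score h.
have [g gF Eff] := hadamard_score fF fF; have [g' gF' Efh] := hadamard_score fF hF.
have [g1 gF1 E1] := hadamard_score gF hF; have [g2 gF2 E2] := hadamard_score fF gF'.
have c0 : weighted_dot f f != 0 by rewrite gt_eqF// weighted_dot_gt0.
have -> : hadamard k h = (weighted_dot f f)^-1 *: (hadamard f (hadamard f h) - hadamard g h).
  rewrite hadamardA Eff; apply/rowP => w; rewrite !mxE; field.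
  exact: c0.
rewrite Efh fh scale0r addr0 E1 E2.
apply: scalemx_sub; apply: addmx_sub; rewrite ?eqmx_opp.
  by apply: addmx_sub; [exact: score_sub_span|exact/scalemx_sub/k_sub_span].
by apply: addmx_sub; [exact: score_sub_span|exact/scalemx_sub/k_sub_span].
Qed.

Lemma span_mul (f h : 'rV[R]_N) : (f <= A)%MS -> (h <= A)%MS -> (hadamard f h <= A)%MS.
Proof.
have FF f1 h1 : (f1 <= F)%MS -> (h1 <= F)%MS -> (hadamard f1 h1 <= A)%MS.
  move=> fF hF; have [g gF ->] := hadamard_score fF hF.
  by apply: addmx_sub; [exact: score_sub_span|exact/scalemx_sub/k_sub_span].
have FA f1 h1 : (f1 <= F)%MS -> (h1 <= A)%MS -> (hadamard f1 h1 <= A)%MS.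
  move=> fF /score_spanP[v [c ->]]; rewrite hadamardDr hadamardZr.
  apply: addmx_sub; first by apply: FF => //; exact: submxMl.
  by apply: scalemx_sub; rewrite hadamardC k_mul_score.
(* One factor [k] is eliminated through [f1 f1 = g + <f1, f1> k]; the rest are products of a score
   with an element of the span. *)
have kk : (hadamard k k <= A)%MS.
  have [f1 [fF f0 _]] := orthogonal_score 0.
  have [g gF Eff] := hadamard_score fF fF.
  have c0 : weighted_dot f1 f1 != 0 by rewrite gt_eqF// weighted_dot_gt0.
  have -> : hadamard k k = (weighted_dot f1 f1)^-1 *:
      (hadamard f1 (hadamard f1 k) - hadamard g k).
    rewrite hadamardA Eff; apply/rowP => w; rewrite !mxE; field.
    exact: c0.
  apply: scalemx_sub; apply: addmx_sub; rewrite ?eqmx_opp.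
    by apply: FA => //; rewrite hadamardC k_mul_score.
  by rewrite hadamardC k_mul_score.
move=> /score_spanP[v [c ->]] hA; rewrite hadamardC hadamardDr hadamardZr.
apply: addmx_sub; first by rewrite hadamardC FA// submxMl.
apply: scalemx_sub.
have /score_spanP[v' [c' ->]] := hA; rewrite hadamardC hadamardDr hadamardZr.
apply: addmx_sub; last exact: scalemx_sub.
by apply: k_mul_score; exact: submxMl.
Qed.

Definition tied (i j : 'I_N) : bool := col i F == col j F.
Definition frozen (j : 'I_N) : bool := col j F == 0.

Lemma tiedP i j : reflect (forall v : 'rV[R]_m, (v *m F) 0 i = (v *m F) 0 j) (tied i j).
Proof.
apply: (iffP eqP) => [E v|E].
  have E' a : F a i = F a j by have := congr1 (fun M : 'cV_m => M a 0) E; rewrite !mxE.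
  by rewrite !mxE; apply: eq_bigr => a _; rewrite E'.
apply/colP => a; have := E (delta_mx 0 a); rewrite -rowE => E'.
by move: E'; rewrite !mxE.
Qed.

Lemma frozenP j : reflect (forall v : 'rV[R]_m, (v *m F) 0 j = 0) (frozen j).
Proof.
apply: (iffP eqP) => [E v|E].
  have E' a : F a j = 0 by have := congr1 (fun M : 'cV_m => M a 0) E; rewrite !mxE.
  by rewrite mxE big1// => a _; rewrite E' mulr0.
apply/colP => a; have := E (delta_mx 0 a); rewrite -rowE => E'.
by move: E'; rewrite !mxE.
Qed.

(** A score of norm 1 solves for [k]. Being a polynomial in scores, [k] inherits their ties and
    zeros, and so does the whole span. *)
Lemma k_square : exists f g : 'rV[R]_N, [/\ (f <= F)%MS, (g <= F)%MS &
  k = hadamard f f - g].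
Proof.
have [f1 [fF f0 _]] := orthogonal_score 0.
have c0 := weighted_dot_gt0 f0.
pose f := (Num.sqrt (weighted_dot f1 f1))^-1 *: f1.
have fF' : (f <= F)%MS by rewrite scalemx_sub.
have [g gF Eff] := hadamard_score fF' fF'.
exists f, g; split => //.
have d1 : weighted_dot f f = 1.
  rewrite weighted_dotZ weighted_dotC weighted_dotZ mulrA -invfM -expr2 sqr_sqrtr ?ltW//.
  by rewrite mulVf// gt_eqF.
by rewrite Eff d1 scale1r addrC addKr.
Qed.

Lemma span_tied i j (f : 'rV[R]_N) : tied i j -> (f <= A)%MS -> f 0 i = f 0 j.
Proof.
move=> /tiedP t /score_spanP[v [c ->]]; have [f1 [g [/submxP[v1 ->] /submxP[v2 ->] ->]]] := k_square.
have E (u : 'rV[R]_N) w : (v *m F + c *: u) 0 w = (v *m F) 0 w + c * u 0 w by rewrite [LHS]mxE [X in _ + X]mxE.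
rewrite !E t; congr (_ + _ * _).
have E' w : (hadamard (v1 *m F) (v1 *m F) - v2 *m F) 0 w =
  (v1 *m F) 0 w * (v1 *m F) 0 w - (v2 *m F) 0 w by rewrite [LHS]mxE [X in X + _]mxE [X in _ + X]mxE.
by rewrite !E' !t.
Qed.

Lemma span_frozen j (f : 'rV[R]_N) : frozen j -> (f <= A)%MS -> f 0 j = 0.
Proof.
move=> /frozenP t /score_spanP[v [c ->]]; have [f1 [g [/submxP[v1 ->] /submxP[v2 ->] ->]]] := k_square.
have E (u : 'rV[R]_N) w : (v *m F + c *: u) 0 w = (v *m F) 0 w + c * u 0 w by rewrite [LHS]mxE [X in _ + X]mxE.
have E' w : (hadamard (v1 *m F) (v1 *m F) - v2 *m F) 0 w =
  (v1 *m F) 0 w * (v1 *m F) 0 w - (v2 *m F) 0 w by rewrite [LHS]mxE [X in X + _]mxE [X in _ + X]mxE.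
by rewrite E E' !t mulr0 subr0 mulr0 addr0.
Qed.

Lemma span_separates i j : ~~ frozen i -> ~~ tied i j ->
  exists f : 'rV[R]_N, [/\ (f <= A)%MS, f 0 i != 0 & f 0 j = 0].
Proof.
move=> fi tij.
have [a [aA ai]] : exists a : 'rV[R]_N, (a <= A)%MS /\ a 0 i != 0.
  move: fi; rewrite /frozen => /eqP fi; apply: contrapT => h; apply: fi.
  apply/eqP/frozenP => v; apply: contrapT => /eqP hv; apply: h.
  by exists (v *m F); split=> //; apply: score_sub_span; exact: submxMl.
have [b [bA bij]] : exists b : 'rV[R]_N, (b <= A)%MS /\ b 0 i != b 0 j.
  move: tij; rewrite /tied => /eqP tij; apply: contrapT => h; apply: tij.
  apply/eqP/tiedP => v; apply: contrapT => /eqP hv; apply: h.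
  by exists (v *m F); split=> //; apply: score_sub_span; exact: submxMl.
have [bi|bi] := eqVneq (b 0 i) 0.
  have bj : b 0 j != 0 by rewrite -bi eq_sym.
  exists (a - (a 0 j / b 0 j) *: b); split.
  - by apply: addmx_sub => //; rewrite eqmx_opp; exact: scalemx_sub.
  - by rewrite !mxE bi mulr0 subr0.
  - by rewrite !mxE divfK// subrr.
exists (hadamard b b - b 0 j *: b); split.
- by apply: addmx_sub; [exact: span_mul|rewrite eqmx_opp; exact: scalemx_sub].
- by rewrite !mxE -mulrBl mulf_neq0// subr_eq0.
- by rewrite !mxE subrr.
Qed.

(** Multiplying separators of [i] from all outcomes not tied to it kills everything outside the
    class; on the class the product is constant by the ties, and it is rescaled to 1. *)
Lemma span_indicator i : ~~ frozen i -> ((\row_j (tied i j)%:R : 'rV[R]_N) <= A)%MS.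
Proof.
move=> fi.
have [a [aA ai]] : exists a : 'rV[R]_N, (a <= A)%MS /\ a 0 i != 0.
  move: fi; rewrite /frozen => /eqP fi; apply: contrapT => h; apply: fi.
  apply/eqP/frozenP => v; apply: contrapT => /eqP hv; apply: h.
  by exists (v *m F); split=> //; apply: score_sub_span; exact: submxMl.
have H (s : seq 'I_N) : exists f : 'rV[R]_N, [/\ (f <= A)%MS, f 0 i != 0 &
    forall j, j \in s -> ~~ tied i j -> f 0 j = 0].
  elim: s => [|j s [f [fA fi0 fs]]]; first by exists a.
  have [tij|tij] := boolP (tied i j).
    exists f; split => // j'; rewrite inE => /orP[/eqP -> /negP //|]; exact: fs.
  have [h [hA hi hj]] := span_separates fi tij.
  exists (hadamard f h); split; first exact: span_mul.
    by rewrite mxE mulf_neq0.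
  move=> j'; rewrite inE mxE => /orP[/eqP -> _|j's /fs ->//]; last by rewrite mul0r.
  by rewrite hj mulr0.
have [f [fA fi0 f0]] := H (enum 'I_N).
have -> : \row_j (tied i j)%:R = (f 0 i)^-1 *: f.
  apply/rowP => j; rewrite !mxE; have [tij|tij] := boolP (tied i j).
    by rewrite -(span_tied tij fA) mulVf.
  by rewrite (f0 j) ?mem_enum// mulr0.
exact: scalemx_sub.
Qed.

Lemma tied_refl i : tied i i.
Proof. exact: eqxx. Qed.

Lemma tied_sym i j : tied i j = tied j i.
Proof. exact: eq_sym. Qed.

Lemma tied_trans j i l : tied i j -> tied j l -> tied i l.
Proof. by move=> /eqP ij /eqP jl; rewrite /tied ij jl. Qed.

Lemma tied_frozen i j : tied i j -> frozen i = frozen j.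
Proof. by rewrite /frozen => /eqP ->. Qed.

(** Taking the least index makes the representative depend on the class only. Representatives later
    become the values of [xi_phi]. *)
Definition class_rep (i : 'I_N) : 'I_N := [arg min_(j < i | tied i j) (j : nat)].

Lemma tied_class_rep i : tied i (class_rep i).
Proof. by rewrite /class_rep; case: arg_minnP => //; exact: tied_refl. Qed.

Lemma class_rep_le i j : tied i j -> (class_rep i <= j)%N.
Proof.
rewrite /class_rep; case: arg_minnP => [|r _ h]; [exact: tied_refl|exact: h].
Qed.

Lemma class_rep_tied i j : tied i j -> class_rep i = class_rep j.
Proof.
move=> ij; apply: val_inj; apply/eqP; rewrite eqn_leq; apply/andP; split.
  by apply: class_rep_le; apply: tied_trans ij _; exact: tied_class_rep.
apply: class_rep_le; rewrite tied_sym in ij.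
by apply: tied_trans ij _; exact: tied_class_rep.
Qed.

Definition reps : {set 'I_N} := [set i | ~~ frozen i & class_rep i == i].

Lemma class_rep_reps i : ~~ frozen i -> class_rep i \in reps.
Proof.
move=> fi; rewrite inE -(tied_frozen (tied_class_rep i)) fi /=.
by rewrite -(class_rep_tied (tied_class_rep i)).
Qed.

Definition indicator (i : 'I_N) : 'rV[R]_N := \row_j (tied i j)%:R.

Lemma respecting_sum (f : 'rV[R]_N) :
  (forall i j, tied i j -> f 0 i = f 0 j) -> (forall j, frozen j -> f 0 j = 0) ->
  f = \sum_(r in reps) f 0 r *: indicator r.
Proof.
move=> tf ff; apply/rowP => j; rewrite summxE.
have [fj|fj] := boolP (frozen j).
  rewrite ff// big1// => r; rewrite inE => /andP[fr _]; rewrite !mxE.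
  case: (boolP (tied r j)) => [/tied_frozen rj|]; last by rewrite mulr0.
  by rewrite rj fj in fr.
rewrite (bigD1 (class_rep j)) ?class_rep_reps//= !mxE tied_sym tied_class_rep mulr1.
rewrite -(tf _ _ (tied_class_rep j)) big1 ?addr0// => r /andP[].
rewrite inE => /andP[_ /eqP rr] rj; rewrite !mxE.
case: (boolP (tied r j)) => [rj'|]; last by rewrite mulr0.
by rewrite -(class_rep_tied rj') rr eqxx in rj.
Qed.

Lemma respecting_sub_span (f : 'rV[R]_N) :
  (forall i j, tied i j -> f 0 i = f 0 j) -> (forall j, frozen j -> f 0 j = 0) ->
  (f <= A)%MS.
Proof.
move=> tf ff; rewrite (respecting_sum tf ff); apply: summx_sub => r.
by rewrite inE => /andP[fr _]; apply: scalemx_sub; exact: span_indicator.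
Qed.

(** The indicators of the nonfrozen classes form a basis of the span: they have disjoint supports,
    and they span by [respecting_sum]. This count yields the number of equations of Xi. *)
Lemma card_reps : #|reps| = m.+1.
Proof.
rewrite -rank_score_span.
pose B : 'M[R]_(#|reps|, N) := \matrix_(r, j) (tied (enum_val r) j)%:R.
have rB r : row r B = indicator (enum_val r) by apply/rowP => j; rewrite !mxE.
have fB : row_free B.
  apply/row_freeP; exists (\matrix_(j, r) (j == enum_val r)%:R).
  apply/matrixP => r s; rewrite !mxE (bigD1 (enum_val s))//= !mxE eqxx mulr1.
  rewrite big1 => [|j /negPf js]; last by rewrite !mxE js mulr0.
  rewrite addr0; have [->|rs] := eqVneq r s; first by rewrite tied_refl.
  have /setIdP[_ /eqP cr] := enum_valP r; have /setIdP[_ /eqP cs] := enum_valP s.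
  case: (boolP (tied _ _)) => // /class_rep_tied; rewrite cr cs => /enum_val_inj E.
  by rewrite E eqxx in rs.
have AB : (A <= B)%MS.
  apply/row_subP => i.
  have iA : (row i A <= A)%MS by exact: row_sub.
  rewrite (respecting_sum (fun a b t => span_tied t iA) (fun a t => span_frozen t iA)).
  apply: summx_sub => r rr; apply: scalemx_sub.
  by rewrite -(enum_rankK_in rr rr) -rB row_sub.
have BA : (B <= A)%MS.
  apply/row_subP => r; rewrite rB; apply: span_indicator.
  by have /setIdP[] := enum_valP r.
by apply/eqP; rewrite eqn_leq -{1}(eqP fB) !mxrankS//= -(eqP fB) mxrankS.
Qed.

End ScoreAlgebra.

(* If [F'] satisfies fewer ties and zeros than [F], its span contains that of [F],
   and both have rank [m.+1]. *)
Lemma same_relations (R : realType) (N m : nat) (p p' : 'rV[R]_N)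
    (F F' : 'M[R]_(m, N)) (k k' : 'rV[R]_N) : (2 <= m)%N ->
  (forall w, 0 < p 0 w) -> (forall w, 0 < p' 0 w) ->
  row_free F -> row_free F' ->
  (forall v : 'rV[R]_m, \sum_w p 0 w * (v *m F) 0 w = 0) ->
  (forall v : 'rV[R]_m, \sum_w p' 0 w * (v *m F') 0 w = 0) ->
  (forall v w : 'rV[R]_m, exists tau : 'rV[R]_m, forall om,
    (v *m F) 0 om * (w *m F) 0 om = (tau *m F) 0 om +
      (\sum_om' p 0 om' * ((v *m F) 0 om' * (w *m F) 0 om')) * k 0 om) ->
  (forall v w : 'rV[R]_m, exists tau : 'rV[R]_m, forall om,
    (v *m F') 0 om * (w *m F') 0 om = (tau *m F') 0 om +
      (\sum_om' p' 0 om' * ((v *m F') 0 om' * (w *m F') 0 om')) * k' 0 om) ->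
  (forall i j, tied F' i j -> tied F i j) ->
  (forall j, frozen F' j -> frozen F j) ->
  (forall i j, tied F' i j = tied F i j) /\ (forall j, frozen F' j = frozen F j).
Proof.
move=> m2 p0 p0' rF rF' mF mF' aF aF' tt ff.
have sub : (score_span F k <= score_span F' k')%MS.
  apply/row_subP => i; have iA : (row i (score_span F k) <= score_span F k)%MS by exact: row_sub.
  apply: (respecting_sub_span m2 p0' rF' aF').
    by move=> a b /tt t; exact: (span_tied m2 p0 rF aF t iA).
  by move=> a /ff t; exact: (span_frozen m2 p0 rF aF t iA).
have sub' : (score_span F' k' <= score_span F k)%MS.
  have := mxrank_leqif_sup sub.
  rewrite (rank_score_span m2 p0 rF mF aF) (rank_score_span m2 p0' rF' mF' aF').
  by case=> _ <-.
have vF' (v : 'rV[R]_m) : (v *m F' <= score_span F k)%MS.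
  apply: submx_trans sub'; apply/score_spanP; exists v, 0.
  by rewrite scale0r addr0.
split=> [i j|j]; apply/idP/idP.
- exact: tt.
- by move=> t; apply/tiedP => v; exact: (span_tied m2 p0 rF aF t (vF' v)).
- exact: ff.
- by move=> t; apply/frozenP => v; exact: (span_frozen m2 p0 rF aF t (vF' v)).
Qed.

Lemma row_free_mull (F : fieldType) a b c (A : 'M[F]_(a, b)) (B : 'M[F]_(b, c)) :
  row_free (A *m B) -> row_free A.
Proof. by move=> /row_freeP[D E]; apply/row_freeP; exists (B *m D); rewrite mulmxA. Qed.

Lemma row_free_mul (F : fieldType) a b c (A : 'M[F]_(a, b)) (B : 'M[F]_(b, c)) :
  row_free A -> row_free B -> row_free (A *m B).
Proof. by move=> rA rB; rewrite /row_free mxrankMfree. Qed.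

(** * Charts of submanifolds of the simplex *)

Section Charts.
Variables (R : realType) (n m : nat) (M : topologicalType) (iota : M -> 'rV[R]_n.+1).
Hypothesis iota_simplex : forall t, simplex n (iota t).

Lemma iota_gt0 t w : 0 < iota t 0 w.
Proof. by have [/(_ w)/andP[]] := iota_simplex t. Qed.

Lemma sum_iota t : \sum_w iota t 0 w = 1.
Proof. by have [] := iota_simplex t. Qed.

Variables (U : set 'rV[R]_m) (phi : 'rV[R]_m -> M).

Lemma prob_coord_expr u : prob (coord_expr iota phi u) = iota (phi u).
Proof. by rewrite /coord_expr etaK// sum_iota. Qed.

Lemma coord_expr_pos u : positive_at (coord_expr iota phi u).
Proof. by move=> w; rewrite prob_coord_expr iota_gt0. Qed.

Lemma point_fun : (fun u => iota (phi u)) =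
  (fun u => coord_expr iota phi u *m prob_mx R n + delta_mx 0 ord_max).
Proof. by apply/funext => u; rewrite -probE prob_coord_expr. Qed.

Lemma coord_expr_fun : coord_expr iota phi =
  (fun u => (fun u => iota (phi u)) u *m eta_mx R n + 0).
Proof. by apply/funext => u; rewrite addr0 -etaE. Qed.

(** [prob] and [eta] are inverse affine maps between the coordinate space and the hyperplane of sum
    one, so smoothness and rank can be tested on the ambient point instead of its coordinates. *)
Lemma parametrizationE : parametrization iota U phi <->
  [/\ open U, forall u, U u -> {for u, continuous phi}, set_inj U phi,
    (forall V : set 'rV[R]_m, open V -> V `<=` U -> open (phi @` V))
    & smooth_on U (fun u => iota (phi u)) /\
      forall u, U u -> row_free ('J (fun u => iota (phi u)) u)].
Proof.
split=> -[oU cphi iphi ophi [sx rx]]; split => //; split => [|u Uu].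
- by rewrite point_fun; exact: smooth_on_affine.
- rewrite point_fun jacobian_affine; last exact: smooth_on_differentiable sx Uu.
  by apply: row_free_mul; [exact: rx|exact: row_free_prob_mx].
- by rewrite coord_expr_fun; exact: smooth_on_affine.
- have := rx u Uu; rewrite {1}point_fun jacobian_affine.
    exact: row_free_mull.
  rewrite coord_expr_fun; apply: differentiable_affine.
  exact: smooth_on_differentiable sx Uu.
Qed.

Hypothesis par : parametrization iota U phi.
Let open_U : open U. Proof. by case: par. Qed.
Let smooth_x : smooth_on U (coord_expr iota phi). Proof. by case: par => _ _ _ _ []. Qed.
Local Notation P := (fun u => iota (phi u)).
Local Notation x := (coord_expr iota phi).

Lemma near_chart u : U u -> \forall y \near u, U y.
Proof. by move=> Uu; exact: open_nbhs_nbhs. Qed.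

Lemma smooth_point : smooth_on U P.
Proof. by case/parametrizationE: par => _ _ _ _ []. Qed.

Lemma tangent_mxE u : U u -> tangent_mx x u = 'J P u.
Proof.
move=> Uu; rewrite point_fun jacobian_affine//.
exact: smooth_on_differentiable smooth_x Uu.
Qed.

Lemma row_free_tangent u : U u -> row_free (tangent_mx x u).
Proof. by move=> Uu; rewrite tangent_mxE//; case/parametrizationE: par => _ _ _ _ []; auto. Qed.

Lemma derive_point u v : U u -> 'D_v P u = v *m tangent_mx x u.
Proof.
move=> Uu; rewrite tangent_mxE// deriveEjacobian//.
exact: smooth_on_differentiable smooth_point Uu.
Qed.

Lemma hessE u a b : U u ->
  hess x u a b = 'D_(basis_vec a) ('D_(basis_vec b) P) u.
Proof. by move=> Uu; rewrite point_fun (derive2_affine_smooth _ _ _ _ open_U smooth_x). Qed.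

Lemma mul_score u v w : U u ->
  (v *m score_mx x u) 0 w = 'D_v P u 0 w / P u 0 w.
Proof. by move=> Uu; rewrite -wdivM mxE derive_point// prob_coord_expr. Qed.

(** A parametrization is continuous and open, so neighbourhoods correspond; this moves local
    statements between a chart and [M]. *)
Lemma chart_nearP (Q : M -> Prop) u : U u ->
  (\forall y \near u, Q (phi y)) <-> (\forall t \near phi u, Q t).
Proof.
case: par => _ cphi _ ophi _ Uu; split=> [h|]; last exact: cphi.
have : nbhs u (U `&` [set y | Q (phi y)]) by apply: filterI; [exact: near_chart|].
rewrite nbhsE => -[V [oV Vu] VU].
have oV' : open (phi @` V) by apply: ophi => // y /VU[].
apply: (@filterS _ _ _ (phi @` V)); first by move=> _ [y /VU[_ ?] <-].
by apply: open_nbhs_nbhs; split => //; exists u.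
Qed.

End Charts.

(** * Mean value theorem along segments *)

Section MeanValue.
Variables (R : realType) (V : normedModType R).

Lemma ball_segment (u : V) e y y' t : ball u e y -> ball u e y' -> 0 <= t <= 1 ->
  ball u e (y + t *: (y' - y)).
Proof.
rewrite -!ball_normE /= => yu yu' /andP[t0 t1].
have -> : u - (y + t *: (y' - y)) = (1 - t) *: (u - y) + t *: (u - y').
  rewrite opprD addrA scalerBl scale1r -[RHS]addrA; congr (_ + _).
  by rewrite -!scalerN -scalerDr !opprB subrKA.
apply: le_lt_trans (ler_normD _ _) _; rewrite !normrZ (ger0_norm t0) ger0_norm ?subr_ge0//.
have [->|tn0] := eqVneq t 0; first by rewrite subr0 mul1r mul0r addr0.
rewrite -[ltRHS]mul1r -[X in X * e](subrK t 1) [ltRHS]mulrDl.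
apply: ler_ltD; last by rewrite ltr_pM2l// lt_def tn0.
by apply: ler_wpM2l; [rewrite subr_ge0|exact: ltW].
Qed.

Lemma segment_mvt (f : V -> R) (y y' : V) :
  (forall t : R, 0 <= t <= 1 -> differentiable f (y + t *: (y' - y))) ->
  exists2 t : R, 0 <= t <= 1 & f y' - f y = 'D_(y' - y) f (y + t *: (y' - y)).
Proof.
move=> df; pose l (t : R) := y + t *: (y' - y); pose g t := f (l t).
have lE h t : l (h *: 1 + t) = h *: (y' - y) + l t.
  by rewrite /l scalerDl [h *: 1]mulr1 addrCA.
have dg (t : R) : 0 <= t <= 1 -> is_derive t 1 g ('D_(y' - y) f (l t)).
  move=> /df/diff_derivable -/(_ (y' - y)) fd.
  have E : (fun h => h^-1 *: ((g \o shift t) (h *: 1) - g t)) =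
      (fun h => h^-1 *: ((f \o shift (l t)) (h *: (y' - y)) - f (l t))).
    by apply/funext => h; rewrite /= /g lE.
  by apply: DeriveDef; rewrite /derivable /derive E.
have [c c01 E] : exists2 c, c \in `[0, 1]%R & g 1 - g 0 = 'D_(y' - y) f (l c) * (1 - 0).
  apply: (@MVT_segment R g (fun t => 'D_(y' - y) f (l t))) => //.
    by move=> t; rewrite in_itv /= => /andP[t0 t1]; apply: dg; rewrite !ltW.
  apply: continuous_in_subspaceT => t; rewrite inE /= in_itv /= => t01.
  by apply: differentiable_continuous; apply/derivable1_diffP; case: (dg t t01).
exists c; first by move: c01; rewrite in_itv.
by move: E; rewrite subr0 mulr1 /g /l scale1r scale0r addr0 [y + _]addrC subrK.
Qed.

Lemma near_constant (f : V -> R) (u : V) :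
  (\forall y \near u, differentiable f y /\ forall v, 'D_v f y = 0) ->
  \forall y \near u, f y = f u.
Proof.
move=> /nbhs_ballP[e e0 h]; apply/nbhs_ballP; exists e => // y yu.
have uu : ball u e u by exact: ballxx.
have [t t01|t t01] := @segment_mvt f u y.
  by case: (h _ (ball_segment uu yu t01)).
by case: (h _ (ball_segment uu yu t01)) => _ -> /subr0_eq.
Qed.

End MeanValue.

(** * Doubly totally-umbilical submanifolds *)

Lemma connected_locally_constant (M : topologicalType) (S : Type) (f : M -> S) :
  connected [set: M] -> (forall t, \forall t' \near t, f t' = f t) ->
  forall t t', f t = f t'.
Proof.
move=> cM loc t t'; pose B := [set s | f s = f t].
suff : B = [set: M] by move=> /seteqP[_ /(_ t' I) ->].
have oB (C : set S) : open (f @^-1` C).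
  rewrite openE => s Cs; rewrite /interior; apply: filterS (loc s) => s' E.
  by rewrite /preimage /= E.
apply: cM; first by exists t.
  by exists B; [exact: oB [set f t]|rewrite setTI].
exists B; last by rewrite setTI.
by rewrite -[B]setCK; apply: open_closedC; exact: oB (~` [set f t]).
Qed.

Section UmbilicalRelations.
Variables (R : realType) (n m : nat) (M : topologicalType) (iota : M -> 'rV[R]_n.+1).
Hypothesis m_ge2 : (2 <= m)%N.
Hypothesis iota_simplex : forall t, simplex n (iota t).
Hypothesis umb : doubly_umbilical m iota.

Section InChart.
Variables (U : set 'rV[R]_m) (phi : 'rV[R]_m -> M).
Hypothesis par : parametrization iota U phi.
Local Notation x := (coord_expr iota phi).
Local Notation P := (fun u => iota (phi u)).
Local Notation F u := (score_mx x u).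
Let gt0 t w : 0 < iota t 0 w. Proof. exact: iota_gt0. Qed.

Lemma row_free_score u : U u -> row_free (F u).
Proof.
move=> Uu; apply: row_free_wdiv; first exact: coord_expr_pos.
exact: (row_free_tangent iota_simplex par).
Qed.

Lemma score_mean u (v : 'rV[R]_m) : \sum_w iota (phi u) 0 w * (v *m F u) 0 w = 0.
Proof.
rewrite -[RHS](mean_tangent x u v); apply: eq_bigr => w _.
rewrite mulrC -(mulF_p _ v w) ?prob_coord_expr//; exact: coord_expr_pos.
Qed.

Lemma score_algebra u : U u -> exists k : 'rV[R]_n.+1, forall v w : 'rV[R]_m,
  exists tau : 'rV[R]_m, forall om,
    (v *m F u) 0 om * (w *m F u) 0 om = (tau *m F u) 0 om +
    (\sum_om' iota (phi u) 0 om' * ((v *m F u) 0 om' * (w *m F u) 0 om')) * k 0 om.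
Proof.
move=> Uu; have pos := coord_expr_pos iota_simplex phi u.
have rT := row_free_tangent iota_simplex par Uu.
have [E oE] : exists E, orthonormal_frame fisher x u E.
  apply: orthonormal_exists.
    apply/matrixP => i j; rewrite mxE induced_metricE// !gramE.
    by apply: eq_bigr => w _; rewrite [X in X / _]mulrC.
  move=> v v0; rewrite induced_metricE// -gramM.
  rewrite lt_def gram_ge0// andbT; apply: contra v0 => /eqP /(gram_eq0 pos) /eqP.
  by rewrite mulmx_free_eq0.
have [ue um] := umb.
have := @umbilical_score_algebra R n m x u pos _ _ (um _ _ par u Uu E oE) (ue _ _ par u Uu E oE).
by rewrite prob_coord_expr.
Qed.

Lemma continuous_score u a w : U u -> {for u, continuous (fun y => F y a w : R)}.
Proof.
move=> Uu.
have Fy : \forall y \near u, F y a w = 'D_(basis_vec a) P y 0 w / P y 0 w.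
  apply: filterS (near_chart par Uu) => y Uy.
  by rewrite -(mul_score iota_simplex par (basis_vec a) w Uy) -rowE [RHS]mxE.
have dDP : differentiable ('D_(basis_vec a) P) u.
  apply: smooth_on_differentiable Uu; apply: smooth_on_derive.
  exact: (smooth_point iota_simplex par).
have dP : differentiable P u.
  exact: smooth_on_differentiable (smooth_point iota_simplex par) Uu.
have c : differentiable (fun y => 'D_(basis_vec a) P y 0 w / P y 0 w : R) u.
  apply: differentiableM; first exact: differentiable_entry.
  by apply: differentiableV; [exact: differentiable_entry|rewrite gt_eqF].
apply: differentiable_continuous; apply: near_eq_differentiable c.
by apply: filterS Fy.
Qed.

Lemma near_relations u : U u -> \forall y \near u, U y /\
  (forall i j, tied (F y) i j = tied (F u) i j) /\
  (forall j, frozen (F y) j = frozen (F u) j).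
Proof.
move=> Uu.
have tn : \forall y \near u, forall ij : 'I_n.+1 * 'I_n.+1,
    tied (F y) ij.1 ij.2 -> tied (F u) ij.1 ij.2.
  apply: (@filter_forall _ _ (fun (ij : 'I_n.+1 * 'I_n.+1) y =>
    tied (F y) ij.1 ij.2 -> tied (F u) ij.1 ij.2) (nbhs u)) => -[i j] /=.
  have [t|] := boolP (tied (F u) i j); first exact: nearW.
  move=> tu; have [a Fa] : exists a, F u a i - F u a j != 0.
    apply: contrapT => h; move: tu; rewrite /tied => /eqP; apply; apply/colP => a.
    rewrite [LHS]mxE [RHS]mxE; apply/subr0_eq/eqP; apply: contrapT => /negP h'.
    by apply: h; exists a.
  have c : {for u, continuous (fun y => F y a i - F y a j : R)}.
    by apply: continuousB; exact: continuous_score.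
  have cn : \forall y \near u, F y a i - F y a j != 0.
    exact: (c [set r | r != 0] (open_nbhs_nbhs (conj (@open_neq _ 0) Fa))).
  move: cn; apply: filterS => y h t; exfalso; move: h; rewrite subr_eq0.
  move: t; rewrite /tied => /eqP E.
  by have := congr1 (fun C : 'cV_m => C a 0) E; rewrite [LHS]mxE [RHS]mxE => ->; rewrite eqxx.
have fn : \forall y \near u, forall j, frozen (F y) j -> frozen (F u) j.
  apply: (@filter_forall _ _ (fun j y => frozen (F y) j -> frozen (F u) j) (nbhs u)) => j.
  have [t|] := boolP (frozen (F u) j); first exact: nearW.
  move=> tu; have [a Fa] : exists a, F u a j != 0.
    apply: contrapT => h; move: tu; rewrite /frozen => /eqP; apply; apply/colP => a.
    rewrite [LHS]mxE [RHS]mxE; apply/eqP; apply: contrapT => /negP h'.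
    by apply: h; exists a.
  have c : {for u, continuous (fun y => F y a j : R)} by exact: continuous_score.
  have cn : \forall y \near u, F y a j != 0.
    exact: (c [set r | r != 0] (open_nbhs_nbhs (conj (@open_neq _ 0) Fa))).
  move: cn; apply: filterS => y h t; exfalso; move: h.
  move: t; rewrite /frozen => /eqP E.
  by have := congr1 (fun C : 'cV_m => C a 0) E; rewrite [LHS]mxE [RHS]mxE => ->; rewrite eqxx.
have [k ku] := score_algebra Uu.
apply: filterS3 (near_chart par Uu) tn fn => y Uy tt ff; split => //.
have [k' ky] := score_algebra Uy.
apply: (same_relations m_ge2 (gt0 (phi u)) (gt0 (phi y)) (row_free_score Uu)
  (row_free_score Uy) (score_mean u) (score_mean y) ku ky) => [i j|j].
  exact: (tt (i, j)).
exact: ff.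
Qed.

(** The logarithmic derivative of [p_i / p_j] is the difference of the scores at [i] and [j]. A tie
    at [u] persists nearby by [near_relations], so the derivative vanishes on a neighbourhood, not
    just at [u]. The right-hand side mentions no chart apart from the point [phi u]. *)
Lemma tied_ratioP u i j : U u -> tied (F u) i j <->
  \forall t \near phi u, iota t 0 i / iota t 0 j = iota (phi u) 0 i / iota (phi u) 0 j.
Proof.
move=> Uu.
have sP := smooth_point iota_simplex par.
have dq y : U y -> forall w, differentiable (fun y => P y 0 w : R) y.
  by move=> Uy w; apply: differentiable_entry; exact: smooth_on_differentiable sP Uy.
have Dq y v : U y -> 'D_v (fun y => P y 0 i / P y 0 j : R) y =
    P y 0 i / P y 0 j * ((v *m F y) 0 i - (v *m F y) 0 j).
  move=> Uy; have dqi := diff_derivable (v := v) (dq y Uy i).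
  have dqj := diff_derivable (v := v) (dq y Uy j).
  rewrite deriveM//; last by apply: derivableV => //; rewrite gt_eqF.
  rewrite deriveV ?gt_eqF// !(mul_score iota_simplex par)//.
  have dP := smooth_on_differentiable sP Uy.
  rewrite -!derive_entry// /GRing.scale /=.
  by field; rewrite !gt_eqF.
rewrite -(chart_nearP par (fun t => iota t 0 i / iota t 0 j =
  iota (phi u) 0 i / iota (phi u) 0 j) Uu).
split=> [t|h].
  apply: (near_constant (f := fun y => P y 0 i / P y 0 j : R)).
  apply: filterS (near_relations Uu) => y [Uy [ty _]]; split=> [|v].
    by apply: differentiableM; [exact: dq|apply: differentiableV; [exact: dq|rewrite gt_eqF]].
  by rewrite Dq//; move: t; rewrite -ty => /tiedP ->; rewrite subrr mulr0.
apply/tiedP => v; apply/subr0_eq/eqP.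
have := Dq u v Uu; rewrite (near_eq_derive (g := cst (iota (phi u) 0 i / iota (phi u) 0 j))) ?derive_cst//.
move=> /esym/eqP; rewrite mulf_eq0 => /orP[|//].
by rewrite mulf_eq0 invr_eq0 !(gt_eqF (gt0 _ _)).
Qed.

Lemma frozen_constP u j : U u -> frozen (F u) j <->
  \forall t \near phi u, iota t 0 j = iota (phi u) 0 j.
Proof.
move=> Uu.
have sP := smooth_point iota_simplex par.
have Dq y v : U y -> 'D_v (fun y => P y 0 j : R) y = P y 0 j * (v *m F y) 0 j.
  move=> Uy; rewrite (mul_score iota_simplex par)// derive_entry.
    by rewrite mulrC divfK// gt_eqF.
  exact: smooth_on_differentiable sP Uy.
rewrite -(chart_nearP par (fun t => iota t 0 j = iota (phi u) 0 j) Uu).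
split=> [t|h].
  apply: (near_constant (f := fun y => P y 0 j : R)).
  apply: filterS (near_relations Uu) => y [Uy [_ ty]]; split=> [|v].
    by apply: differentiable_entry; exact: smooth_on_differentiable sP Uy.
  by rewrite Dq//; move: t; rewrite -ty => /frozenP ->; rewrite mulr0.
apply/frozenP => v; apply/eqP.
have := Dq u v Uu; rewrite (near_eq_derive (g := cst (iota (phi u) 0 j))) ?derive_cst//.
move=> /esym/eqP; rewrite mulf_eq0 => /orP[|//].
by rewrite (gt_eqF (gt0 _ _)).
Qed.

End InChart.

Hypothesis M_sub : submanifold m iota.
Hypothesis M_conn : connected [set: M].

(** Ties and zeros are defined in a chart; local constancy of ratios and probabilities records them
    intrinsically, as a function on [M] to which connectedness applies. *)
Definition ratio_code (t : M) : {set 'I_n.+1 * 'I_n.+1} * {set 'I_n.+1} :=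
  ([set ij | `[< \forall t' \near t, iota t' 0 ij.1 / iota t' 0 ij.2 =
      iota t 0 ij.1 / iota t 0 ij.2 >]],
   [set j | `[< \forall t' \near t, iota t' 0 j = iota t 0 j >]])%SET.

Lemma ratio_codeE (U : set 'rV[R]_m) phi u : parametrization iota U phi -> U u ->
  ratio_code (phi u) = ([set ij | tied (score_mx (coord_expr iota phi) u) ij.1 ij.2],
    [set j | frozen (score_mx (coord_expr iota phi) u) j])%SET.
Proof.
move=> par Uu; congr pair; apply/setP => i; rewrite !inE; apply/asboolP/idP.
- by move/(tied_ratioP par _ _ Uu).
- by move/(tied_ratioP par _ _ Uu).
- by move/(frozen_constP par _ Uu).
- by move/(frozen_constP par _ Uu).
Qed.

Lemma ratio_code_constant t t' : ratio_code t = ratio_code t'.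
Proof.
apply: connected_locally_constant M_conn _ t t' => s.
have [_ _ /(_ s)[U [phi [u [par Uu <-]]]]] := M_sub.
rewrite -(chart_nearP par (fun t => ratio_code t = ratio_code (phi u)) Uu).
apply: filterS (near_relations par Uu) => y [Uy [ty fy]].
rewrite !(ratio_codeE par)//; congr pair; apply/setP => i; rewrite !inE.
  exact: ty.
exact: fy.
Qed.

Lemma umbilical_in_Xi (t0 : M) : exists X : xi_data R n m, range iota `<=` Xi X.
Proof.
have [_ _ /(_ t0)[U [phi [u [par Uu t0E]]]]] := M_sub.
pose F := score_mx (coord_expr iota phi) u.
have [k0 ku] := score_algebra par Uu.
have cr := card_reps m_ge2 (iota_gt0 iota_simplex (phi u)) (row_free_score par Uu)
  (score_mean phi u) ku.
(* The tie is known only at [phi u]. Since [ratio_code] is constant, the ratio is locally constant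
   at every point, and connectedness makes it constant. *)
have tied_const t t' i j : tied F i j -> iota t 0 i / iota t 0 j = iota t' 0 i / iota t' 0 j.
  move=> tij; apply: (@connected_locally_constant M _ (fun t => iota t 0 i / iota t 0 j) M_conn) => s.
  have : (i, j) \in (ratio_code (phi u)).1 by rewrite (ratio_codeE par)// inE.
  by rewrite (ratio_code_constant _ s) inE => /asboolP.
have frozen_const t t' j : frozen F j -> iota t 0 j = iota t' 0 j.
  move=> fj; apply: (@connected_locally_constant M _ (fun t => iota t 0 j) M_conn) => s.
  have : j \in (ratio_code (phi u)).2 by rewrite (ratio_codeE par)// inE.
  by rewrite (ratio_code_constant _ s) inE => /asboolP.
pose Is := [set i | ~~ frozen F i & class_rep F i != i]%SET.
pose Js := [set j | frozen F j]%SET.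
have cardIJ : (#|Is| + #|Js| = n - m)%N.
  (* Representatives, other nonfrozen outcomes and frozen outcomes partition all [n.+1] outcomes,
     and there are [m.+1] representatives. *)
  have : (#|reps F| + #|Is| + #|Js| = n.+1)%N.
    rewrite -[RHS]card_ord -addnA -(cardsC Js) [RHS]addnC addnA; congr (_ + _)%N.
    rewrite -(cardsID [set i | class_rep F i == i]%SET (~: Js)); congr (_ + _)%N;
      by apply: eq_card => i; rewrite !inE// andbC.
  by rewrite cr; lia.
have xi_i_inj : injective (fun k : 'I_#|Is| => enum_val k) by exact: enum_val_inj.
have xi_j_inj : injective (fun k : 'I_#|Js| => enum_val k) by exact: enum_val_inj.
have IP (k : 'I_#|Is|) : ~~ frozen F (enum_val k) /\ class_rep F (enum_val k) != enum_val k.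
  by have := enum_valP k; rewrite inE => /andP[].
have JP (k : 'I_#|Js|) : frozen F (enum_val k) by have := enum_valP k; rewrite inE.
have repI i : class_rep F (class_rep F i) = class_rep F i.
  by rewrite -(class_rep_tied (tied_class_rep F i)).
have xi_ij (k : 'I_#|Is|) (l : 'I_#|Js|) : enum_val k != enum_val l.
  by apply/eqP => E; have [] := IP k; rewrite E JP.
have xi_phi_i (k k' : 'I_#|Is|) : class_rep F (enum_val k) != enum_val k'.
  by apply/eqP => E; have [_] := IP k'; rewrite -E repI eqxx.
have xi_phi_j (k : 'I_#|Is|) (l : 'I_#|Js|) : class_rep F (enum_val k) != enum_val l.
  apply/eqP => E; have [] := IP k; rewrite (tied_frozen (tied_class_rep F _)).
  by rewrite E JP.
(* The constants [a] and [b] are the values of the ratios and probabilities at the base point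
   [t0]. *)
have xi_a0 (k : 'I_#|Is|) : 0 < iota t0 0 (enum_val k) / iota t0 0 (class_rep F (enum_val k)).
  by rewrite divr_gt0// iota_gt0.
have xi_b0 (l : 'I_#|Js|) : 0 < iota t0 0 (enum_val l) < 1.
  by have [] := iota_simplex t0.
exists (XiData cardIJ xi_i_inj xi_j_inj xi_ij xi_phi_i xi_phi_j xi_a0 xi_b0).
move=> _ [t _ <-]; split => /= [|k'|l]; first exact: iota_simplex.
  rewrite -(tied_const t); first by rewrite divfK// gt_eqF// iota_gt0.
  exact: tied_class_rep.
by apply: frozen_const; exact: JP.
Qed.

End UmbilicalRelations.

(** * Cellular families *)

(* Outcomes in the cell [l] have conditional probabilities [kap], the outcomes
   without a cell have the fixed probabilities [kap]. *)
Record cells (R : realType) (n m : nat) := Cells {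
  cell : 'I_n.+1 -> option 'I_m.+1;
  kap : 'I_n.+1 -> R;
  kap_gt0 : forall w, 0 < kap w;
  sum_kap : forall l, \sum_(w | cell w == Some l) kap w = 1
}.

Section CellMatrices.
Variables (R : realType) (n m : nat) (c : cells R n m).

(** Right multiplication by [lump_mx] sums the mass of each cell and forgets frozen outcomes;
    [split_mx] redistributes cell masses by the conditional probabilities and puts 0 on frozen
    outcomes. *)
Definition lump_mx : 'M[R]_(n.+1, m.+1) := \matrix_(w, l) (cell c w == Some l)%:R.
Definition split_mx : 'M[R]_(m.+1, n.+1) :=
  \matrix_(l, w) (if cell c w == Some l then kap c w else 0).
Definition frozen_row : 'rV[R]_n.+1 :=
  \row_w (if cell c w is None then kap c w else 0).
Local Notation Cm := lump_mx.
Local Notation Km := split_mx.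

Definition cell_set : set 'rV[R]_n.+1 :=
  [set p | simplex n p /\ p = p *m Cm *m Km + frozen_row].

Lemma mul_splitE (h : 'rV[R]_m.+1) w :
  (h *m Km) 0 w = if cell c w is Some l then kap c w * h 0 l else 0.
Proof.
rewrite mxE; case E : (cell c w) => [l|]; last first.
  by rewrite big1// => l' _; rewrite mxE E mulr0.
rewrite (bigD1 l)//= mxE E eqxx mulrC big1 ?addr0// => l' l'l.
by rewrite mxE E (inj_eq Some_inj) eq_sym (negPf l'l) mulr0.
Qed.

Lemma mul_lumpTE (h : 'rV[R]_m.+1) w :
  (h *m Cm^T) 0 w = if cell c w is Some l then h 0 l else 0.
Proof.
rewrite mxE; case E : (cell c w) => [l|]; last first.
  by rewrite big1// => l' _; rewrite !mxE E mulr0.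
rewrite (bigD1 l)//= !mxE E eqxx mulr1 big1 ?addr0// => l' l'l.
by rewrite !mxE E (inj_eq Some_inj) eq_sym (negPf l'l) mulr0.
Qed.

Lemma mul_lumpE (y : 'rV[R]_n.+1) l : (y *m Cm) 0 l = \sum_(w | cell c w == Some l) y 0 w.
Proof.
rewrite mxE [RHS]big_mkcond; apply: eq_bigr => w _; rewrite mxE.
by case: ifP => _; rewrite ?mulr1 ?mulr0.
Qed.

Lemma split_lump : Km *m Cm = 1%:M.
Proof.
apply/row_matrixP => l; rewrite row_mul; apply/rowP => l'.
rewrite mul_lumpE !mxE; under eq_bigr do rewrite !mxE.
have [<-|ll'] := eqVneq l l'.
  by rewrite -(sum_kap c l); apply: eq_bigr => w ->.
by rewrite big1// => w /eqP ->; rewrite (inj_eq Some_inj) eq_sym (negPf ll').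
Qed.

Lemma frozen_lump : frozen_row *m Cm = 0.
Proof. by apply/rowP => l; rewrite mul_lumpE mxE big1// => w /eqP E; rewrite mxE E. Qed.

Lemma sum_lump (y : 'rV[R]_n.+1) :
  \sum_l (y *m Cm) 0 l = \sum_(w | cell c w != None) y 0 w.
Proof.
under eq_bigr do rewrite mul_lumpE big_mkcond /=.
rewrite exchange_big [RHS]big_mkcond; apply: eq_bigr => w _ /=.
case E : (cell c w) => [l|] /=; last by rewrite big1.
rewrite (bigD1 l)//= eqxx big1 ?addr0// => l' l'l.
by rewrite (inj_eq Some_inj) eq_sym (negPf l'l).
Qed.

Lemma sum_split (h : 'rV[R]_m.+1) : \sum_w (h *m Km) 0 w = \sum_l h 0 l.
Proof.
rewrite -[in RHS](mulmx1 h) -split_lump mulmxA sum_lump [RHS]big_mkcond.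
by apply: eq_bigr => w _; rewrite mul_splitE; case: (cell c w).
Qed.

Definition cell_weight : R := 1 - \sum_w frozen_row 0 w.
Local Notation sg := cell_weight.

Lemma sum_lump_cell_set p : cell_set p -> \sum_l (p *m Cm) 0 l = sg.
Proof.
move=> [[_ p1] pE]; rewrite /sg -p1 {2}pE.
under [in RHS]eq_bigr do rewrite mxE.
by rewrite big_split /= addrK sum_split.
Qed.

Lemma lump_gt0 (p : 'rV[R]_n.+1) l : (forall w, 0 < p 0 w) -> 0 < (p *m Cm) 0 l.
Proof.
move=> p0; rewrite mul_lumpE.
have [w cw] : exists w, cell c w == Some l.
  apply: contrapT => h; have := sum_kap c l; rewrite big1 => [/eqP|w cw].
    by rewrite eq_sym oner_eq0.
  by exfalso; apply: h; exists w.
rewrite (bigD1 w)//= ltr_wpDr//; apply: sumr_ge0 => i _; exact: ltW.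
Qed.

Lemma cell_weight_gt0 p : cell_set p -> 0 < sg.
Proof.
move=> cp; rewrite -(sum_lump_cell_set cp) (bigD1 ord0)//=.
have p0 w : 0 < p 0 w by have [[/(_ w)/andP[]]] := cp.
by rewrite ltr_wpDr ?lump_gt0//; apply: sumr_ge0 => i _; rewrite ltW// lump_gt0.
Qed.

Lemma frozen_row_none w : cell c w = None -> frozen_row 0 w = kap c w.
Proof. by move=> E; rewrite mxE E. Qed.

Lemma frozen_row_some w l : cell c w = Some l -> frozen_row 0 w = 0.
Proof. by move=> E; rewrite mxE E. Qed.

End CellMatrices.

Section CellSubmanifold.
Variables (R : realType) (n m : nat) (M : topologicalType) (iota : M -> 'rV[R]_n.+1).
Variable c : cells R n m.
Local Notation Cm := (lump_mx c).
Local Notation Km := (split_mx c).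
Local Notation sg := (cell_weight c).
Hypothesis iota_cell : forall t, cell_set c (iota t).

Lemma cell_simplex t : simplex n (iota t). Proof. by case: (iota_cell t). Qed.

Section InChart.
Variables (U : set 'rV[R]_m) (phi : 'rV[R]_m -> M).
Hypothesis par : parametrization iota U phi.
Local Notation x := (coord_expr iota phi).
Local Notation P := (fun u => iota (phi u)).
Local Notation T u := (tangent_mx x u).
Local Notation F u := (score_mx x u).
Variables (u : 'rV[R]_m) (Uu : U u).
Let gt0 t w : 0 < iota t 0 w. Proof. exact: iota_gt0 cell_simplex _ _. Qed.
Let pos : positive_at (x u). Proof. exact: coord_expr_pos cell_simplex _ _. Qed.
Let pE : prob (x u) = iota (phi u). Proof. exact: prob_coord_expr cell_simplex _ _. Qed.
Let smP : smooth_on U P. Proof. exact: (smooth_point cell_simplex par). Qed.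
Let oU : open U. Proof. by case: par. Qed.

Lemma cell_point_fun : P = (fun u => P u *m (Cm *m Km) + frozen_row c).
Proof. by apply/funext => y; rewrite mulmxA; case: (iota_cell (phi y)). Qed.

Lemma tangent_cell : T u = T u *m Cm *m Km.
Proof.
rewrite -mulmxA (tangent_mxE cell_simplex par)//.
rewrite {1}cell_point_fun jacobian_affine//; exact: smooth_on_differentiable smP Uu.
Qed.

Lemma hess_cell a b : hess x u a b = hess x u a b *m Cm *m Km.
Proof.
rewrite -mulmxA (hessE cell_simplex par)//.
by rewrite {1}cell_point_fun (derive2_affine_smooth _ _ _ _ oU smP).
Qed.

(** A dimension count: the lumped tangent vectors are [m] independent rows inside the vectors of sum
    zero on [m.+1] cells, a space of dimension [m], hence they span it. *)
Lemma cell_tangentP (y : 'rV[R]_n.+1) :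
  y = y *m Cm *m Km -> \sum_w y 0 w = 0 -> exists r, y = r *m T u.
Proof.
move=> yE y0; pose Tq := T u *m Cm.
have rT := row_free_tangent cell_simplex par Uu.
have rTq : row_free Tq.
  by apply: (@row_free_mull _ _ _ _ Tq Km); rewrite -tangent_cell.
pose one : 'cV[R]_m.+1 := const_mx 1.
have oneE (h : 'rV[R]_m.+1) : (h *m one) 0 0 = \sum_l h 0 l.
  by rewrite mxE; apply: eq_bigr => l _; rewrite mxE mulr1.
have Tk : (Tq <= kermx one)%MS.
  apply/sub_kermxP/row_matrixP => a; rewrite row_mul row0; apply/rowP => i.
  rewrite (ord1 i) oneE mxE -(sum_split c) -row_mul -tangent_cell rowE.
  exact: mean_tangent.
have rk : \rank (kermx one) = m.
  rewrite mxrank_ker (_ : \rank one = 1%N) ?subn1//.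
  apply/eqP; rewrite eqn_leq rank_leq_col/= lt0n mxrank_eq0.
  by apply/eqP => /matrixP/(_ 0 0); rewrite !mxE => /eqP; rewrite oner_eq0.
have kT : (kermx one <= Tq)%MS.
  by have [_ <-] := mxrank_leqif_sup Tk; rewrite rk (eqP rTq).
have /submx_trans/(_ kT)/submxP[r rE] : (y *m Cm <= kermx one)%MS.
  apply/sub_kermxP/rowP => i; rewrite (ord1 i) oneE mxE.
  by rewrite -(sum_split c) -yE.
by exists r; rewrite yE rE [in RHS]tangent_cell !mulmxA.
Qed.

Lemma sum_hess a b : \sum_w hess x u a b 0 w = 0.
Proof. exact: sum_mul_prob_mx. Qed.

Lemma mscore_cell a b : exists r d, mscore x u a b =
  r *m F u + gram (prob (x u)) (T u) a b *: 0 + const_mx d.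
Proof.
have [r rE] := cell_tangentP (hess_cell a b) (sum_hess a b).
exists r, 0; rewrite /mscore rE wdivM scaler0 addr0; apply/rowP => w.
by rewrite [RHS]mxE [X in _ = _ + X]mxE addr0.
Qed.

(* The e-form of a cellular submanifold is the metric times the normal part of
   the vector with this score, which is orthogonal to all tangent scores. *)
Definition curvature_row : 'rV[R]_n.+1 :=
  \row_w (1 - (if cell c w is Some _ then sg^-1 else 0)).

Lemma cellularP (y : 'rV[R]_n.+1) (h : 'rV[R]_m.+1) :
  (forall w, y 0 w = if cell c w is Some l then kap c w * h 0 l else 0) ->
  y = y *m Cm *m Km.
Proof.
move=> yE; have -> : y = h *m Km by apply/rowP => w; rewrite yE mul_splitE.
by rewrite -(mulmxA h) split_lump mulmx1.
Qed.

Lemma cell_entry (y : 'rV[R]_n.+1) w : y = y *m Cm *m Km ->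
  y 0 w = if cell c w is Some l then kap c w * (y *m Cm) 0 l else 0.
Proof. by move=> {1}->; rewrite mul_splitE. Qed.

Lemma point_some t w l : cell c w = Some l ->
  iota t 0 w = kap c w * (iota t *m Cm) 0 l.
Proof.
move=> E; have [_ {1}->] := iota_cell t.
by rewrite mxE mul_splitE E (frozen_row_some E) addr0.
Qed.

Lemma escore_cell a b : exists r d, escore x u a b =
  r *m F u + gram (prob (x u)) (T u) a b *: curvature_row + const_mx d.
Proof.
have sg0 : 0 < sg by exact: cell_weight_gt0 (iota_cell (phi u)).
set p := iota (phi u); set G := gram _ _ a b.
have q0 l : (p *m Cm) 0 l != 0 by rewrite gt_eqF// lump_gt0// => w; exact: gt0.
pose ha := row a (T u); pose hb := row b (T u).
have haE : ha = ha *m Cm *m Km by rewrite -!row_mul -tangent_cell.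
have hbE : hb = hb *m Cm *m Km by rewrite -!row_mul -tangent_cell.
(* The hessian minus the product of tangent vectors over [p] is cellular but has sum [- G]. The
   cellular part of [p] has sum [sg], so adding [G / sg] times it restores sum zero and makes [y]
   tangent. *)
pose y : 'rV[R]_n.+1 := \row_w (hess x u a b 0 w - ha 0 w * hb 0 w / p 0 w
  + G / sg * (p *m Cm *m Km) 0 w).
have yE : y = y *m Cm *m Km.
  apply: (cellularP (h := \row_l ((hess x u a b *m Cm) 0 l
    - (ha *m Cm) 0 l * (hb *m Cm) 0 l / (p *m Cm) 0 l + G / sg * (p *m Cm) 0 l))) => w.
  rewrite mxE (cell_entry _ (hess_cell a b)) (cell_entry _ haE) (cell_entry _ hbE) mul_splitE.
  case E : (cell c w) => [l|]; last by rewrite !mul0r mulr0 subr0 addr0.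
  rewrite (point_some _ E) -/p [X in _ = _ * X]mxE; field.
  by rewrite (gt_eqF sg0) q0 (gt_eqF (kap_gt0 c w)).
have sy : \sum_w y 0 w = 0.
  under eq_bigr do rewrite mxE.
  rewrite big_split /= sumrB sum_hess sub0r -mulr_sumr sum_split.
  rewrite (sum_lump_cell_set (iota_cell _)) divfK ?gt_eqF//.
  rewrite /G gramE pE; under eq_bigr do rewrite [ha _ _]mxE [hb _ _]mxE.
  by rewrite addNr.
have [r rE] := cell_tangentP yE sy.
(* The constant [- G] cancels the 1 in [curvature_row]: on frozen outcomes everything vanishes, and
   on cells [- G / sg] offsets the correction made in [y]. *)
exists r, (- G); apply/rowP => w.
have -> : (r *m F u + G *: curvature_row + const_mx (- G)) 0 w =
    (r *m F u) 0 w + G * curvature_row 0 w - G by rewrite [LHS]mxE [X in X + _ = _]mxE [X in _ + X + _ = _]mxE [const_mx _ _ _]mxE.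
have -> : (r *m F u) 0 w = y 0 w / p 0 w by rewrite -wdivM -rE mxE pE.
have -> : escore x u a b 0 w = hess x u a b 0 w / p 0 w - ha 0 w / p 0 w * (hb 0 w / p 0 w).
  by rewrite [LHS]mxE [mscore _ _ _ _ _ _]mxE [F u a w]mxE [F u b w]mxE pE [ha _ _]mxE [hb _ _]mxE.
rewrite [y 0 w]mxE [curvature_row 0 w]mxE mul_splitE.
have pw : p 0 w != 0 by rewrite (gt_eqF (gt0 (phi u) w)).
case E : (cell c w) => [l|].
  rewrite -(point_some _ E) -/p; field.
  by rewrite pw gt_eqF.
by field; rewrite pw gt_eqF.
Qed.

End InChart.

Lemma cell_mconn_form (U : set 'rV[R]_m) phi u v w : parametrization iota U phi -> U u ->
  second_fundamental_form fisher mconn (coord_expr iota phi) u v w = 0.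
Proof.
move=> par Uu; have pos := coord_expr_pos cell_simplex phi u.
rewrite (second_fundamental_form_decomp pos (row_free_tangent cell_simplex par Uu)
  (nabla_along_mconn pos) (mscore_cell par Uu)).
by rewrite !mul0mx normal_part0 scaler0.
Qed.

Lemma cell_econn_form (U : set 'rV[R]_m) phi u : parametrization iota U phi -> U u ->
  forall v w, second_fundamental_form fisher econn (coord_expr iota phi) u v w =
  (v *m induced_metric fisher (coord_expr iota phi) u *m w^T) 0 0 *:
    normal_part fisher (coord_expr iota phi) u
    (curvature_row *m (prob_mx R n)^T *m invmx (fisher (coord_expr iota phi u))).
Proof.
move=> par Uu; have pos := coord_expr_pos cell_simplex phi u.
exact: (second_fundamental_form_decomp pos (row_free_tangent cell_simplex par Uu)
  (nabla_along_econn pos) (escore_cell par Uu)).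
Qed.

Lemma cell_mconn_autoparallel : autoparallel m iota mconn.
Proof. by move=> U phi par u Uu v w; exact: (cell_mconn_form v w par Uu). Qed.

Lemma cell_doubly_umbilical : (0 < m)%N -> doubly_umbilical m iota.
Proof.
move=> m0; split=> U phi par u Uu E oE v w; last first.
  have sN v' w' : second_fundamental_form fisher mconn (coord_expr iota phi) u v' w' =
    (v' *m induced_metric fisher (coord_expr iota phi) u *m w'^T) 0 0 *: 0.
    by rewrite (cell_mconn_form _ _ par Uu) scaler0.
  by rewrite (mean_curvature_umbilic m0 oE sN) sN.
by rewrite (mean_curvature_umbilic m0 oE (cell_econn_form par Uu)) (cell_econn_form par Uu).
Qed.

Lemma cell_econn_autoparallel : (forall w, cell c w != None) -> autoparallel m iota econn.
Proof.
move=> cN U phi par u Uu v w; rewrite (cell_econn_form par Uu).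
have f0 w' : frozen_row c 0 w' = 0 by rewrite mxE; case: (cell c w') (cN w').
have sg1 : sg = 1 by rewrite /sg big1 ?subr0.
have -> : curvature_row = 0.
  by apply/rowP => i; rewrite !mxE sg1 invr1; case: (cell c i) (cN i) => // l _; rewrite subrr.
by rewrite !mul0mx normal_part0 scaler0.
Qed.

(** A vanishing e-form makes [curvature_row] a tangent score plus a constant [d]. A frozen outcome
    [w] forces [d = 1]; the tangent score is then [- sg^-1] on all cells, so its tangent vector has
    sum -1 instead of 0. *)
Lemma cell_autoparallel_none (U : set 'rV[R]_m) phi u : (0 < m)%N -> parametrization iota U phi -> U u ->
  autoparallel m iota econn -> forall w, cell c w != None.
Proof.
move=> m0 par Uu ap w; apply/eqP => cw.
have pos := coord_expr_pos cell_simplex phi u.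
have pE := prob_coord_expr cell_simplex phi u.
have sg0 : 0 < sg by exact: cell_weight_gt0 (iota_cell (phi u)).
pose v : 'rV[R]_m := delta_mx 0 (Ordinal m0).
have v0 : v != 0.
  by apply/eqP => /matrixP/(_ 0 (Ordinal m0)); rewrite !mxE !eqxx => /eqP; rewrite oner_eq0.
have := cell_econn_form par Uu v v; rewrite (ap _ _ par u Uu) => /esym/eqP.
rewrite scaler_eq0 => /orP[/eqP|/eqP/normal_part_eq0[r rE]].
  rewrite induced_metricE// -gramM => /(gram_eq0 pos)/eqP.
  by rewrite mulmx_free_eq0 ?(negPf v0)//; exact: (row_free_tangent cell_simplex par).
have : (curvature_row - r *m score_mx (coord_expr iota phi) u) *m (prob_mx R n)^T = 0.
  by rewrite mulmxBl -[r *m _ *m _]mulmxA -(jac_fisher pos) mulmxA -rE mulmxKV ?subrr// fisher_unit.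
move=> /mulT_prob_mx_eq0[d dE].
have E i : curvature_row 0 i - (r *m tangent_mx (coord_expr iota phi) u) 0 i / iota (phi u) 0 i = d.
  have := congr1 (fun N : 'rV[R]_n.+1 => N 0 i) dE.
  by rewrite -wdivM [LHS]mxE [X in _ + X]mxE [wdiv _ _ _ _]mxE pE [RHS]mxE.
have TE : r *m tangent_mx (coord_expr iota phi) u =
    r *m tangent_mx (coord_expr iota phi) u *m Cm *m Km.
  by rewrite {1}(tangent_cell par Uu) !mulmxA.
have d1 : d = 1.
  by rewrite -(E w) (cell_entry w TE) cw mul0r subr0 mxE cw subr0.
have T0 : \sum_i (r *m tangent_mx (coord_expr iota phi) u) 0 i = 0 by exact: mean_tangent.
have T1 : \sum_i (r *m tangent_mx (coord_expr iota phi) u) 0 i =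
    \sum_i - sg^-1 * (iota (phi u) *m Cm *m Km) 0 i.
  apply: eq_bigr => i _; rewrite mul_splitE; have := E i; rewrite d1 mxE.
  have := cell_entry i TE.
  have p0 : iota (phi u) 0 i != 0 by rewrite gt_eqF// (iota_gt0 cell_simplex).
  case Ei : (cell c i) => [l|]; last by move=> ->; rewrite mulr0.
  rewrite -(point_some _ Ei) => _ h.
  have -> : - sg^-1 = (r *m tangent_mx (coord_expr iota phi) u) 0 i / iota (phi u) 0 i.
    by move: h; set z := _ / _ => h; lra.
  by rewrite divfK.
move: T0; rewrite T1 -mulr_sumr sum_split (sum_lump_cell_set (iota_cell _)) mulNr mulVf ?gt_eqF//.
by move/eqP; rewrite oppr_eq0 oner_eq0.
Qed.

End CellSubmanifold.

Lemma simplex_pos (R : realType) n (p : 'rV[R]_n.+1) : (0 < n)%N ->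
  (forall w, 0 < p 0 w) -> \sum_w p 0 w = 1 -> simplex n p.
Proof.
move=> n0 p0 p1; have [q [q0 q1] E] : (@eta R n @` simplex n) (eta p).
  by apply/eta_simplexP => // w; rewrite etaK.
by rewrite -(etaK p1) -E etaK.
Qed.

Lemma near_eq_jacobian (R : realType) m n (f g : 'rV[R]_m -> 'rV[R]_n) u :
  (\forall y \near u, f y = g y) -> differentiable f u -> 'J f u = 'J g u.
Proof.
move=> fg df; apply/row_matrixP => a.
have dg := near_eq_differentiable fg df.
apply: etrans (row_jacobian a df) _; apply: etrans (esym (row_jacobian a dg)).
exact: near_eq_derive.
Qed.

Lemma jacobian_affine_id (R : realType) m n (A : 'M[R]_(m, n)) b u :
  'J (fun y : 'rV[R]_m => y *m A + b) u = A.
Proof.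
apply/row_matrixP => a; have di : differentiable (@id 'rV[R]_m) u by exact: ex_diff.
rewrite (row_jacobian a (differentiable_affine A b di)).
by rewrite (derive_affine A b (basis_vec a) di) derive_id -rowE.
Qed.

Lemma eta_prob_mx (R : realType) n (y : 'rV[R]_n.+1) :
  \sum_w y 0 w = 0 -> y *m eta_mx R n *m prob_mx R n = y.
Proof.
move=> y0; pose e : 'rV[R]_n.+1 := delta_mx 0 ord_max.
have eE : e *m eta_mx R n = 0.
  by apply/rowP => i; rewrite -rowE !mxE (negPf (neq_lift _ _)).
have e1 : \sum_w e 0 w = 1.
  rewrite (bigD1 ord_max)//= mxE !eqxx big1 ?addr0// => w /negPf h.
  by rewrite mxE h andbF.
have : \sum_w (y + e) 0 w = 1.
  by under eq_bigr do rewrite mxE; rewrite big_split /= y0 add0r.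
by move/etaK; rewrite probE etaE mulmxDl eE addr0 => /addIr.
Qed.

(** * Invariance under splitting of cells, and Markov embeddings *)

Section Lumping.
Variables (R : realType) (n m : nat) (c : cells R n m).
Local Notation Km := (split_mx c).

Lemma sum_cells (G : 'I_m.+1 -> R) (H : 'I_n.+1 -> R) :
  (forall w, H w = if cell c w is Some l then kap c w * G l else 0) ->
  \sum_w H w = \sum_l G l.
Proof.
move=> HG; transitivity (\sum_w (\row_l G l *m Km) 0 w).
  apply: eq_bigr => w _; rewrite HG mul_splitE.
  by case: (cell c w) => // l; rewrite mxE.
by rewrite sum_split; apply: eq_bigr => l _; rewrite mxE.
Qed.

(** Inside a cell, split vectors and [p] carry the same factor [kap], so one factor is left and sums
    to 1 over the cell. With [lump_cubic] this is the invariance of the Fisher metric and the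
    e-connection under Markov embeddings. *)
Lemma lump_gram (y z q : 'rV[R]_m.+1) (p : 'rV[R]_n.+1) : (forall l, q 0 l != 0) ->
  (forall w l, cell c w = Some l -> p 0 w = kap c w * q 0 l) ->
  \sum_w (y *m Km) 0 w * (z *m Km) 0 w / p 0 w = \sum_l y 0 l * z 0 l / q 0 l.
Proof.
move=> q0 pq; apply: sum_cells => w; rewrite !mul_splitE.
case E : (cell c w) => [l|]; last by rewrite !mul0r.
by rewrite (pq _ _ E); field; rewrite q0 gt_eqF// kap_gt0.
Qed.

Lemma lump_cubic (y z v q : 'rV[R]_m.+1) (p : 'rV[R]_n.+1) : (forall l, q 0 l != 0) ->
  (forall w l, cell c w = Some l -> p 0 w = kap c w * q 0 l) ->
  \sum_w (y *m Km) 0 w * (z *m Km) 0 w * (v *m Km) 0 w / p 0 w ^+ 2 =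
  \sum_l y 0 l * z 0 l * v 0 l / q 0 l ^+ 2.
Proof.
move=> q0 pq; apply: sum_cells => w; rewrite !mul_splitE.
case E : (cell c w) => [l|]; last by rewrite !mul0r.
by rewrite (pq _ _ E); field; rewrite q0 gt_eqF// kap_gt0.
Qed.

Lemma cell_inhabited l : exists w, cell c w = Some l.
Proof.
apply: contrapT => h; have := sum_kap c l; rewrite big1 => [/eqP|w /eqP cw].
  by rewrite eq_sym oner_eq0.
by exfalso; apply: h; exists w.
Qed.

Lemma cells_leq : (m <= n)%N.
Proof.
pose f l := sval (cid (cell_inhabited l)).
have fP l : cell c (f l) = Some l := svalP (cid (cell_inhabited l)).
have fI : injective f by move=> l l' E; apply: Some_inj; rewrite -!fP E.
by have := leq_card f fI; rewrite !card_ord.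
Qed.

Lemma mul_split_gt0 (q : 'rV[R]_m.+1) w l : (forall l, 0 < q 0 l) -> cell c w = Some l ->
  0 < (q *m Km) 0 w.
Proof. by move=> q0 E; rewrite mul_splitE E mulr_gt0// kap_gt0. Qed.

(** Lumping is a continuous linear left inverse of splitting; injectivity, the rank of the
    differential and openness onto the image all come from it. *)
Lemma markov_split (f : 'rV[R]_m.+1 -> 'rV[R]_n.+1) : (0 < m)%N ->
  (forall w, cell c w != None) -> (forall q, simplex m q -> f q = q *m Km) ->
  markov_embedding f.
Proof.
move=> m0 cN fE; have mn := cells_leq; have n0 := leq_trans m0 mn.
have oU := @open_eta_simplex R m m0.
have f_simplex q : simplex m q -> simplex n (f q).
  move=> sq; rewrite fE//; have [q0 q1] := sq.
  apply: simplex_pos => // [w|]; last by rewrite sum_split.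
  case E : (cell c w) (cN w) => [l|//] _.
  by apply: (mul_split_gt0 _ E) => l'; have /andP[] := q0 l'.
pose A := prob_mx R m *m Km *m eta_mx R n.
pose b : 'rV[R]_n := delta_mx 0 ord_max *m Km *m eta_mx R n.
have xE u : (@eta R m @` simplex m) u -> id u *m A + b = eta (f (prob u)).
  move=> [q sq <-]; rewrite etaK; last by case: sq.
  rewrite fE// [RHS]etaE /A /b /= !mulmxA -!mulmxDl -probE etaK//; by case: sq.
split => //.
  split.
  - by move=> _ [q sq <-]; exact: f_simplex.
  - apply: (smooth_on_eq oU xE); apply: smooth_on_affine => //; exact: smooth_on_id.
  - move=> u Uu; rewrite -(@near_eq_jacobian _ _ _ (fun u => id u *m A + b)).
    + rewrite jacobian_affine_id /A; apply: (@row_free_mull _ _ _ _ _ (prob_mx R n)).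
      have -> : prob_mx R m *m Km *m eta_mx R n *m prob_mx R n = prob_mx R m *m Km.
        apply/row_matrixP => i; rewrite !row_mul eta_prob_mx// sum_split rowE.
        exact: sum_mul_prob_mx.
      apply: (@row_free_mull _ _ _ _ _ (lump_mx c)).
      by rewrite -mulmxA split_lump mulmx1 row_free_prob_mx.
    + by apply: filterS (open_nbhs_nbhs (conj oU Uu)) => y; exact: xE.
    + by apply: differentiable_affine; exact: ex_diff.
  - have : {within simplex m, continuous (mulmxr Km : 'rV[R]_m.+1 -> 'rV[R]_n.+1)}.
      by apply: continuous_subspaceT; exact: continuous_mulmxr.
    apply: subspace_eq_continuous => q; rewrite inE => sq; exact: esym (fE _ sq).
  split.
    move=> q q'; rewrite !inE => sq sq'; rewrite !fE// => /(congr1 (mulmx^~ (lump_mx c))).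
    by rewrite -!mulmxA split_lump !mulmx1.
  move=> V oV; exists [set p | V (p *m lump_mx c)].
    by apply: (@open_comp _ _ (mulmxr (lump_mx c)) V) => // p _; exact: continuous_mulmxr.
  apply/seteqP; split => [_ [q [Vq sq] <-]|p [Vp [q sq qE]]].
    split; last by exists q.
    by rewrite /= fE// -mulmxA split_lump mulmx1.
  exists q => //; split => //; move: Vp; rewrite -qE /= fE//.
  by rewrite -mulmxA split_lump mulmx1.
exists (fun l => [set w | cell c w == Some l]%SET), (fun l => row l Km).
split=> [l|l l' w|w|l w|p sp].
- have [w cw] := cell_inhabited l; apply/finset.set0Pn; exists w.
  by rewrite inE cw.
- by rewrite !inE => /eqP -> /eqP[].
- by case E : (cell c w) (cN w) => [l|//] _; exists l; rewrite inE E.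
- rewrite inE !mxE; case: ifP => [_|_]; last by rewrite eqxx.
  by rewrite ltW// kap_gt0.
- rewrite fE//; exact: mulmx_sum_row.
Qed.

End Lumping.

Section SubConnection.
Variables (R : realType) (n m : nat) (M : topologicalType) (iota : M -> 'rV[R]_n.+1).
Hypothesis iota_simplex : forall t, simplex n (iota t).
Variable phi : 'rV[R]_m -> M.
Local Notation x := (coord_expr iota phi).
Local Notation P := (fun u => iota (phi u)).

Lemma sub_metricE u a b : sub_metric iota phi u a b =
  \sum_w tangent_mx x u a w * tangent_mx x u b w / iota (phi u) 0 w.
Proof.
rewrite /sub_metric induced_metricE; last exact: coord_expr_pos.
by rewrite gramE prob_coord_expr.
Qed.

Lemma sub_connectionE u a b k : sub_connection iota phi u a b 0 k =
  \sum_w hess x u a b 0 w * tangent_mx x u k w / iota (phi u) 0 w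
  - \sum_w tangent_mx x u a w * tangent_mx x u b w * tangent_mx x u k w
      / iota (phi u) 0 w ^+ 2.
Proof.
rewrite /sub_connection induced_econnE; last exact: coord_expr_pos.
rewrite mxE -sumrB; apply: eq_bigr => w _.
rewrite [escore _ _ _ _ _ _]mxE [mscore _ _ _ _ _ _]mxE [_^T _ _]mxE.
rewrite ![score_mx _ _ _ _]mxE prob_coord_expr//.
by field; rewrite gt_eqF// iota_gt0.
Qed.

End SubConnection.

(** * A global chart of a cellular family by the simplex of its cells *)

Section CellChart.
Variables (R : realType) (n m : nat) (c : cells R n m) (S : set 'rV[R]_n.+1).
Hypothesis SE : S = cell_set c.
Hypothesis m_gt0 : (0 < m)%N.
Variable t0 : set_type S.
Local Notation Cm := (lump_mx c).
Local Notation Km := (split_mx c).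
Local Notation sg := (cell_weight c).
Local Notation inc := (@set_val _ S).
Local Notation D := (@eta R m @` simplex m).

Let mn : (m <= n)%N. Proof. exact: cells_leq c. Qed.
Let n_gt0 : (0 < n)%N. Proof. exact: leq_trans mn. Qed.

Lemma inc_cell t : cell_set c (inc t).
Proof. by rewrite -SE; exact: set_valP. Qed.

Lemma weight_gt0 : 0 < sg. Proof. exact: cell_weight_gt0 (inc_cell t0). Qed.

(** The cells share the total mass [sg], so scaling by it identifies the family with the whole
    simplex of dimension [m]. *)
Definition cell_point (q : 'rV[R]_m.+1) : 'rV[R]_n.+1 := sg *: (q *m Km) + frozen_row c.
Definition cell_coord (p : 'rV[R]_n.+1) : 'rV[R]_m.+1 := sg^-1 *: (p *m Cm).
(** Off the simplex, [insubd] may return the default [t0]; the chart uses only points of the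
    simplex, where the lift is [cell_point]. *)
Definition cell_lift (q : 'rV[R]_m.+1) : set_type S := insubd t0 (cell_point q).

Lemma cell_pointK : cancel cell_point cell_coord.
Proof.
move=> q; rewrite /cell_coord /cell_point mulmxDl frozen_lump addr0 -scalemxAl.
by rewrite -mulmxA split_lump mulmx1 scalerA mulVf ?scale1r// gt_eqF// weight_gt0.
Qed.

Lemma cell_coordK p : cell_set c p -> cell_point (cell_coord p) = p.
Proof.
move=> [_ {2}->]; rewrite /cell_coord /cell_point -scalemxAl scalerA.
by rewrite mulfV ?scale1r// gt_eqF// weight_gt0.
Qed.

Lemma cell_point_set q : simplex m q -> cell_set c (cell_point q).
Proof.
move=> [q0 q1].
have fE : cell_point q = cell_point q *m Cm *m Km + frozen_row c.
  have := cell_pointK q; rewrite /cell_coord => /(congr1 ( *:%R sg)).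
  rewrite scalerA mulfV ?scale1r; last by rewrite gt_eqF// weight_gt0.
  by move=> ->; rewrite {1}/cell_point scalemxAl.
split=> //; apply: simplex_pos => // [w|].
  rewrite mxE [X in X + _]mxE; case E : (cell c w) => [l|].
    rewrite (frozen_row_some E) addr0 mulr_gt0 ?weight_gt0//.
    by apply: (mul_split_gt0 _ E) => l'; have /andP[] := q0 l'.
  by rewrite (frozen_row_none E) mul_splitE E mulr0 add0r kap_gt0.
under eq_bigr do rewrite mxE [X in X + _]mxE.
by rewrite big_split /= -mulr_sumr sum_split q1 mulr1 /cell_weight subrK.
Qed.

Lemma cell_coord_simplex p : cell_set c p -> simplex m (cell_coord p).
Proof.
move=> cp; have [[p0 _] _] := cp; apply: simplex_pos => // [l|].
  rewrite mxE mulr_gt0 ?invr_gt0 ?weight_gt0// lump_gt0// => w.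
  by have /andP[] := p0 w.
under eq_bigr do rewrite mxE.
by rewrite -mulr_sumr (sum_lump_cell_set cp) mulVf// gt_eqF// weight_gt0.
Qed.

Lemma inc_cell_lift q : simplex m q -> inc (cell_lift q) = cell_point q.
Proof.
move=> sq; rewrite set_valE; apply: insubdK; rewrite inE SE; exact: cell_point_set.
Qed.

Lemma cell_lift_coord t : cell_lift (cell_coord (inc t)) = t.
Proof.
apply: val_inj; rewrite -set_valE inc_cell_lift ?cell_coordK//; first exact: inc_cell.
by apply: cell_coord_simplex; exact: inc_cell.
Qed.

Lemma prob_domain u : D u -> simplex m (prob u).
Proof. by move=> [q [q0 q1] <-]; rewrite etaK. Qed.

Let A := sg *: (prob_mx R m *m Km).
Let b : 'rV[R]_n.+1 := sg *: (delta_mx 0 ord_max *m Km) + frozen_row c.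

Lemma cell_point_affine u : cell_point (prob u) = id u *m A + b.
Proof.
by rewrite /cell_point probE mulmxDl scalerDr -addrA -scalemxAr mulmxA.
Qed.

Lemma near_cell_lift u : D u -> \forall y \near u,
  id y *m A + b = inc (cell_lift (prob y)).
Proof.
move=> Du; apply: filterS (open_nbhs_nbhs (conj (open_eta_simplex m_gt0) Du)) => y Dy.
by rewrite inc_cell_lift ?cell_point_affine//; exact: prob_domain.
Qed.

Lemma row_free_cell_chart : row_free A.
Proof.
apply: (@row_free_mull _ _ _ _ _ (sg^-1 *: Cm)).
rewrite -scalemxAl -scalemxAr scalerA mulfV ?scale1r; last by rewrite gt_eqF// weight_gt0.
by rewrite -mulmxA split_lump mulmx1 row_free_prob_mx.
Qed.

Lemma jacobian_cell_chart u : D u -> 'J (fun y => inc (cell_lift (prob y))) u = A.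
Proof.
move=> Du; rewrite -(near_eq_jacobian (near_cell_lift Du)) ?jacobian_affine_id//.
by apply: differentiable_affine; exact: ex_diff.
Qed.

Lemma inc_simplex t : simplex n (inc t).
Proof. by case: (inc_cell t). Qed.

Lemma cell_chart : parametrization inc D (cell_lift \o @prob R m).
Proof.
have oD : open D by exact: open_eta_simplex.
apply/(parametrizationE inc_simplex); split => //.
- move=> u Du B; rewrite nbhsE => -[_ [[W oW <-] Wu] WB].
  have c0 : {for u, continuous (fun y => inc (cell_lift (prob y)))}.
    apply: differentiable_continuous; apply: near_eq_differentiable (near_cell_lift Du) _.
    by apply: differentiable_affine; exact: ex_diff.
  have cn : \forall y \near u, W (inc (cell_lift (prob y))).
    exact: (c0 W (open_nbhs_nbhs (conj oW Wu))).
  by apply: (filterS _ cn) => y Wy; exact: WB.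
- move=> u u'; rewrite !inE => Du Du' /= /(congr1 inc).
  rewrite !inc_cell_lift; [|exact: prob_domain..].
  by move=> /(can_inj cell_pointK)/(can_inj (@probK R m)).
(* The image of [V] is the trace on [S] of the preimage of [V] under the linear map giving the cell
   coordinates, hence open in the subspace topology. *)
- move=> V oV VD; exists [set p | V (eta (cell_coord p))].
    have -> : [set p | V (eta (cell_coord p))] = (mulmxr (sg^-1 *: (Cm *m eta_mx R m))) @^-1` V.
      apply/funext => p; rewrite /preimage /= etaE /cell_coord -scalemxAl -scalemxAr mulmxA //.
    apply: (@open_comp _ _ (mulmxr (sg^-1 *: (Cm *m eta_mx R m))) V) => // p _.
    exact: continuous_mulmxr.
  apply/seteqP; split => [t /= Vt|t [y Vy <-]] /=.
    exists (eta (cell_coord (inc t))) => //=.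
    rewrite etaK ?cell_lift_coord//.
    by have [] := cell_coord_simplex (inc_cell t).
  rewrite inc_cell_lift; last by apply: prob_domain; exact: VD.
  by rewrite cell_pointK probK.
- split=> [|u Du]; last by rewrite jacobian_cell_chart// row_free_cell_chart.
  apply: (smooth_on_eq oD (f := fun y => id y *m A + b)).
    by move=> y Dy; rewrite -cell_point_affine inc_cell_lift//; exact: prob_domain.
  by apply: smooth_on_affine => //; exact: smooth_on_id.
Qed.

Lemma cell_lift_onto : cell_lift @` simplex m = [set: set_type S].
Proof.
apply/seteqP; split => // t _; exists (cell_coord (inc t)); last exact: cell_lift_coord.
by apply: cell_coord_simplex; exact: inc_cell.
Qed.

Lemma cell_submanifold : submanifold m inc.
Proof.
split; [exact: inc_simplex|by move=> t t'; rewrite set_valE => /val_inj|].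
move=> t; exists D, (cell_lift \o @prob R m), (eta (cell_coord (inc t))).
have [cs0 cs1] := cell_coord_simplex (inc_cell t).
split; [exact: cell_chart|by exists (cell_coord (inc t))|].
by rewrite /= etaK// cell_lift_coord.
Qed.

(** Without frozen outcomes [sg = 1] and the chart is affine with differential
    [prob_mx *m split_mx]; its hessian vanishes, and splitting invariance identifies both
    structures. *)
Lemma cell_statistical_diffeo : (forall w, cell c w != None) ->
  statistical_diffeo inc cell_lift.
Proof.
move=> cN; split; [exact: cell_chart|exact: cell_lift_onto|].
move=> u Du; have par := cell_chart.
have f0 : frozen_row c = 0 by apply/rowP => w; rewrite !mxE; case: (cell c w) (cN w).
have sg1 : sg = 1 by rewrite /cell_weight big1 ?subr0// => w _; rewrite f0 mxE.
have pu : positive_at u by apply/eta_simplexP.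
have TE : tangent_mx (coord_expr inc (cell_lift \o @prob R m)) u = prob_mx R m *m Km.
  by rewrite (tangent_mxE inc_simplex par)// jacobian_cell_chart// /A sg1 scale1r.
have PE : inc (cell_lift (prob u)) = prob u *m Km.
  by rewrite inc_cell_lift /cell_point ?f0 ?sg1 ?scale1r ?addr0//; exact: prob_domain.
have qK w l : cell c w = Some l -> (prob u *m Km) 0 w = kap c w * prob u 0 l.
  by move=> E; rewrite mul_splitE E.
have q0 l : prob u 0 l != 0 by rewrite gt_eqF.
have rE (a : 'I_m) w : (prob_mx R m *m Km) a w = (row a (prob_mx R m) *m Km) 0 w.
  by rewrite -row_mul [RHS]mxE.
have hess0 a b' : hess (coord_expr inc (cell_lift \o @prob R m)) u a b' = 0.
  rewrite (hessE inc_simplex par)//.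
  have E y : D y -> 'D_(basis_vec b') (fun y => inc (cell_lift (prob y))) y = row b' A.
    move=> Dy; rewrite -(near_eq_derive _ (near_cell_lift Dy)) derive_affine.
      by rewrite derive_id -rowE.
    exact: ex_diff.
  rewrite (near_eq_derive (g := cst (row b' A))) ?derive_cst//.
  exact: filterS E (open_nbhs_nbhs (conj (open_eta_simplex m_gt0) Du)).
split.
  apply/matrixP => a b'; rewrite fisherE// mxE (sub_metricE inc_simplex) TE /= PE.
  under [RHS]eq_bigr do rewrite !rE.
  rewrite (lump_gram _ _ q0 qK); apply: eq_bigr => l _.
  by rewrite ![row _ _ _ _]mxE.
move=> a b'; apply/rowP => k; rewrite econnE// mxE (sub_connectionE inc_simplex) TE hess0 /= PE.
rewrite [X in _ = X - _]big1 ?sub0r; last by move=> w _; rewrite mxE !mul0r.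
under [in RHS]eq_bigr do rewrite !rE.
rewrite (lump_cubic _ _ _ q0 qK); congr (- _); apply: eq_bigr => l _.
by rewrite ![row _ _ _ _]mxE.
Qed.

Lemma cell_markov : (forall w, cell c w != None) -> markov_embedding (inc \o cell_lift).
Proof.
move=> cN; apply: (markov_split (c := c)) => // q sq /=; rewrite inc_cell_lift//.
have f0 : frozen_row c = 0 by apply/rowP => w; rewrite !mxE; case: (cell c w) (cN w).
have sg1 : sg = 1 by rewrite /cell_weight big1 ?subr0// => w _; rewrite f0 mxE.
by rewrite /cell_point f0 sg1 scale1r addr0.
Qed.

End CellChart.

(** * A cellular family as a slice of a larger simplex *)

Section Slice.
Variables (R : realType) (n m : nat) (c : cells R n m) (w0 : 'I_n.+1).
Hypothesis cw0 : cell c w0 = None.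
Local Notation Cm := (lump_mx c).
Local Notation Km := (split_mx c).

Let tau := \sum_w frozen_row c 0 w.

Lemma frozen_weightE : tau = \sum_(w | cell c w == None) kap c w.
Proof.
by rewrite /tau [RHS]big_mkcond; apply: eq_bigr => w _; rewrite mxE; case: (cell c w).
Qed.

Lemma frozen_weight_gt0 : 0 < tau.
Proof.
rewrite frozen_weightE (bigD1 w0) ?cw0//= ltr_wpDr ?kap_gt0//.
by apply: sumr_ge0 => w _; rewrite ltW// kap_gt0.
Qed.

(** All frozen outcomes are merged into one extra cell, the last one, with conditional probabilities
    [kap / tau]. The family then lies in a Markov image of the simplex of dimension [m.+1], where
    the last coordinate is [tau]. *)
Definition total_cell w : option 'I_m.+2 :=
  Some (if cell c w is Some l then lift ord_max l else ord_max).
Definition total_kap w : R := if cell c w is Some _ then kap c w else kap c w / tau.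

Lemma total_kap_gt0 w : 0 < total_kap w.
Proof.
by rewrite /total_kap; case: (cell c w) => [_|]; rewrite ?divr_gt0 ?kap_gt0 ?frozen_weight_gt0.
Qed.

Lemma sum_total_kap l : \sum_(w | total_cell w == Some l) total_kap w = 1.
Proof.
rewrite /total_cell /total_kap; case: (unliftP ord_max l) => [l' ->|->].
  rewrite -(sum_kap c l') big_mkcond [RHS]big_mkcond; apply: eq_bigr => w _.
  case: (cell c w) => [l''|] /=; rewrite (inj_eq Some_inj); last by rewrite (negPf (neq_lift _ _)).
  by rewrite (inj_eq lift_inj) (inj_eq Some_inj).
rewrite -[RHS](mulfV (lt0r_neq0 frozen_weight_gt0)) [X in _ = X / _]frozen_weightE mulr_suml.
rewrite big_mkcond [RHS]big_mkcond; apply: eq_bigr => w _.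
case: (cell c w) => [l''|] /=; last by rewrite !eqxx.
have -> : (Some (lift ord_max l'') == Some ord_max) = false.
  by rewrite (inj_eq Some_inj) [LHS]eq_sym; exact: (negPf (neq_lift _ _)).
by [].
Qed.

Definition total_cells : cells R n m.+1 := Cells total_kap_gt0 sum_total_kap.

(** Inside the larger simplex the family is again cellular: one singleton cell per original cell,
    and a single frozen outcome of probability [tau]. *)
Definition slice_kap (l : 'I_m.+2) : R := if unlift ord_max l is Some _ then 1 else tau.

Lemma slice_kap_gt0 l : 0 < slice_kap l.
Proof. by rewrite /slice_kap; case: unlift => [_|]; rewrite ?ltr01 ?frozen_weight_gt0. Qed.

Lemma sum_slice_kap l : \sum_(w | unlift ord_max w == Some l) slice_kap w = 1.
Proof.
rewrite (bigD1 (lift ord_max l)) ?liftK//= /slice_kap liftK big1 ?addr0// => w.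
case: unliftP => [j -> /=|-> //]; rewrite (inj_eq Some_inj) => /andP[/eqP ->].
by rewrite eqxx.
Qed.

Definition slice_cells : cells R m.+1 m :=
  @Cells R m.+1 m (fun l => unlift ord_max l) slice_kap slice_kap_gt0 sum_slice_kap.
Local Notation Kt := (split_mx total_cells).
Local Notation Ks := (split_mx slice_cells).

Lemma slice_total : Ks *m Kt = Km.
Proof.
apply/row_matrixP => l; apply/rowP => w; rewrite row_mul mul_splitE /= mxE.
rewrite mxE [RHS]mxE [RHS]mxE /total_kap /slice_kap /=; case E : (cell c w) => [l'|].
  by rewrite /slice_kap !liftK (inj_eq Some_inj); case: eqP; rewrite ?mulr1 ?mulr0.
by rewrite unlift_none mulr0.
Qed.

Lemma frozen_total : frozen_row slice_cells *m Kt = frozen_row c.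
Proof.
apply/rowP => w; rewrite mul_splitE /= mxE /= /total_kap /slice_kap [RHS]mxE.
case E : (cell c w) => [l'|]; first by rewrite liftK mulr0.
by rewrite unlift_none divfK// gt_eqF// frozen_weight_gt0.
Qed.

Definition slice_point (p : 'rV[R]_n.+1) : 'rV[R]_m.+2 := p *m Cm *m Ks + frozen_row slice_cells.

Lemma slice_pointK p : cell_set c p -> slice_point p *m Kt = p.
Proof. by move=> [_ {2}->]; rewrite mulmxDl -mulmxA slice_total frozen_total. Qed.

Lemma sum_slice_frozen : \sum_l frozen_row slice_cells 0 l = tau.
Proof.
rewrite sum_unlift big1 ?add0r => [|i _]; last by rewrite mxE /= liftK.
by rewrite mxE /= unlift_none /slice_kap unlift_none.
Qed.

Lemma slice_point_set p : cell_set c p -> cell_set slice_cells (slice_point p).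
Proof.
move=> cp; have [[p0 p1] _] := cp; split.
  apply: simplex_pos => // [l|].
    rewrite mxE mul_splitE /= [frozen_row _ _ _]mxE /= /slice_kap.
    case: unliftP => [j _|_]; last by rewrite add0r frozen_weight_gt0.
    by rewrite mul1r addr0 lump_gt0// => w; have /andP[] := p0 w.
  under eq_bigr do rewrite mxE.
  rewrite big_split /= sum_split (sum_lump_cell_set cp) sum_slice_frozen.
  by rewrite /cell_weight subrK.
rewrite /slice_point mulmxDl frozen_lump addr0; congr (_ + _).
by rewrite -!mulmxA (mulmxA Ks) split_lump mul1mx.
Qed.

Variables (S : set 'rV[R]_n.+1) (SE : S = cell_set c) (m_gt0 : (0 < m)%N) (t0 : set_type S).
Local Notation inc := (@set_val _ S).
Let j := slice_point \o inc.

Let inc_set t : cell_set c (inc t). Proof. by rewrite -SE; exact: set_valP. Qed.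

Lemma j_simplex t : simplex m.+1 (j t).
Proof. by case: (slice_point_set (inc_set t)). Qed.

Lemma inc_j t : inc t = j t *m Kt.
Proof. by rewrite slice_pointK. Qed.

Lemma slice_parametrization (U : set 'rV[R]_m) phi :
  parametrization inc U phi -> parametrization j U phi.
Proof.
have inc_s t : simplex n (inc t) by case: (inc_set t).
move=> /(parametrizationE inc_s)[oU cphi iphi ophi [sP rP]].
have jE : (fun u => j (phi u)) =
    (fun u => inc (phi u) *m (Cm *m Ks) + frozen_row slice_cells).
  by apply/funext => u; rewrite mulmxA.
have sj : smooth_on U (fun u => j (phi u)) by rewrite jE; exact: smooth_on_affine.
apply/(parametrizationE j_simplex); split => //; split => // u Uu.
apply: (@row_free_mull _ _ _ _ _ Kt).
rewrite -(jacobian_affine Kt 0 (smooth_on_differentiable sj Uu)).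
have -> : (fun u => j (phi u) *m Kt + 0) = (fun u => inc (phi u)).
  by apply/funext => y; rewrite addr0 -inc_j.
exact: rP.
Qed.

Lemma slice_submanifold : submanifold m j.
Proof.
have [_ incI chart] := cell_submanifold SE m_gt0 t0.
split; [exact: j_simplex|move=> t t' E; apply: incI; by rewrite !inc_j E|].
move=> t; have [U [phi [u [par Uu <-]]]] := chart t.
by exists U, phi, u; split => //; exact: slice_parametrization.
Qed.

Lemma slice_statistical : @statistical_immersion R n m.+1 m (set_type S) inc j.
Proof.
split; first exact: j_simplex.
have inc_s t : simplex n (inc t) by case: (inc_set t).
move=> U phi par; have parj := slice_parametrization par; split=> // u Uu.
have sj := smooth_point j_simplex parj.
have oU : open U by case: par.
have E : (fun u => inc (phi u)) = (fun u => j (phi u) *m Kt + 0).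
  by apply/funext => y; rewrite addr0 -inc_j.
have TE a w : tangent_mx (coord_expr inc phi) u a w =
    (row a (tangent_mx (coord_expr j phi) u) *m Kt) 0 w.
  rewrite (tangent_mxE inc_s par)// (tangent_mxE j_simplex parj)// E.
  rewrite (jacobian_affine Kt 0 (smooth_on_differentiable sj Uu)).
  by rewrite -row_mul [RHS]mxE.
have hE a b : hess (coord_expr inc phi) u a b = hess (coord_expr j phi) u a b *m Kt.
  rewrite (hessE inc_s par)// (hessE j_simplex parj)// E.
  by rewrite (derive2_affine_smooth _ _ _ _ oU sj).
have q0 l : j (phi u) 0 l != 0 by rewrite gt_eqF// (iota_gt0 j_simplex).
have qK w l : cell total_cells w = Some l ->
    inc (phi u) 0 w = kap total_cells w * j (phi u) 0 l.
  by move=> Ew; rewrite inc_j mul_splitE Ew.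
split.
  apply/matrixP => a b; rewrite (sub_metricE inc_s) (sub_metricE j_simplex).
  under eq_bigr do rewrite !TE.
  by rewrite (lump_gram _ _ q0 qK); apply: eq_bigr => l _; rewrite ![row _ _ _ _]mxE.
move=> a b; apply/rowP => k; rewrite (sub_connectionE inc_s) (sub_connectionE j_simplex).
congr (_ - _).
  under eq_bigr do rewrite TE hE.
  by rewrite (lump_gram _ _ q0 qK); apply: eq_bigr => l _; rewrite [row _ _ _ _]mxE.
under eq_bigr do rewrite !TE.
by rewrite (lump_cubic _ _ _ q0 qK); apply: eq_bigr => l _; rewrite ![row _ _ _ _]mxE.
Qed.

Lemma slice_embedding : exists f : 'rV[R]_m.+2 -> 'rV[R]_n.+1,
  [/\ @markov_embedding R m.+1 n f, S `<=` f @` simplex m.+1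
    & exists j : set_type S -> 'rV[R]_m.+2,
      [/\ forall q, simplex m.+1 (j q) /\ f (j q) = inc q,
          @submanifold R m.+1 m (set_type S) j,
          @statistical_immersion R n m.+1 m (set_type S) inc j
        & @doubly_umbilical R m.+1 m (set_type S) j]].
Proof.
exists (mulmx^~ Kt); split.
- exact: (markov_split (c := total_cells)).
- move=> p; rewrite SE => cp; exists (slice_point p); last exact: slice_pointK.
  by case: (slice_point_set cp).
exists j; split.
- by move=> q; split; [exact: j_simplex|rewrite -inc_j].
- exact: slice_submanifold.
- exact: slice_statistical.
- by apply: (cell_doubly_umbilical (c := slice_cells)) => // t; exact: slice_point_set.
Qed.

End Slice.

(** * The submanifolds Xi are cellular *)

Section XiCells.
Variables (R : realType) (n m : nat) (X : xi_data R n m).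
Hypothesis mn : (m <= n)%N.

Let free := [set w | (w \notin codom (xi_i X)) && (w \notin codom (xi_j X))]%SET.

(** The bound [m <= n] makes the truncated difference [n - m] genuine, so that
    [n.+1 - (n - m) = m.+1]. *)
Lemma card_free : #|free| = m.+1.
Proof.
have ci : #|[set w in codom (xi_i X)]%SET| = xi_A X.
  by rewrite cardsE card_codom ?card_ord//; exact: xi_i_inj.
have cj : #|[set w in codom (xi_j X)]%SET| = xi_B X.
  by rewrite cardsE card_codom ?card_ord//; exact: xi_j_inj.
have dij : ([set w in codom (xi_i X)] :&: [set w in codom (xi_j X)] = finset.set0)%SET.
  apply/setP => w; rewrite !inE; apply/negP.
  by move=> /andP[/codomP[k ->] /codomP[l E]]; have := xi_ij k l; rewrite E eqxx.
have := cardsC ([set w in codom (xi_i X)] :|: [set w in codom (xi_j X)])%SET.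
rewrite cardsU dij cards0 subn0 ci cj (xi_dim X) card_ord.
have -> : (~: ([set w in codom (xi_i X)] :|: [set w in codom (xi_j X)]))%SET = free.
  by apply/setP => w; rewrite !inE negb_or.
by lia.
Qed.

Let rep (l : 'I_m.+1) : 'I_n.+1 := enum_val (cast_ord (esym card_free) l).

Let rep_inj : injective rep.
Proof. by move=> l l' /enum_val_inj/cast_ord_inj. Qed.

Let rep_free l : rep l \in free. Proof. exact: enum_valP. Qed.

Let rep_onto w : w \in free -> exists l, rep l = w.
Proof.
move=> wf; exists (cast_ord card_free (enum_rank_in wf w)).
by rewrite /rep cast_ordK enum_rankK_in.
Qed.

(** On Xi an outcome that is not some [j_l] has probability [coef w] times that of the free outcome
    [root w]. An outcome [j_l] is its own root and is not free, so it gets no cell, and [coef] is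
    its fixed probability. *)
Let root w := if [pick k | xi_i X k == w] is Some k then xi_phi X k else w.
Let coef w := if [pick k | xi_i X k == w] is Some k then xi_a X k else
  if [pick l | xi_j X l == w] is Some l then xi_b X l else 1.
Let xcell w : option 'I_m.+1 := [pick l | rep l == root w].

Let root_i k : root (xi_i X k) = xi_phi X k.
Proof. by rewrite /root; case: pickP => [k' /eqP/xi_i_inj ->//|/(_ k)]; rewrite eqxx. Qed.

Let coef_i k : coef (xi_i X k) = xi_a X k.
Proof. by rewrite /coef; case: pickP => [k' /eqP/xi_i_inj ->//|/(_ k)]; rewrite eqxx. Qed.

Let root_j l : root (xi_j X l) = xi_j X l.
Proof. by rewrite /root; case: pickP => // k /eqP E; have := xi_ij k l; rewrite E eqxx. Qed.

Let coef_j l : coef (xi_j X l) = xi_b X l.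
Proof.
rewrite /coef; case: pickP => [k /eqP E|_]; first by have := xi_ij k l; rewrite E eqxx.
by case: pickP => [l' /eqP/xi_j_inj ->//|/(_ l)]; rewrite eqxx.
Qed.

Let freeP w : w \in free -> root w = w /\ coef w = 1.
Proof.
rewrite inE => /andP[wi wj]; rewrite /root /coef; case: pickP => [k /eqP E|_].
  by rewrite -E codom_f in wi.
by split => //; case: pickP => // l /eqP E; rewrite -E codom_f in wj.
Qed.

Let phi_free k : xi_phi X k \in free.
Proof.
rewrite inE; apply/andP; split; apply/negP => /codomP[l E].
  by have := xi_phi_i k l; rewrite E eqxx.
by have := xi_phi_j k l; rewrite E eqxx.
Qed.

Let trichotomy w : [\/ exists k, w = xi_i X k, exists l, w = xi_j X l | w \in free].
Proof.
have [/codomP[k ->]|wi] := boolP (w \in codom (xi_i X)); first by constructor 1; exists k.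
have [/codomP[k ->]|wj] := boolP (w \in codom (xi_j X)); first by constructor 2; exists k.
by constructor 3; rewrite inE wi wj.
Qed.

Let coef_gt0 w : 0 < coef w.
Proof.
have [[k ->]|[l ->]|/freeP[_ ->]//] := trichotomy w; first by rewrite coef_i xi_a_gt0.
by rewrite coef_j; have /andP[] := xi_b_01 l.
Qed.

Let xcellE w l : xcell w = Some l <-> root w = rep l.
Proof.
rewrite /xcell; case: pickP => [l' /eqP E|h].
  by split=> [[<-]//|]; rewrite -E => /rep_inj ->.
by split=> // E; have := h l; rewrite E eqxx.
Qed.

Let xcell_rep l : xcell (rep l) = Some l.
Proof. by apply/xcellE; case: (freeP (rep_free l)). Qed.

Let xcell_none w : xcell w = None <-> exists l, w = xi_j X l.
Proof.
split=> [wN|[l ->]].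
  have [[k wE]|//|wf] := trichotomy w; last first.
    by have [l lE] := rep_onto wf; move: wN; rewrite -lE xcell_rep.
  have [l lE] := rep_onto (phi_free k).
  by move: wN; rewrite wE (_ : xcell _ = Some l)//; apply/xcellE; rewrite root_i.
case E : (xcell _) => [l'|//]; move/xcellE : E; rewrite root_j => E.
by have := rep_free l'; rewrite inE -E codom_f andbF.
Qed.

(** Normalises the coefficients of a cell: [coef w / mass l] is the conditional probability of [w]
    in cell [l]. *)
Let mass l := \sum_(w | xcell w == Some l) coef w.

Let mass_gt0 l : 0 < mass l.
Proof.
rewrite /mass (bigD1 (rep l)) ?xcell_rep//= ltr_wpDr ?coef_gt0//.
by apply: sumr_ge0 => w _; exact: ltW.
Qed.

Let xkap w := if xcell w is Some l then coef w / mass l else coef w.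

Let xkap_gt0 w : 0 < xkap w.
Proof. by rewrite /xkap; case: (xcell w) => [l|]; rewrite ?divr_gt0. Qed.

Let sum_xkap l : \sum_(w | xcell w == Some l) xkap w = 1.
Proof.
transitivity (\sum_(w | xcell w == Some l) coef w / mass l).
  by apply: eq_bigr => w /eqP E; rewrite /xkap E.
by rewrite -mulr_suml -/(mass l) mulfV ?(gt_eqF (mass_gt0 l)).
Qed.

Let xc : cells R n m := Cells xkap_gt0 sum_xkap.

Let Xi_rel (p : 'rV[R]_n.+1) : (forall k, p 0 (xi_i X k) = xi_a X k * p 0 (xi_phi X k)) /\
    (forall l, p 0 (xi_j X l) = xi_b X l) <->
  forall w, p 0 w = if xcell w is Some l then coef w * p 0 (rep l) else coef w.
Proof.
split=> [[hi hj] w|h].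
  have [[k ->]|[l ->]|wf] := trichotomy w.
  - case E : (xcell _) => [l|]; last first.
      by have [l /eqP] := (xcell_none _).1 E; rewrite (negPf (xi_ij k l)).
    by move/xcellE : E; rewrite root_i coef_i hi => ->.
  - by rewrite (_ : xcell _ = None) ?coef_j//; apply/xcell_none; exists l.
  - have [l lE] := rep_onto wf; rewrite -lE xcell_rep.
    by have [_ ->] := freeP (rep_free l); rewrite mul1r.
split=> [k|l].
  rewrite h; case E : (xcell _) => [l|].
    by move/xcellE : E; rewrite root_i coef_i => ->.
  by have [l /eqP] := (xcell_none _).1 E; rewrite (negPf (xi_ij k l)).
by rewrite h (_ : xcell _ = None) ?coef_j//; apply/xcell_none; exists l.
Qed.

Lemma Xi_cells : exists c : cells R n m, Xi X = cell_set c /\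
  ((forall w, cell c w != None) <-> xi_B X = 0%N).
Proof.
exists xc; split.
  have pE (p : 'rV[R]_n.+1) w : (p *m lump_mx xc *m split_mx xc + frozen_row xc) 0 w =
      if xcell w is Some l then coef w / mass l * (p *m lump_mx xc) 0 l else coef w.
    rewrite mxE mul_splitE /= [frozen_row _ _ _]mxE /= /xkap.
    by case: (xcell w) => [l|]; rewrite ?addr0 ?add0r.
  apply/seteqP; split => p.
    move=> [sp hi hj]; split => //; have h := (Xi_rel p).1 (conj hi hj).
    have q l : (p *m lump_mx xc) 0 l = mass l * p 0 (rep l).
      rewrite mul_lumpE /= mulr_suml; apply: eq_bigr => w /eqP E.
      by rewrite h E.
    apply/rowP => w; rewrite pE h; case: (xcell w) => // l.
    by rewrite q mulrA divfK ?(gt_eqF (mass_gt0 l)).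
  move=> [sp E]; suff /Xi_rel[hi hj] : forall w,
    p 0 w = if xcell w is Some l then coef w * p 0 (rep l) else coef w by split.
  move=> w; have pw w' := congr1 (fun M : 'rV[R]_n.+1 => M 0 w') E.
  rewrite pw pE; case: (xcell w) => // l.
  rewrite [p 0 (rep l)]pw pE xcell_rep; have [_ ->] := freeP (rep_free l).
  by rewrite mul1r mulrA.
split=> [h|B0 w].
  case E : (xi_B X) => [//|b]; have l : 'I_(xi_B X) by rewrite E; exact: ord0.
  have := h (xi_j X l); rewrite /= (_ : xcell _ = None) ?eqxx//.
  by apply/xcell_none; exists l.
by apply/eqP => /xcell_none[l _]; case: l => i; rewrite B0.
Qed.

End XiCells.

(** * Local inverses *)

Section RowNorm.
Variable R : realType.

Lemma entry_le_norm n (x : 'rV[R]_n) j : `|x 0 j| <= `|x|.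
Proof.
rewrite [leRHS]/Num.Def.normr/= mx_normrE.
by apply: le_trans; last exact: (le_bigmax _ _ (0, j)).
Qed.

Lemma norm_le_entries n (x : 'rV[R]_n) e : 0 <= e -> (forall j, `|x 0 j| <= e) -> `|x| <= e.
Proof.
move=> e0 h; rewrite [leLHS]/Num.Def.normr/= mx_normrE.
by apply: bigmax_le => // -[i j] _ /=; rewrite (ord1 i).
Qed.

Lemma mulmxr_bound m n (A : 'M[R]_(m, n)) :
  exists2 k, 0 < k & forall x : 'rV[R]_m, `|x *m A| <= k * `|x|.
Proof. exact: (linear_lipschitz (@continuous_mulmxr R m n A)). Qed.

End RowNorm.

Section DifferentiableLift.
Variables (R : realType) (V : normedModType R) (m k : nat).
Variables (theta : V -> 'rV[R]_m) (y : 'rV[R]_m -> 'rV[R]_k) (s : V).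

(* [y] has an injective differential, so it bounds the increments of [theta]
   by those of [y \o theta]. *)
Lemma differentiable_lift : {for s, continuous theta} ->
  differentiable y (theta s) -> row_free ('J y (theta s)) ->
  differentiable (fun r => y (theta r)) s -> differentiable theta s.
Proof.
move=> ct dy /row_freeP[L JL] dz; set J := 'J y (theta s) in JL.
pose Dz := 'd (fun r => y (theta r)) s.
have Dzc : continuous Dz by exact: diff_continuous.
have [K K0 KL] := mulmxr_bound L; have [KD KD0 KDz] := linear_lipschitz Dzc.
pose dth h := theta (h + s) - theta s.
have y_eps e : 0 < e -> \forall h \near 0,
    `|y (theta (h + s)) - y (theta s) - dth h *m J| <= e * `|dth h|.
  move=> e0; have /eqaddoP/(_ e e0) := diff_locally dy => ne.
  have ct0 : dth h @[h --> 0] --> (0 : 'rV[R]_m).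
    rewrite -[X in _ --> X](subrr (theta s)); apply: cvgB; last exact: cvg_cst.
    have sh : (h + s) @[h --> 0] --> s.
      by rewrite -[X in _ --> X]add0r; apply: cvgD; [exact: cvg_id|exact: cvg_cst].
    have ct1 : theta x @[x --> s] --> theta s := ct.
    exact: (cvg_comp _ _ sh ct1).
  have n2 : \forall h \near 0, `|(y \o shift (theta s) - (cst (y (theta s))
      + 'd y (theta s))) (dth h)| <= e * `|dth h| := ct0 _ ne.
  apply: filterS n2 => h; rewrite !fctE /= /dth subrK.
  by rewrite opprD addrA /J /jacobian mul_rV_lin1.
have z_eps e : 0 < e -> \forall h \near 0,
    `|y (theta (h + s)) - y (theta s) - Dz h| <= e * `|h|.
  move=> e0; have /eqaddoP/(_ e e0) := diff_locally dz.
  by apply: filterS => h; rewrite !fctE /= opprD addrA.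
have key h : dth h - Dz h *m L = (y (theta (h + s)) - y (theta s) - Dz h) *m L -
    (y (theta (h + s)) - y (theta s) - dth h *m J) *m L.
  set d := y _ - y _.
  by rewrite (mulmxBl d) (mulmxBl d) -mulmxA JL mulmx1 opprB [RHS]addrC subrKA.
(* With this tolerance the error bounded by [|dth h|] contributes at most half of it after
   multiplication by [L], and is absorbed into the left side. *)
have e1 : 0 < (2 * K)^-1 by rewrite invr_gt0 mulr_gt0.
have lip : \forall h \near 0, `|dth h| <= 2 * (K * KD + K) * `|h|.
  apply: filterS2 (y_eps _ e1) (z_eps 1 ltr01) => h hy hz.
  have h1 : `|dth h| <= `|dth h - Dz h *m L| + `|Dz h *m L|.
    by rewrite -[X in `|X| <= _](subrK (Dz h *m L)) ler_normD.
  have h2 : `|dth h - Dz h *m L| <= K * `|h| + `|dth h| / 2.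
    rewrite key; apply: le_trans (ler_normB _ _) _; apply: lerD.
      by apply: le_trans (KL _) _; rewrite ler_pM2l// -[leRHS]mul1r.
    apply: le_trans (KL _) _; apply: le_trans (ler_wpM2l (ltW K0) hy) _.
    by rewrite invfM mulrA mulrCA mulfV ?gt_eqF// mulr1 mulrC.
  have h3 : `|Dz h *m L| <= K * (KD * `|h|).
    by apply: le_trans (KL _) _; rewrite ler_pM2l.
  lra.
apply/differentiable_epsP.
exists (mulmxr L \o Dz : {linear V -> 'rV[R]_m}); split.
  by move=> h; apply: continuous_comp; [exact: Dzc|exact: continuous_mulmxr].
move=> e e0; pose C := 2 * (K * KD + K).
have C0 : 0 < C by apply: mulr_gt0 => //; apply: addr_gt0 => //; apply: mulr_gt0.
have e2 : 0 < e / (2 * K * C).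
  by apply: divr_gt0 => //; apply: mulr_gt0 => //; apply: mulr_gt0.
have e3 : 0 < e / (2 * K) by rewrite divr_gt0// mulr_gt0.
apply: filterS3 (y_eps _ e2) (z_eps _ e3) lip => h hy hz hl.
rewrite -/(dth h) /= key; apply: le_trans (ler_normB _ _) _.
have -> : e * `|h| = K * (e / (2 * K) * `|h|) + K * (e / (2 * K * C) * (C * `|h|)).
  by field; rewrite (gt_eqF K0) (gt_eqF C0).
apply: lerD; apply: le_trans (KL _) _; rewrite ler_pM2l//.
by apply: le_trans hy _; rewrite ler_pM2l.
Qed.

End DifferentiableLift.

(* The completeness and normed module structures of row vectors are not joined
   in the library. *)
Definition complete_row (R : realType) (m : nat) : completeNormedModType R :=
  HB.pack 'rV[R]_m.

Lemma mulmx_sub_entry (R : realType) m (v : 'rV[R]_m) (A B : 'M[R]_m) j :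
  (v *m A) 0 j - (v *m B) 0 j = \sum_a v 0 a * (A a j - B a j).
Proof. by rewrite !mxE -sumrB; apply: eq_bigr => a _; rewrite mulrBr. Qed.

Section LocalInverse.
Variables (R : realType) (m : nat) (y : 'rV[R]_m -> 'rV[R]_m) (U : set 'rV[R]_m).
Variable u0 : 'rV[R]_m.
Hypothesis oU : open U.
Hypothesis U0 : U u0.
Hypothesis sy : smooth_on U y.
Hypothesis Junit : 'J y u0 \in unitmx.
Local Notation J := ('J y u0).

(** The mean value theorem is applied to each entry of [y] minus its linear part at [u0], whose
    gradient is small near [u0] by continuity of the jacobian. *)
Lemma strictly_differentiable e : 0 < e -> exists2 r, 0 < r &
  ball u0 r `<=` U /\ forall w w', ball u0 r w -> ball u0 r w' ->
    `|y w' - y w - (w' - w) *m J| <= e * `|w' - w|.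
Proof.
(* The [m] partial derivatives contribute [e1] each; dividing by [m.+1] keeps the denominator
   nonzero when [m = 0]. *)
move=> e0; pose e1 := e / m.+1%:R.
have e10 : 0 < e1 by rewrite divr_gt0.
have dU u : U u -> differentiable y u by exact: smooth_on_differentiable.
have nU : \forall u \near u0, U u by exact: open_nbhs_nbhs.
have nJ : \forall u \near u0, forall aj : 'I_m * 'I_m,
    `|'J y u aj.1 aj.2 - J aj.1 aj.2| <= e1.
  apply: (@filter_forall _ _ (fun (aj : 'I_m * 'I_m) u =>
    `|'J y u aj.1 aj.2 - J aj.1 aj.2| <= e1) (nbhs u0)) => -[a j] /=.
  have c : 'D_(basis_vec a) y u 0 j @[u --> u0] --> 'D_(basis_vec a) y u0 0 j.
    apply: differentiable_continuous; apply: differentiable_entry.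
    by apply: smooth_on_differentiable U0; exact: smooth_on_derive.
  have cn : \forall u \near u0,
      `|'D_(basis_vec a) y u0 0 j - 'D_(basis_vec a) y u 0 j| <= e1.
    exact: (cvgrPdist_le _ _).1 c e1 e10.
  apply: filterS2 nU cn => u Uu; rewrite distrC; apply: le_trans.
  have E1 := jacobian_entry a j (dU u Uu); have E2 := jacobian_entry a j (dU u0 U0).
  by rewrite le_eqVlt; apply/orP; left; apply/eqP; congr (`|_ - _|).
have [r r0 br] := (nbhs_ballP _ _).1 (filterI nU nJ).
exists r => //; split=> [u /br[]//|w w' bw bw'].
apply: norm_le_entries => [|j]; first by rewrite mulr_ge0// ltW.
have dg u : differentiable (fun u : 'rV[R]_m => id u *m J + 0) u.
  by apply: differentiable_affine; exact: ex_diff.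
pose f : 'rV[R]_m -> R := (fun u => y u 0 j : R) - (fun u => (id u *m J + 0) 0 j : R).
have df u : U u -> differentiable f u.
  by move=> Uu; apply: differentiableB; apply: differentiable_entry; [exact: dU|].
have bt t : 0 <= t <= 1 -> ball u0 r (w + t *: (w' - w)) by exact: ball_segment.
have [t t01|t t01 E] := @segment_mvt R _ f w w'.
  by apply: df; case: (br _ (bt t t01)).
have -> : (y w' - y w - (w' - w) *m J) 0 j = f w' - f w.
  rewrite /f !fctE !addr0 mulmxBl; move: (w *m J) (w' *m J) => a b.
  by rewrite !mxE; ring.
rewrite E; set xi := w + _ *: _.
have [Uxi Jxi] := br _ (bt t t01).
have -> : 'D_(w' - w) f xi = \sum_a (w' - w) 0 a * ('J y xi a j - J a j).
  rewrite deriveB; try by apply: diff_derivable; apply: differentiable_entry; auto.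
  rewrite !derive_entry; [|exact: dg|exact: dU].
  rewrite derive_affine ?derive_id; last exact: ex_diff.
  rewrite deriveEjacobian; last exact: dU.
  exact: mulmx_sub_entry.
apply: le_trans (ler_norm_sum _ _ _) _.
apply: (@le_trans _ _ (\sum_(a < m) `|w' - w| * e1)).
  apply: ler_sum => a _; rewrite normrM; apply: ler_pM => //; first exact: entry_le_norm.
  exact: (Jxi (a, j)).
have h : e1 * m%:R <= e by rewrite /e1 mulrAC ler_pdivrMr// ler_pM2l// ler_nat.
by rewrite sumr_const card_ord -mulr_natr -mulrA mulrC ler_wpM2r.
Qed.

(** To solve [y w = zeta], the map sending [w] to [w - (y w - zeta) *m invmx J] is a contraction of
    factor 1/2 near [u0]; a closed ball inside the region of validity provides completeness. *)
Lemma local_inverse : exists r d K, [/\ 0 < r, 0 < d, 0 < K, ball u0 r `<=` U &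
  (forall zeta, `|zeta - y u0| <= d -> exists2 w, ball u0 r w & y w = zeta) /\
  (forall w w', ball u0 r w -> ball u0 r w' -> `|w' - w| <= K * `|y w' - y w|)].
Proof.
have [K K0 KL] := mulmxr_bound (invmx J).
have e0 : 0 < (2 * K)^-1 by rewrite invr_gt0 mulr_gt0.
have [r r0 [rU sd]] := strictly_differentiable e0.
have r20 : 0 < r / 2 by rewrite divr_gt0.
have contr w w' : ball u0 r w -> ball u0 r w' ->
    `|(w' - w) - (y w' - y w) *m invmx J| <= 2^-1 * `|w' - w|.
  move=> bw bw'; rewrite -normrN opprB.
  have -> : (y w' - y w) *m invmx J - (w' - w) =
      (y w' - y w - (w' - w) *m J) *m invmx J.
    by rewrite [RHS]mulmxBl mulmxK.
  apply: le_trans (KL _) _; apply: le_trans (ler_wpM2l (ltW K0) (sd _ _ bw bw')) _.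
  by rewrite invfM mulrA mulrCA mulfV ?gt_eqF// mulr1.
have sub : closed_ball_ Num.norm u0 (r / 2) `<=` ball u0 r.
  move=> w; rewrite -ball_normE /closed_ball_ /= => h; apply: le_lt_trans h _.
  by rewrite ltr_pdivrMr// ltr_pMr// ltr1n.
(* A target within [r / 4 / K] displaces the centre by at most [r / 4], and contraction adds half of
   [r / 2], so the ball of radius [r / 2] is preserved. The bound [2 * K] results from absorbing the
   factor 1/2. *)
exists r, (r / 4 / K), (2 * K); split => //; first by rewrite !divr_gt0.
  by rewrite mulr_gt0.
split=> [zeta hz|w w' bw bw'].
  pose f (w : complete_row R m) : complete_row R m := w - (y w - zeta) *m invmx J.
  pose B : set (complete_row R m) := closed_ball_ Num.norm u0 (r / 2).
  have fB : {homo f : w / B w >-> B w}.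
    move=> w Bw; have bw := sub _ Bw.
    have bu : ball u0 r u0 by exact: ballxx.
    rewrite /B /closed_ball_ /= distrC /f.
    have -> : w - (y w - zeta) *m invmx J - u0 =
        ((w - u0) - (y w - y u0) *m invmx J) + (zeta - y u0) *m invmx J.
      by rewrite !mulmxBl; set a := y w *m _; set b := zeta *m _; set c := y u0 *m _;
        rewrite !opprB; apply/rowP => i; rewrite !mxE; ring.
    apply: le_trans (ler_normD _ _) _.
    have h1 := contr _ _ bu bw.
    have h2 : `|w - u0| <= r / 2 by rewrite distrC.
    have h3 : `|(zeta - y u0) *m invmx J| <= r / 4.
      apply: le_trans (KL _) _; rewrite -ler_pdivlMl// mulrC; exact: hz.
    lra.
  have nB : B !=set0 by exists u0; rewrite /B /closed_ball_ /= subrr normr0 ltW.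
  have ctr : is_contraction (mkfun fB).
    exists (2^-1)%:nng; split; first by rewrite /= invf_lt1 ?ltr1n.
    move=> [w w'] [/= Bw Bw']; have := contr _ _ (sub _ Bw') (sub _ Bw).
    rewrite /mkfun /f; congr (`|_| <= _).
    by rewrite !mulmxBl; set a := y w *m _; set b := zeta *m _; set c := y w' *m _;
        apply/rowP => i; rewrite !mxE; ring.
  have [w Bw wE] := banach_fixed_point ctr
    (@closed_closed_ball_ R (complete_row R m) u0 (r / 2)) nB.
  exists w; first exact: sub.
  apply/subr0_eq/eqP; rewrite -(mulmx_free_eq0 _ (B := invmx J)).
    by apply/eqP; move: wE; rewrite /mkfun /f => /eqP; rewrite -subr_eq0 opprB addrC subrK => /eqP.
  by rewrite row_free_unit unitmx_inv.
have h := contr _ _ bw bw'.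
have h1 : `|w' - w| <= `|(w' - w) - (y w' - y w) *m invmx J| + `|(y w' - y w) *m invmx J|.
  by rewrite -{1}[w' - w](subrK ((y w' - y w) *m invmx J)) ler_normD.
have h2 := KL (y w' - y w).
lra.
Qed.

(** The lift is chosen pointwise; the Lipschitz bound of the inverse then forces both the initial
    value and continuity. *)
Lemma local_lift (z : R -> 'rV[R]_m) s : (forall r, {for r, continuous z}) -> z s = y u0 ->
  exists I (c : R -> 'rV[R]_m), [/\ open I, I s, c s = u0 &
    forall r, I r -> [/\ U (c r), y (c r) = z r & {for r, continuous c}]].
Proof.
move=> cz zs; have [r [d [K [r0 d0 K0 rU [ex inj]]]]] := local_inverse.
pose I := [set t | `|z t - y u0| < d].
have Iex t : exists w, I t -> ball u0 r w /\ y w = z t.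
  have [It|nIt] := pselect (I t); last by exists u0.
  by have [w bw yw] := ex (z t) (ltW It); exists w.
have [c cP] := choice Iex.
have oI : open I.
  rewrite openE => t It.
  have cn : {for t, continuous (fun t => `|z t - y u0| : R)}.
    by apply: cvg_norm; apply: cvgB; [exact: cz|exact: cvg_cst].
  by apply: (cn [set x | x < d]); apply: open_nbhs_nbhs; split; [exact: open_lt|].
have Is : I s by rewrite /I /= zs subrr normr0.
exists I, c; split => // [|t It].
  have [bc yc] := cP s Is; apply/eqP; rewrite -subr_eq0 -normr_le0.
  apply: le_trans (inj _ _ (ballxx _ r0) bc) _.
  by rewrite yc zs subrr normr0 mulr0.
have [bc yc] := cP t It; split => //; first exact: rU.
apply/cvgrPdist_le => e e0.
have eK : 0 < e / K by rewrite divr_gt0.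
have cn : \forall t' \near t, `|z t - z t'| <= e / K.
  exact: (cvgrPdist_le _ _).1 (cz t) (e / K) eK.
apply: filterS2 (open_nbhs_nbhs (conj oI It)) cn => t' It' h.
have [bc' yc'] := cP t' It'.
apply: le_trans (inj _ _ bc' bc) _; rewrite yc yc'.
by rewrite -ler_pdivlMl// mulrC.
Qed.

End LocalInverse.

(** * Smoothness from function algebras closed under derivation *)

Section FunctionAlgebra.
Variable R : realType.
Variable I : set R.
Hypothesis oI : open I.

(** Smoothness asks for all iterated derivatives. If every generator is differentiable with
    derivative in the algebra, the Leibniz rule extends this to the whole algebra, and induction
    reaches all orders. *)
Inductive fun_alg (B : (R -> R) -> Prop) : (R -> R) -> Prop :=
| alg_base f : B f -> fun_alg B f
| alg_cst c : fun_alg B (fun=> c)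
| alg_add f g : fun_alg B f -> fun_alg B g -> fun_alg B (fun r => f r + g r)
| alg_mul f g : fun_alg B f -> fun_alg B g -> fun_alg B (fun r => f r * g r).

Lemma alg_sub (B B' : (R -> R) -> Prop) f :
  (forall g, B g -> B' g) -> fun_alg B f -> fun_alg B' f.
Proof.
move=> BB; elim=> [g /BB|c|g h _ bg _ bh|g h _ bg _ bh].
- exact: alg_base.
- exact: alg_cst.
- exact: alg_add.
- exact: alg_mul.
Qed.

Lemma alg_sum B (J : finType) (f : J -> R -> R) :
  (forall i, fun_alg B (f i)) -> fun_alg B (fun r => \sum_i f i r).
Proof.
move=> bf; elim: (index_enum J) => [|i s IH].
  rewrite (_ : (fun _ => _) = fun=> 0); first exact: alg_cst.
  by apply/funext => r; rewrite big_nil.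
rewrite (_ : (fun _ => _) = fun r => f i r + \sum_(j <- s) f j r).
  exact: alg_add.
by apply/funext => r; rewrite big_cons.
Qed.

Lemma alg_prod B (J : finType) (f : J -> R -> R) :
  (forall i, fun_alg B (f i)) -> fun_alg B (fun r => \prod_i f i r).
Proof.
move=> bf; elim: (index_enum J) => [|i s IH].
  rewrite (_ : (fun _ => _) = fun=> 1); first exact: alg_cst.
  by apply/funext => r; rewrite big_nil.
rewrite (_ : (fun _ => _) = fun r => f i r * \prod_(j <- s) f j r).
  exact: alg_mul.
by apply/funext => r; rewrite big_cons.
Qed.

Lemma alg_det B k (A : R -> 'M[R]_k) :
  (forall i j, fun_alg B (fun r => A r i j)) -> fun_alg B (fun r => \det (A r)).
Proof.
move=> bA; apply: alg_sum => s; apply: alg_mul; first exact: alg_cst.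
by apply: alg_prod => i.
Qed.

Definition alg_derivative (B : (R -> R) -> Prop) (f : R -> R) :=
  (forall r, I r -> differentiable f r) /\
  exists2 g, fun_alg B g & forall r, I r -> 'D_1 f r = g r.

(** Two sets of generators are kept apart because the determinant, an expression in [partial_fun],
    has its derivative only in the algebra of [lift_base]; this treats the generator [lift_inv]
    without circularity. *)
Lemma alg_closed (B0 B : (R -> R) -> Prop) f : (forall g, B0 g -> B g) ->
  (forall g, B0 g -> alg_derivative B g) -> fun_alg B0 f -> alg_derivative B f.
Proof.
move=> BB cB; elim=> [g /cB//|c|g h ag [dg [g' ag' Dg]] ah [dh [h' ah' Dh]]|
  g h ag [dg [g' ag' Dg]] ah [dh [h' ah' Dh]]].
- split=> [r _|]; first exact: differentiable_cst.
  by exists (fun=> 0); [exact: alg_cst|move=> r _; exact: derive_cst].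
- split=> [r Ir|]; first by apply: differentiableD; [exact: dg|exact: dh].
  exists (fun r => g' r + h' r); first exact: alg_add.
  move=> r Ir; rewrite -Dg// -Dh//; apply: deriveD; apply: diff_derivable.
    exact: dg.
  exact: dh.
- split=> [r Ir|]; first by apply: differentiableM; [exact: dg|exact: dh].
  exists (fun r => g r * h' r + h r * g' r).
    by apply: alg_add; apply: alg_mul => //; exact: alg_sub BB _.
  move=> r Ir; rewrite -Dg// -Dh//; apply: deriveM; apply: diff_derivable.
    exact: dg.
  exact: dh.
Qed.

Lemma derive_scale1 (W : normedModType R) (f : R -> W) (r v : R) :
  differentiable f r -> 'D_v f r = v *: 'D_1 f r.
Proof.
move=> df; rewrite !deriveE// -linearZ; congr ('d f r _).
by rewrite /GRing.scale /= mulr1.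
Qed.

Lemma alg_smooth (B : (R -> R) -> Prop) f :
  (forall g, B g -> alg_derivative B g) -> fun_alg B f -> @smooth_on R R^o R^o I f.
Proof.
move=> cB af s; elim/last_ind: s f af => [|s v IH] f af r Ir /=.
  by have [df _] := alg_closed (fun g => id) cB af; exact: df.
have [df [g ag Dg]] := alg_closed (fun g => id) cB af.
rewrite foldr_rcons.
have avg : fun_alg B (fun r => v * g r) by apply: alg_mul => //; exact: alg_cst.
apply: (differentiable_foldr_eq oI _ Ir (IH _ avg r Ir)) => t It.
by rewrite derive_scale1 ?Dg//; exact: df.
Qed.

Lemma smooth_on_row k (f : R -> 'rV[R]_k) :
  (forall j, @smooth_on R R^o R^o I (fun r => f r 0 j)) -> @smooth_on R R^o 'rV[R]_k I f.
Proof.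
move=> sf s; elim/last_ind: s f sf => [|s v IH] f sf r Ir /=.
  by apply: differentiable_row => j; exact: (sf j [::] r Ir).
have df t : I t -> differentiable f t.
  by move=> It; apply: differentiable_row => j; exact: (sf j [::] t It).
rewrite foldr_rcons; apply: IH => // j.
apply: (smooth_on_eq oI _ (smooth_on_derive (v : R^o) (sf j))) => t It.
exact: (derive_entry (v : R^o) j (df t It)).
Qed.

End FunctionAlgebra.

Lemma derive_comp_row (R : realType) m k (c : R -> 'rV[R]_m) (f : 'rV[R]_m -> 'rV[R]_k) r :
  differentiable c r -> differentiable f (c r) ->
  'D_1 (fun t => f (c t)) r = 'D_1 c r *m 'J f (c r).
Proof.
move=> dc df; have dfc : differentiable (fun t => f (c t)) r by exact: (differentiable_comp dc df).
rewrite !deriveE// /jacobian mul_rV_lin1.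
exact: (congr1 (fun F => F (1 : R)) (diff_comp dc df)).
Qed.

Section LiftSmooth.
Variables (R : realType) (m : nat) (y : 'rV[R]_m -> 'rV[R]_m) (U : set 'rV[R]_m).
Variables (I : set R) (z c : R -> 'rV[R]_m).
Hypothesis oI : open I.
Hypothesis oU : open U.
Hypothesis sy : smooth_on U y.
Hypothesis Jy : forall u, U u -> 'J y u \in unitmx.
Hypothesis sz : @smooth_on R R^o 'rV[R]_m I z.
Hypothesis cU : forall r, I r -> U (c r).
Hypothesis yc : forall r, I r -> y (c r) = z r.
Hypothesis cc : forall r, I r -> {for r, continuous c}.

Lemma lift_differentiable r : I r -> differentiable c r.
Proof.
move=> Ir; apply: (@differentiable_lift R R^o m m c y r (cc Ir)).
- exact: smooth_on_differentiable sy (cU Ir).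
- by rewrite row_free_unit; exact/Jy/cU.
- apply: near_eq_differentiable (smooth_on_differentiable sz Ir).
  by apply: filterS (open_nbhs_nbhs (conj oI Ir)) => t It; rewrite yc.
Qed.

Lemma derive_lift r : I r -> 'D_1 c r = 'D_1 z r *m invmx ('J y (c r)).
Proof.
move=> Ir; have dy := smooth_on_differentiable sy (cU Ir).
have E : 'D_1 c r *m 'J y (c r) = 'D_1 z r.
  rewrite -(derive_comp_row (lift_differentiable Ir) dy); apply: near_eq_derive.
  by apply: filterS (open_nbhs_nbhs (conj oI Ir)) => t It; rewrite yc.
by rewrite -E mulmxK//; exact/Jy/cU.
Qed.

Definition partial_fun (f : R -> R) := exists (s : seq 'rV[R]_m) (b : 'I_m),
  f = fun r => foldr (fun v h => 'D_v h) y s (c r) 0 b.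

(* These generate an algebra closed under derivation: by Cramer's formula
   c' = z' J(c)^-1 only needs the inverse of det J(c). *)
Inductive lift_base : (R -> R) -> Prop :=
| lift_partial f : partial_fun f -> lift_base f
| lift_target (s : seq R^o) b :
    lift_base (fun r => foldr (fun v h => 'D_v h) (z : R^o -> 'rV[R]_m) s r 0 b)
| lift_entry a : lift_base (fun r => c r 0 a)
| lift_inv : lift_base (fun r => (\det (\matrix_(i, j) 'D_(basis_vec i) y (c r) 0 j))^-1).

Local Notation Jc r := (\matrix_(i, j) 'D_(basis_vec i) y (c r) 0 j).

Lemma jacobian_cE r : I r -> 'J y (c r) = Jc r.
Proof.
move=> Ir; apply/matrixP => i j; rewrite [RHS]mxE; apply: jacobian_entry.
exact: smooth_on_differentiable sy (cU Ir).
Qed.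

Lemma alg_Jc i j : fun_alg lift_base (fun r => Jc r i j).
Proof.
rewrite (_ : (fun _ => _) = fun r => foldr (fun v h => 'D_v h) y [:: basis_vec i] (c r) 0 j).
  by apply/alg_base/lift_partial; exists [:: basis_vec i], j.
by apply/funext => r; rewrite mxE.
Qed.

Lemma partial_det : fun_alg partial_fun (fun r => \det (Jc r)).
Proof.
apply: alg_det => i j.
rewrite (_ : (fun _ => _) = fun r => foldr (fun v h => 'D_v h) y [:: basis_vec i] (c r) 0 j).
  by apply/alg_base; exists [:: basis_vec i], j.
by apply/funext => r; rewrite mxE.
Qed.

Lemma alg_derive_c a : exists2 g, fun_alg lift_base g &
  forall r, I r -> 'D_1 c r 0 a = g r.
Proof.
exists (fun r => \sum_b (foldr (fun v h => 'D_v h) (z : R^o -> 'rV[R]_m) [:: (1 : R^o)] r 0 b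
  * ((\det (Jc r))^-1 * \adj (Jc r) b a))).
  apply: alg_sum => b; apply: alg_mul; first exact/alg_base/lift_target.
  apply: alg_mul; first exact/alg_base/lift_inv.
  rewrite (_ : (fun _ => _) = fun r => (-1) ^+ (a + b) * \det (row' a (col' b (Jc r)))).
    apply: alg_mul; first exact: alg_cst.
    apply: alg_det => i j.
    rewrite (_ : (fun _ => _) = fun r => Jc r (lift a i) (lift b j)); first exact: alg_Jc.
    by apply/funext => r; rewrite [LHS]mxE [LHS]mxE.
  by apply/funext => r; rewrite mxE.
move=> r Ir; rewrite derive_lift// jacobian_cE// mxE; apply: eq_bigr => b _.
congr (_ * _); rewrite /invmx -(jacobian_cE Ir) (Jy (cU Ir)) (jacobian_cE Ir).
by rewrite [LHS]mxE.
Qed.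

Lemma partial_derivative f : partial_fun f -> alg_derivative I lift_base f.
Proof.
move=> [s [b ->]]; set g := foldr _ y s.
have dg r : I r -> differentiable g (c r) by move=> Ir; exact: (sy s (cU Ir)).
have dgc r : I r -> differentiable (fun r => g (c r)) r.
  by move=> Ir; exact: (differentiable_comp (lift_differentiable Ir) (dg r Ir)).
split=> [r Ir|]; first by apply: differentiable_entry; exact: dgc.
pose h a := sval (cid2 (alg_derive_c a)).
have ah a : fun_alg lift_base (h a) by rewrite /h; case: cid2.
have hE a r : I r -> 'D_1 c r 0 a = h a r by rewrite /h; case: cid2 => ? ? /= E; exact: E.
exists (fun r => \sum_a (h a r * 'D_(basis_vec a) g (c r) 0 b)).
  apply: alg_sum => a; apply: alg_mul => //; apply/alg_base/lift_partial.
  by exists (basis_vec a :: s), b.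
move=> r Ir; have -> : 'D_1 (fun r => g (c r) 0 b : R) r = ('D_1 c r *m 'J g (c r)) 0 b.
  rewrite -(derive_comp_row (lift_differentiable Ir) (dg r Ir)).
  exact: (derive_entry (1 : R^o) b (dgc r Ir)).
rewrite mxE; apply: eq_bigr => a _; rewrite hE//; congr (_ * _).
exact: (jacobian_entry a b (dg r Ir)).
Qed.

Lemma lift_derivative f : lift_base f -> alg_derivative I lift_base f.
Proof.
have pl g : partial_fun g -> lift_base g by exact: lift_partial.
have [dd [d' ad' Dd]] := alg_closed pl partial_derivative partial_det.
case=> [g|s b|a|]; first exact: partial_derivative.
- set g := foldr _ _ s; have dg r : I r -> differentiable g r := fun Ir => sz s Ir.
  split=> [r Ir|]; first by apply: differentiable_entry; exact: dg.
  exists (fun r => foldr (fun v h => 'D_v h) (z : R^o -> 'rV[R]_m) ((1 : R^o) :: s) r 0 b).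
    exact/alg_base/lift_target.
  by move=> r Ir; exact: (derive_entry (1 : R^o) b (dg r Ir)).
- split=> [r Ir|]; first by apply: differentiable_entry; exact: lift_differentiable.
  have [g ag gE] := alg_derive_c a; exists g => // r Ir.
  by rewrite -gE// derive_entry//; exact: lift_differentiable.
have d0 r : I r -> \det (Jc r) != 0.
  by move=> Ir; rewrite -jacobian_cE// -unitfE -unitmxE; exact/Jy/cU.
split=> [r Ir|]; first by apply: differentiableV; [exact: dd|exact: d0].
exists (fun r => -1 * ((\det (Jc r))^-1 * (\det (Jc r))^-1) * d' r).
  apply: alg_mul => //; apply: alg_mul; first exact: alg_cst.
  by apply: alg_mul; exact/alg_base/lift_inv.
move=> r Ir; have -> := @deriveV _ _ _ r (1 : R^o) (d0 r Ir) (diff_derivable (dd r Ir)).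
rewrite -Dd// /GRing.scale /=; congr (_ * _).
by rewrite mulN1r -invfM expr2.
Qed.

Lemma lift_smooth : @smooth_on R R^o 'rV[R]_m I c.
Proof.
apply: smooth_on_row => // a.
by apply: (alg_smooth oI lift_derivative); exact/alg_base/lift_entry.
Qed.

End LiftSmooth.

(** * Geodesics *)

Section GeodesicEquation.
Variables (R : realType) (n m : nat) (M : topologicalType) (iota : M -> 'rV[R]_n.+1).
Hypothesis iota_simplex : forall t, simplex n (iota t).
Variables (U : set 'rV[R]_m) (phi : 'rV[R]_m -> M).
Hypothesis par : parametrization iota U phi.
Variables (I : set R) (c : R -> 'rV[R]_m).
Hypothesis oI : open I.
Hypothesis sc : @smooth_on R R^o 'rV[R]_m I c.
Hypothesis cU : forall r, I r -> U (c r).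
Local Notation x := (coord_expr iota phi).
Local Notation P := (fun u => iota (phi u)).
Local Notation p := (fun r => iota (phi (c r))).
Local Notation T r := (tangent_mx x (c r)).
Local Notation D1 f := ('D_(1 : R^o) f).

Let sP : smooth_on U P. Proof. exact: (smooth_point iota_simplex par). Qed.
Let dc r : I r -> differentiable c r. Proof. exact: smooth_on_differentiable sc. Qed.
Let dDc r : I r -> differentiable (D1 c) r.
Proof. exact: (smooth_on_differentiable (smooth_on_derive (1 : R^o) sc)). Qed.
Let dP r : I r -> differentiable P (c r).
Proof. by move=> /cU; exact: smooth_on_differentiable sP. Qed.
Let dDP a r : I r -> differentiable ('D_(basis_vec a) P) (c r).
Proof. by move=> /cU; exact: (smooth_on_differentiable (smooth_on_derive (basis_vec a) sP)). Qed.

Lemma curve_differentiable r : I r -> differentiable p r.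
Proof. by move=> Ir; exact: (differentiable_comp (dc Ir) (dP Ir)). Qed.

Lemma curve_derive r : I r -> D1 p r = D1 c r *m T r.
Proof.
move=> Ir; rewrite (tangent_mxE iota_simplex par); last exact: cU.
exact: (derive_comp_row (dc Ir) (dP Ir)).
Qed.

Let velocity t : 'rV[R]_n.+1 :=
  \row_w \sum_a (D1 c t 0 a * 'D_(basis_vec a) P (c t) 0 w).

Let near_velocity r : I r -> \forall t \near r, D1 p t = velocity t.
Proof.
move=> Ir; apply: filterS (open_nbhs_nbhs (conj oI Ir)) => t It.
rewrite curve_derive//; apply/rowP => w; rewrite [RHS]mxE [LHS]mxE.
apply: eq_bigr => a _; congr (_ * _).
by rewrite (derive_point iota_simplex par _ (cU It)) -rowE [RHS]mxE.
Qed.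

Let velocity_entry w : (fun t => velocity t 0 w) =
  \sum_a ((fun t => D1 c t 0 a : R) * (fun t => 'D_(basis_vec a) P (c t) 0 w : R)).
Proof. by apply/funext => t; rewrite mxE fct_sumE. Qed.

Let dDPc a r : I r -> differentiable (fun t => 'D_(basis_vec a) P (c t)) r.
Proof. by move=> Ir; exact: (differentiable_comp (dc Ir) (dDP a Ir)). Qed.

Lemma curve_differentiable2 r : I r -> differentiable (D1 p) r.
Proof.
move=> Ir; apply: (@near_eq_differentiable _ _ _ velocity).
  by apply: filterS (near_velocity Ir) => t ->.
apply: differentiable_row => w; rewrite velocity_entry.
apply: differentiable_sum => a; apply: differentiableM; apply: differentiable_entry.
  exact: dDc.
exact: dDPc.
Qed.

Lemma curve_derive2 r : I r -> D1 (D1 p) r = D1 (D1 c) r *m T r +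
  \sum_a \sum_b (D1 c r 0 a * D1 c r 0 b) *: hess x (c r) a b.
Proof.
move=> Ir; apply: etrans (near_eq_derive (1 : R^o) (near_velocity Ir)) _.
have dv : differentiable velocity r.
  apply: differentiable_row => w; rewrite velocity_entry.
  apply: differentiable_sum => a; apply: differentiableM; apply: differentiable_entry.
    exact: dDc.
  exact: dDPc.
apply/rowP => w; rewrite -(derive_entry (1 : R^o) w dv) velocity_entry.
have dca a : derivable (fun t => D1 c t 0 a : R) r (1 : R^o).
  by apply: diff_derivable; apply: differentiable_entry; exact: dDc.
have dPa a : derivable (fun t => 'D_(basis_vec a) P (c t) 0 w : R) r (1 : R^o).
  by apply: diff_derivable; apply: differentiable_entry; exact: dDPc.
rewrite derive_sum; last by move=> a; exact: derivableM (dca a) (dPa a).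
rewrite exchange_big /= [RHS]mxE [X in _ = X + _]mxE summxE -big_split.
apply: eq_bigr => a _ /=.
rewrite (deriveM (dca a) (dPa a)) addrC; congr (_ + _); last first.
  rewrite /GRing.scale /= mulrC; congr (_ * _).
    exact: (derive_entry (1 : R^o) a (dDc Ir)).
  by rewrite (derive_point iota_simplex par _ (cU Ir)) -rowE [LHS]mxE.
have E : 'D_(1 : R^o) (fun t => 'D_(basis_vec a) P (c t) 0 w : R) r =
    (D1 c r *m 'J ('D_(basis_vec a) P) (c r)) 0 w.
  by rewrite -(derive_comp_row (dc Ir) (dDP a Ir)); exact: (derive_entry (1 : R^o) w (dDPc a Ir)).
rewrite /GRing.scale /=; apply: etrans (congr1 _ E) _.
rewrite mxE mulr_sumr summxE.
apply: eq_bigr => b _; rewrite [RHS]mxE mulrA [X in _ = X * _]mulrC; congr (_ * _).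
rewrite (hessE iota_simplex par _ _ (cU Ir)).
exact: (jacobian_entry b w (dDP a Ir)).
Qed.

Definition acceleration r : 'rV[R]_m := derive1 (derive1 c) r +
  \sum_(a < m) \sum_(b < m) (derive1 c r 0 a * derive1 c r 0 b)
    *: nabla_basis (sub_metric iota phi) (sub_connection iota phi) (c r) a b.

Lemma derive1_fun (W : normedModType R) (f : R -> W) : derive1 f = D1 f.
Proof. by apply/funext => r; exact: derive1E. Qed.

(** The entrywise second derivative of [ln p] along the curve. *)
Definition log_acceleration r : 'rV[R]_n.+1 :=
  \row_w (D1 (D1 p) r 0 w / p r 0 w - (D1 p r 0 w / p r 0 w) ^+ 2).

(** The induced metric is invertible, and multiplying by it leaves pairings with tangent vectors:
    [c''] and the hessians combine into [p''], the score products into the square of [p' / p]. A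
    geodesic is thus a curve with [(ln p)''] orthogonal to the family. *)
Lemma acceleration_eq0 r : I r ->
  acceleration r = 0 <-> log_acceleration r *m (T r)^T = 0.
Proof.
move=> Ir; have pos := coord_expr_pos iota_simplex phi (c r).
have uG : sub_metric iota phi (c r) \in unitmx.
  rewrite /sub_metric induced_metricE// gram_unit//.
  exact: (row_free_tangent iota_simplex par (cU Ir)).
suff E : acceleration r *m sub_metric iota phi (c r) = log_acceleration r *m (T r)^T.
  rewrite -E; split=> [->|h]; first by rewrite mul0mx.
  by rewrite -(mulmxK uG (acceleration r)) h mul0mx.
rewrite /acceleration !derive1_fun mulmxDl mulmx_suml.
under eq_bigr => a _.
  rewrite mulmx_suml; under eq_bigr => b _.
    rewrite -scalemxAl /nabla_basis mulmxKV// /sub_connection induced_econnE// scalemxAl; over.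
  rewrite -mulmx_suml; over.
rewrite -mulmx_suml {1}/sub_metric induced_metricE// /gram mulmxA -mulmxDl.
congr (_ *m _); apply/rowP => w.
have -> : log_acceleration r 0 w = wdiv (prob (x (c r))) (D1 (D1 p) r) 0 w -
    (D1 c r *m score_mx x (c r)) 0 w * (D1 c r *m score_mx x (c r)) 0 w.
  rewrite mxE -wdivM -curve_derive// [wdiv _ _ _ _]mxE [wdiv _ (D1 p r) _ _]mxE.
  by rewrite prob_coord_expr// expr2.
rewrite curve_derive2// mul_score_prod.
rewrite [LHS]mxE summxE [wdiv _ _ _ _]mxE [X in X / _]mxE mulrDl -addrA.
congr (_ + _); first by rewrite -wdivM [LHS]mxE.
rewrite summxE mulr_suml -sumrB; apply: eq_bigr => a _.
rewrite !summxE mulr_suml -sumrB; apply: eq_bigr => b _.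
rewrite [LHS]mxE [escore _ _ _ _ _ _]mxE [mscore _ _ _ _ _ _]mxE.
by rewrite [X in _ = X / _ - _]mxE mulrBr !mulrA.
Qed.

End GeodesicEquation.

(** * The geodesic equation for cell masses *)

Section CellGeodesics.
Variables (R : realType) (n m : nat) (M : topologicalType) (iota : M -> 'rV[R]_n.+1).
Variable cl : cells R n m.
Local Notation Cm := (lump_mx cl).
Local Notation Km := (split_mx cl).
Local Notation sg := (cell_weight cl).
Local Notation D1 f := ('D_(1 : R^o) f).
Hypothesis iota_cell : forall t, cell_set cl (iota t).

Let iota_simplex t : simplex n (iota t). Proof. by case: (iota_cell t). Qed.

Lemma lump_iota_gt0 t l : 0 < (iota t *m Cm) 0 l.
Proof. by apply: lump_gt0 => w; exact: (iota_gt0 iota_simplex). Qed.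

Definition log_curvature (q : R -> 'rV[R]_m.+1) r l : R :=
  D1 (D1 q) r 0 l / q r 0 l - (D1 q r 0 l / q r 0 l) ^+ 2.

Section InChart.
Variables (U : set 'rV[R]_m) (phi : 'rV[R]_m -> M).
Hypothesis par : parametrization iota U phi.
Variables (I : set R) (c : R -> 'rV[R]_m).
Hypothesis oI : open I.
Hypothesis sc : @smooth_on R R^o 'rV[R]_m I c.
Hypothesis cU : forall r, I r -> U (c r).
Local Notation p := (fun r => iota (phi (c r))).
Local Notation q := (fun r => iota (phi (c r)) *m Cm).
Local Notation T r := (tangent_mx (coord_expr iota phi) (c r)).

Let dp r : I r -> differentiable p r.
Proof. exact: (curve_differentiable iota_simplex par sc cU). Qed.
Let dDp r : I r -> differentiable (D1 p) r.
Proof. exact: (curve_differentiable2 iota_simplex par oI sc cU). Qed.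

Let qE : q = (fun r => p r *m Cm + 0).
Proof. by apply/funext => r; rewrite addr0. Qed.

Let near_dp r : I r -> \forall t \near r, differentiable p t.
Proof. by move=> Ir; apply: filterS (open_nbhs_nbhs (conj oI Ir)). Qed.

Lemma lump_differentiable r : I r -> differentiable q r.
Proof. by move=> Ir; rewrite qE; apply: differentiable_affine; exact: dp. Qed.

Lemma lump_derive r : I r -> D1 q r = D1 p r *m Cm.
Proof. by move=> Ir; rewrite qE; exact: (derive_affine Cm 0 (1 : R^o) (dp Ir)). Qed.

Lemma lump_differentiable2 r : I r -> differentiable (D1 q) r.
Proof.
move=> Ir; apply: (@near_eq_differentiable _ _ _ (fun t => D1 p t *m Cm + 0)).
  apply: filterS (open_nbhs_nbhs (conj oI Ir)) => t It.
  by rewrite addr0 -(lump_derive It).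
by apply: differentiable_affine; exact: dDp.
Qed.

Lemma lump_derive2 r : I r -> D1 (D1 q) r = D1 (D1 p) r *m Cm.
Proof. by move=> Ir; rewrite qE; exact: (derive2_affine Cm 0 (1 : R^o) (near_dp Ir) (dDp Ir)). Qed.

Let pE : p = (fun r => p r *m (Cm *m Km) + frozen_row cl).
Proof. by apply/funext => r; rewrite mulmxA; case: (iota_cell (phi (c r))). Qed.

(** [(ln p_w)''] equals [(ln q_l)''] in cell [l] and 0 on frozen outcomes. Lumped tangent vectors
    are exactly the vectors of sum zero on the cells, and only constants annihilate these. *)
Lemma cell_acceleration_eq0 r : I r -> acceleration iota phi c r = 0 <->
  forall l l', log_curvature q r l = log_curvature q r l'.
Proof.
move=> Ir; rewrite (acceleration_eq0 iota_simplex par oI sc cU Ir).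
set L : 'rV[R]_m.+1 := \row_l log_curvature q r l.
have Dp : D1 p r = D1 p r *m Cm *m Km.
  rewrite {1}pE -mulmxA; exact: (derive_affine _ _ (1 : R^o) (dp Ir)).
have DDp : D1 (D1 p) r = D1 (D1 p) r *m Cm *m Km.
  rewrite {1}pE -mulmxA; exact: (derive2_affine _ _ (1 : R^o) (near_dp Ir) (dDp Ir)).
have -> : log_acceleration iota phi c r = L *m Cm^T.
  apply/rowP => w; rewrite mul_lumpTE [LHS]mxE.
  rewrite (cell_entry w Dp) (cell_entry w DDp).
  case E : (cell cl w) => [l|]; last by rewrite !mul0r expr0n /= subr0.
  rewrite [RHS]mxE /log_curvature (lump_derive Ir) (lump_derive2 Ir) (point_some iota_cell _ E).
  field; rewrite (gt_eqF (kap_gt0 cl w)) gt_eqF//; exact: lump_iota_gt0.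
rewrite -mulmxA -trmx_mul.
have TE := tangent_cell iota_cell par (cU Ir).
split=> [h l l'|h].
  have s1 l0 : \sum_i (delta_mx 0 l0 : 'rV[R]_m.+1) 0 i = 1.
    rewrite (bigD1 l0)//= mxE !eqxx big1 ?addr0// => i /negPf il.
    by rewrite mxE il andbF.
  pose d : 'rV[R]_m.+1 := delta_mx 0 l - delta_mx 0 l'.
  have dE : d *m Km = d *m Km *m Cm *m Km by rewrite -(mulmxA d) split_lump mulmx1.
  have d0 : \sum_w (d *m Km) 0 w = 0.
    rewrite sum_split; under eq_bigr do rewrite mxE [X in _ + X]mxE.
    by rewrite sumrB !s1 subrr.
  have [v vE] := cell_tangentP iota_cell par (cU Ir) dE d0.
  have : L *m d^T = 0.
    have -> : d = v *m (T r *m Cm).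
      by rewrite mulmxA -vE -mulmxA split_lump mulmx1.
    by rewrite [(v *m _)^T]trmx_mul mulmxA h mul0mx.
  rewrite linearB /= mulmxBr !trmx_delta -!colE => /matrixP/(_ 0 0).
  by rewrite !mxE => /subr0_eq.
have LE : L = log_curvature q r ord0 *: const_mx 1.
  by apply/rowP => l; rewrite !mxE mulr1 (h l ord0).
rewrite LE -scalemxAl (_ : const_mx 1 *m _ = 0) ?scaler0//.
apply/rowP => k; rewrite [RHS]mxE [LHS]mxE.
under eq_bigr do rewrite [const_mx _ _ _]mxE mul1r [_^T _ _]mxE.
transitivity (\sum_l (row k (T r) *m Cm) 0 l).
  by apply: eq_bigr => l _; rewrite -row_mul [RHS]mxE.
by rewrite -(sum_split cl) -!row_mul -TE rowE mean_tangent.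
Qed.

End InChart.

End CellGeodesics.

(** * Completeness forces the whole cellular family *)

Section Completeness.
Variables (R : realType) (n m : nat) (M : topologicalType) (iota : M -> 'rV[R]_n.+1).
Variable cl : cells R n m.
Local Notation Cm := (lump_mx cl).
Local Notation Km := (split_mx cl).
Local Notation sg := (cell_weight cl).
Local Notation D1 f := ('D_(1 : R^o) f).
Hypothesis iota_cell : forall t, cell_set cl (iota t).
Hypothesis M_sub : submanifold m iota.

Let iota_simplex t : simplex n (iota t). Proof. by case: (iota_cell t). Qed.

Lemma is_derive_rate (q : R -> 'rV[R]_m.+1) r l : differentiable q r ->
  differentiable (D1 q) r -> q r 0 l != 0 ->
  is_derive r (1 : R^o) (fun t => D1 q t 0 l / q t 0 l : R) (log_curvature q r l).
Proof.
move=> dq dDq q0.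
have d1 : derivable (fun t => D1 q t 0 l : R) r (1 : R^o).
  by apply: diff_derivable; exact: differentiable_entry.
have d2 : derivable (fun t => q t 0 l : R) r (1 : R^o).
  by apply: diff_derivable; exact: differentiable_entry.
have d3 : derivable (fun t => (q t 0 l)^-1 : R) r (1 : R^o) by exact: derivableV.
apply: DeriveDef; first exact: (derivableM d1 d3).
apply: etrans (deriveM d1 d3) _.
rewrite (deriveV q0 d2) (derive_entry (1 : R^o) l dDq) (derive_entry (1 : R^o) l dq).
by rewrite /log_curvature /GRing.scale /=; field.
Qed.

Lemma affine_of_derive2 (f : R -> R) : (forall r, derivable f r (1 : R^o)) ->
  (forall r, is_derive r (1 : R^o) (D1 f) 0) -> forall r, f r = f 0 + r * D1 f 0.
Proof.
move=> df ddf r.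
have cD t : D1 f t = D1 f 0 by exact: (is_derive_0_is_cst (f := D1 f) t 0 ddf).
have dfr t : differentiable f t by exact/derivable1_diffP.
have [t _|t _ E] := @segment_mvt R R^o f 0 r; first exact: dfr.
apply/eqP; rewrite addrC -subr_eq E subr0; apply/eqP.
apply: etrans (derive_scale1 r (dfr _)) _.
by rewrite cD.
Qed.

(** Each time may need its own chart, but the masses [Q] are independent of charts; the second
    derivative of [h] vanishes at every time, so [h] is affine on the whole line. *)
Lemma geodesic_log_affine (gamma : R -> M) l :
  geodesic m iota gamma ->
  let h t := ln ((iota (gamma t) *m Cm) 0 l) - ln ((iota (gamma t) *m Cm) 0 ord0) in
  forall r, h r = h 0 + r * D1 h 0.
Proof.
move=> geo h; pose Q t := iota (gamma t) *m Cm.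
have Q0 t l' : 0 < Q t 0 l' by exact: lump_iota_gt0.
have loc s : [/\ \forall t \near s, differentiable Q t, differentiable (D1 Q) s &
    forall l l', log_curvature Q s l = log_curvature Q s l'].
  have [U [phi [c [par [I [oI Is sc cE]]]]]] := geo s.
  have cU r : I r -> U (c r) by move=> /cE[].
  have nQ r : I r -> \forall t \near r, iota (phi (c t)) *m Cm = Q t.
    move=> Ir; apply: filterS (open_nbhs_nbhs (conj oI Ir)) => t It.
    by have [_ E _] := cE t It; rewrite /Q E.
  have nDQ r : I r -> D1 (fun t => iota (phi (c t)) *m Cm) r = D1 Q r.
    by move=> Ir; exact: near_eq_derive (1 : R^o) (nQ r Ir).
  have nDDQ : D1 (D1 (fun t => iota (phi (c t)) *m Cm)) s = D1 (D1 Q) s.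
    apply: near_eq_derive; apply: filterS (open_nbhs_nbhs (conj oI Is)) => t; exact: nDQ.
  split.
  - apply: filterS (open_nbhs_nbhs (conj oI Is)) => t It.
    apply: near_eq_differentiable (nQ t It) _.
    exact: (lump_differentiable iota_cell par sc cU It).
  - apply: near_eq_differentiable (lump_differentiable2 iota_cell par oI sc cU Is).
    by apply: filterS (open_nbhs_nbhs (conj oI Is)) => t; exact: nDQ.
  - have E l1 : log_curvature (fun t => iota (phi (c t)) *m Cm) s l1 = log_curvature Q s l1.
      by rewrite /log_curvature (nDQ s Is) nDDQ (nbhs_singleton (nQ s Is)).
    move=> l1 l2; rewrite -!E.
    apply: (cell_acceleration_eq0 iota_cell par oI sc cU Is).1.
    by have [] := cE s Is.
have lnE s l' : is_derive s (1 : R^o) (fun t => ln (Q t 0 l') : R) (D1 Q s 0 l' / Q s 0 l').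
  have [dQ _ _] := loc s; have dq := nbhs_singleton dQ.
  have [dl dE] := is_derive1_ln (Q0 s l').
  have dq' : differentiable (fun t => Q t 0 l' : R) s by exact: differentiable_entry.
  apply: DeriveDef; first by apply: diff_derivable; exact: differentiable_comp1.
  apply: etrans (derive_comp1 (1 : R^o) dq' dl) _.
  by rewrite derive1E dE (derive_entry (1 : R^o) l' dq) mulrC.
have hE s : is_derive s (1 : R^o) h (D1 Q s 0 l / Q s 0 l - D1 Q s 0 ord0 / Q s 0 ord0).
  exact: (is_deriveB (lnE s l) (lnE s ord0)).
apply: affine_of_derive2 => s; first by case: (hE s).
have -> : D1 h = (fun t => D1 Q t 0 l / Q t 0 l - D1 Q t 0 ord0 / Q t 0 ord0).
  by apply/funext => t; case: (hE t).
have [dQ dDQ cQ] := loc s; have dq := nbhs_singleton dQ.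
have nz l' : Q s 0 l' != 0 by rewrite gt_eqF.
have := is_deriveB (is_derive_rate dq dDQ (nz l)) (is_derive_rate dq dDQ (nz ord0)).
by rewrite (cQ l ord0) subrr.
Qed.

Lemma cell_set_eq p p' : cell_set cl p -> cell_set cl p' -> p *m Cm = p' *m Cm -> p = p'.
Proof. by move=> [_ {2}->] [_ {2}->] ->. Qed.

(** The geodesic is aimed at [p]: its initial velocity makes the log ratios of the masses move, in
    unit time, from those of the start to those of the target. *)
Lemma complete_onto (t0 : M) : complete_connection m iota ->
  forall p, cell_set cl p -> exists t, iota t = p.
Proof.
move=> comp p cp; have [_ _ /(_ t0)[U [phi [u [par Uu _]]]]] := M_sub.
have sg0 : 0 < sg := cell_weight_gt0 cp.
pose q := iota (phi u) *m Cm; pose q' := p *m Cm.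
have q0 l : 0 < q 0 l by exact: lump_iota_gt0.
have q'0 l : 0 < q' 0 l by apply: lump_gt0 => w; have [[/(_ w)/andP[]]] := cp.
pose th l := ln (q' 0 l) - ln (q 0 l).
(* Subtracting the weighted mean [mu] gives the velocity sum zero, so that it is tangent;
   differences of rates are unchanged. *)
pose mu := (\sum_l q 0 l * th l) / sg.
pose y : 'rV[R]_m.+1 := \row_l (q 0 l * (th l - mu)).
have y0 : \sum_w (y *m Km) 0 w = 0.
  rewrite sum_split; under eq_bigr do rewrite mxE mulrBr.
  rewrite sumrB -mulr_suml (sum_lump_cell_set (iota_cell (phi u))).
  by rewrite /mu mulrC divfK ?subrr// gt_eqF.
have yK : y *m Km = y *m Km *m Cm *m Km by rewrite -(mulmxA y) split_lump mulmx1.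
have [v vE] := cell_tangentP iota_cell par Uu yK y0.
have [gamma [c [geo gn c0 c1]]] := comp U phi par u Uu v.
pose Q t := iota (gamma t) *m Cm.
exists (gamma 1); apply: cell_set_eq => //.
have [I [oI I0 sc cE]] := gn.
have cU r : I r -> U (c r) by move=> /cE[].
have nQ : \forall t \near 0, iota (phi (c t)) *m Cm = Q t.
  apply: filterS (open_nbhs_nbhs (conj oI I0)) => t It.
  by have [_ E _] := cE t It; rewrite /Q E.
have Q0E : Q 0 = q by rewrite -(nbhs_singleton nQ) c0.
have dQ : differentiable Q 0.
  apply: near_eq_differentiable nQ _.
  exact: (lump_differentiable iota_cell par sc cU I0).
have DQ : D1 Q 0 = y.
  rewrite -(near_eq_derive (1 : R^o) nQ) (lump_derive iota_cell par sc cU I0).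
  rewrite (curve_derive iota_simplex par sc cU I0) c0.
  have -> : D1 c 0 = v by rewrite -c1 derive1E.
  by rewrite -vE -mulmxA split_lump mulmx1.
have rate l : D1 (fun t => ln (Q t 0 l) - ln (Q t 0 ord0)) 0 = th l - th ord0.
  have lnD l' : is_derive 0 (1 : R^o) (fun t => ln (Q t 0 l') : R) (D1 Q 0 0 l' / Q 0 0 l').
    have [dl dE] := is_derive1_ln (lump_iota_gt0 iota_cell (gamma 0) l').
    have dq' : differentiable (fun t => Q t 0 l' : R) 0 by exact: differentiable_entry.
    apply: DeriveDef; first by apply: diff_derivable; exact: differentiable_comp1.
    apply: etrans (derive_comp1 (1 : R^o) dq' dl) _.
    by rewrite derive1E dE (derive_entry (1 : R^o) l' dQ) mulrC.
  have [_ ->] := is_deriveB (lnD l) (lnD ord0).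
  have yE l' : y 0 l' / q 0 l' = th l' - mu.
    by rewrite [y _ _]mxE mulrAC mulfV ?mul1r// gt_eqF.
  by rewrite DQ Q0E !yE; ring.
have ratio l : ln (Q 1 0 l) - ln (Q 1 0 ord0) = ln (q' 0 l) - ln (q' 0 ord0).
  have := geodesic_log_affine l geo 1; rewrite /= -/(Q 1) -/(Q 0).
  rewrite (_ : D1 _ 0 = th l - th ord0); last exact: rate.
  by rewrite Q0E mul1r => ->; rewrite /th; ring.
have Q1 l : 0 < Q 1 0 l by exact: lump_iota_gt0.
have prop l : Q 1 0 l = q' 0 l * (Q 1 0 ord0 / q' 0 ord0).
  apply: ln_inj; [by rewrite posrE|by rewrite posrE mulr_gt0// divr_gt0|].
  rewrite lnM ?posrE ?divr_gt0// ln_div ?posrE//.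
  by have := ratio l; lra.
(* Equal ratios leave a common factor, which is 1 because both mass vectors sum to [sg]. *)
have k1 : Q 1 0 ord0 / q' 0 ord0 = 1.
  have sQ : \sum_l Q 1 0 l = sg by exact: (sum_lump_cell_set (iota_cell _)).
  have sq' : \sum_l q' 0 l = sg by exact: (sum_lump_cell_set cp).
  apply: (mulfI (lt0r_neq0 sg0)); rewrite mulr1 -{1}sq' -sQ mulr_suml.
  by apply: eq_bigr => l _; rewrite -prop.
by apply/rowP => l; rewrite -/(Q 1) -/q' prop k1 mulr1.
Qed.

End Completeness.

(** * Exponential tilting of cell masses *)

Section ExponentialCurve.
Variables (R : realType) (m : nat) (sg : R) (q0 : 'rV[R]_m.+1) (th : 'I_m.+1 -> R).
Hypothesis sg_gt0 : 0 < sg.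
Hypothesis q0_gt0 : forall l, 0 < q0 0 l.
Hypothesis q0_sum : \sum_l q0 0 l = sg.
Local Notation D1 f := ('D_(1 : R^o) f).

Let e l (r : R) : R := q0 0 l * expR (th l * r).
Let Z (r : R) : R := \sum_l e l r.
Let Z' (r : R) : R := \sum_l th l * e l r.

(** The masses [q0] tilted with rates [th] and renormalised by the partition function [Z] to total
    mass [sg]. *)
Definition exp_curve (r : R) : 'rV[R]_m.+1 := \row_l (sg * e l r * (Z r)^-1).

Let e_gt0 l r : 0 < e l r. Proof. by rewrite mulr_gt0// expR_gt0. Qed.

Let Z_gt0 r : 0 < Z r.
Proof.
rewrite /Z (bigD1 ord0)//= ltr_wpDr ?e_gt0//.
by apply: sumr_ge0 => l _; rewrite ltW.
Qed.

Lemma exp_curve_gt0 r l : 0 < exp_curve r 0 l.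
Proof. by rewrite mxE mulr_gt0 ?invr_gt0// mulr_gt0. Qed.

Lemma sum_exp_curve r : \sum_l exp_curve r 0 l = sg.
Proof.
under eq_bigr do rewrite mxE.
by rewrite -mulr_suml -mulr_sumr -/(Z r) mulfK// gt_eqF.
Qed.

Lemma exp_curve0 : exp_curve 0 = q0.
Proof.
have e0 l : e l 0 = q0 0 l by rewrite /e mulr0 expR0 mulr1.
apply/rowP => l; rewrite mxE /Z e0; under eq_bigr do rewrite e0.
by rewrite q0_sum mulrAC mulfV ?mul1r// gt_eqF.
Qed.

(** Closed under derivation: the derivative of [Z^-1] is a combination of exponentials times [Z^-1]
    squared. *)
Inductive exp_base : (R -> R) -> Prop :=
| exp_base_exp a : exp_base (fun r => expR (a * r))
| exp_base_inv : exp_base (fun r => (Z r)^-1).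

Let derive_lin (a r : R) : is_derive r (1 : R^o) (fun t : R => a * t) a.
Proof.
have := is_diff_scaler (a : R) (r : R^o) => -[d dE].
apply: DeriveDef; first exact: (diff_derivable d).
apply: etrans (deriveE (1 : R^o) d) _.
by rewrite dE /GRing.scale /= mulr1.
Qed.

Let is_derive_exp (a r : R) : is_derive r (1 : R^o) (fun t : R => expR (a * t)) (a * expR (a * r)).
Proof.
have [dl lE] := derive_lin a r.
have dl' : differentiable (fun t : R => a * t) r by exact/derivable1_diffP.
have [de eE] := is_derive_expR (a * r).
apply: DeriveDef; first by apply: diff_derivable; exact: differentiable_comp1.
apply: etrans (derive_comp1 (1 : R^o) dl' de) _.
by rewrite lE derive1E eE mulrC.
Qed.

Let is_derive_e l r : is_derive r (1 : R^o) (e l) (th l * e l r).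
Proof.
have [d dE] := is_derive_exp (th l) r.
have eE : e l = q0 0 l \*o (fun t => expR (th l * t)) by apply/funext.
apply: DeriveDef; rewrite eE; first exact: (derivableM (derivable_cst _ _ _) d).
by rewrite (deriveMl (q0 0 l) d) dE /= mulrCA.
Qed.

Let is_derive_Z r : is_derive r (1 : R^o) Z (Z' r).
Proof.
have ZE : Z = \sum_l e l by apply/funext => t; rewrite fct_sumE.
rewrite ZE; have d l : derivable (e l) r (1 : R^o) by case: (is_derive_e l r).
apply: DeriveDef; first exact: derivable_sum.
rewrite derive_sum//; apply: eq_bigr => l _; by case: (is_derive_e l r).
Qed.

Let alg_e l : fun_alg exp_base (e l).
Proof. by apply: alg_mul; [exact: alg_cst|exact/alg_base/exp_base_exp]. Qed.

Let is_derive_Zinv r : is_derive r (1 : R^o) (fun t => (Z t)^-1) (- Z' r * ((Z r)^-1 * (Z r)^-1)).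
Proof.
have [d dE] := is_derive_Z r; have Z0 : Z r != 0 by rewrite gt_eqF.
apply: DeriveDef; first exact: derivableV.
by rewrite deriveV// dE /GRing.scale /= mulNr -mulNr mulrC; rewrite -invfM expr2 mulrN mulNr mulrC.
Qed.

Let exp_derivative f : exp_base f -> alg_derivative setT exp_base f.
Proof.
case=> [a|]; split.
- by move=> r _; apply/derivable1_diffP; case: (is_derive_exp a r).
- exists (fun r => a * expR (a * r)); last by move=> r _; case: (is_derive_exp a r).
  by apply: alg_mul; [exact: alg_cst|exact/alg_base/exp_base_exp].
- by move=> r _; apply/derivable1_diffP; case: (is_derive_Zinv r).
- exists (fun r => (-1 * \sum_l th l * e l r) * ((Z r)^-1 * (Z r)^-1)).
    apply: alg_mul; last by apply: alg_mul; exact/alg_base/exp_base_inv.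
    apply: alg_mul; first exact: alg_cst.
    apply: alg_sum => l; apply: alg_mul; first exact: alg_cst.
    exact: alg_e.
  by move=> r _; rewrite mulN1r; case: (is_derive_Zinv r).
Qed.

Lemma exp_curve_smooth : @smooth_on R R^o 'rV[R]_m.+1 setT exp_curve.
Proof.
apply: smooth_on_row => [|l]; first exact: openT.
apply: (alg_smooth openT exp_derivative).
rewrite (_ : (fun _ => _) = fun r => sg * e l r * (Z r)^-1); last first.
  by apply/funext => r; rewrite mxE.
apply: alg_mul; last exact/alg_base/exp_base_inv.
by apply: alg_mul; [exact: alg_cst|exact: alg_e].
Qed.

Lemma exp_curve_differentiable r : differentiable exp_curve r.
Proof. exact: (smooth_on_differentiable exp_curve_smooth (I : setT r)). Qed.

Lemma exp_curve_derive r l :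
  D1 exp_curve r 0 l = exp_curve r 0 l * (th l - Z' r / Z r).
Proof.
rewrite -(derive_entry (1 : R^o) l (exp_curve_differentiable r)).
have [d1 e1] := is_derive_e l r; have [d2 e2] := is_derive_Zinv r.
have d3 : derivable (sg \*o e l) r (1 : R^o) by exact: (derivableM (derivable_cst _ _ _) d1).
have -> : (fun t => exp_curve t 0 l : R) = (sg \*o e l) * (fun t => (Z t)^-1).
  by apply/funext => t; rewrite mxE.
apply: etrans (deriveM d3 d2) _.
rewrite (deriveMl sg d1) e1 e2 /GRing.scale /= mxE; field.
by rewrite gt_eqF.
Qed.

(** The logarithmic rate of entry [l] is [th l - Z' / Z]; two rates differ by a constant, so their
    derivatives coincide. *)
Lemma exp_curve_curvature r l l' :
  log_curvature exp_curve r l = log_curvature exp_curve r l'.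
Proof.
have dD : differentiable (D1 exp_curve) r.
  exact: (smooth_on_differentiable (smooth_on_derive (1 : R^o) exp_curve_smooth) (I : setT r)).
have nz k : exp_curve r 0 k != 0 by rewrite gt_eqF// exp_curve_gt0.
have rate k t : D1 exp_curve t 0 k / exp_curve t 0 k = th k - Z' t / Z t.
  by rewrite exp_curve_derive mulrAC mulfV ?mul1r// gt_eqF// exp_curve_gt0.
have [d dE] := is_derive_rate (exp_curve_differentiable r) dD (nz l).
have [d' dE'] := is_derive_rate (exp_curve_differentiable r) dD (nz l').
rewrite -dE -dE'.
have -> : (fun t => D1 exp_curve t 0 l / exp_curve t 0 l : R) =
    (fun t => D1 exp_curve t 0 l' / exp_curve t 0 l' : R) + cst (th l - th l').
  by apply/funext => t; rewrite !fctE !rate; ring.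
by rewrite (deriveD d' (derivable_cst _ _ _)) derive_cst addr0.
Qed.

(** With these rates [Z' 0] is the sum of [v], hence 0, and normalisation does not disturb the
    initial velocity. *)
Lemma exp_curve_velocity0 (v : 'rV[R]_m.+1) : \sum_l v 0 l = 0 ->
  (forall l, th l = v 0 l / q0 0 l) -> D1 exp_curve 0 = v.
Proof.
move=> v0 thE; apply/rowP => l; rewrite exp_curve_derive exp_curve0.
have -> : Z' 0 = 0.
  rewrite /Z' -[RHS]v0; apply: eq_bigr => k _.
  by rewrite thE /e mulr0 expR0 mulr1 divfK// gt_eqF.
by rewrite mul0r subr0 thE mulrC divfK// gt_eqF.
Qed.

End ExponentialCurve.

(** * The whole cellular family is complete *)

Section OntoComplete.
Variables (R : realType) (n m : nat) (M : topologicalType) (iota : M -> 'rV[R]_n.+1).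
Variable cl : cells R n m.
Local Notation Cm := (lump_mx cl).
Local Notation Km := (split_mx cl).
Local Notation sg := (cell_weight cl).
Local Notation D1 f := ('D_(1 : R^o) f).
Hypothesis n_gt0 : (0 < n)%N.
Hypothesis iota_cell : forall t, cell_set cl (iota t).
Hypothesis M_sub : submanifold m iota.
Hypothesis onto : forall p, cell_set cl p -> exists t, iota t = p.

Let iota_simplex t : simplex n (iota t). Proof. by case: (iota_cell t). Qed.
Let iota_inj : injective iota. Proof. by case: M_sub. Qed.

Lemma cell_set_of_lump (q : 'rV[R]_m.+1) : (forall l, 0 < q 0 l) -> \sum_l q 0 l = sg ->
  cell_set cl (q *m Km + frozen_row cl).
Proof.
move=> q0 q1; split.
  apply: simplex_pos => // [w|].
    rewrite mxE; case E : (cell cl w) => [l|].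
      by rewrite (frozen_row_some E) addr0 (mul_split_gt0 _ E).
    by rewrite (frozen_row_none E) mul_splitE E add0r kap_gt0.
  under eq_bigr do rewrite mxE.
  by rewrite big_split /= sum_split q1 /cell_weight subrK.
by rewrite mulmxDl frozen_lump addr0 -!mulmxA (mulmxA Km) split_lump mul1mx.
Qed.

(** The masses of all cells but the last. They are coordinates on the family, so in any chart of [M]
    they form a map between spaces of equal dimension with invertible jacobian. *)
Let E := Cm *m eta_mx R m.

Lemma flat_chart_unit (U : set 'rV[R]_m) phi u : parametrization iota U phi -> U u ->
  'J (fun u => iota (phi u) *m E + 0) u \in unitmx.
Proof.
move=> par Uu; have sP := smooth_point iota_simplex par.
rewrite (jacobian_affine E 0 (smooth_on_differentiable sP Uu)) -(tangent_mxE iota_simplex par Uu).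
set T := tangent_mx _ _; have TE := tangent_cell iota_cell par Uu.
rewrite -row_free_unit mulmxA; apply: (@row_free_mull _ _ _ _ _ (prob_mx R m)).
have -> : T *m Cm *m eta_mx R m *m prob_mx R m = T *m Cm.
  apply/row_matrixP => a; rewrite !(row_mul _ _ (prob_mx R m)) (row_mul _ _ (eta_mx R m)).
  rewrite eta_prob_mx// -(sum_split cl) -row_mul -TE rowE; exact: mean_tangent.
apply: (@row_free_mull _ _ _ _ _ Km); rewrite -TE.
exact: (row_free_tangent iota_simplex par).
Qed.

Lemma flat_chart_inj p p' : cell_set cl p -> cell_set cl p' -> p *m E = p' *m E -> p = p'.
Proof.
move=> cp cp' h; apply: (cell_set_eq cp cp').
apply/subr0_eq; rewrite -mulmxBl; set y := (p - p') *m Cm.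
have y0 : \sum_l y 0 l = 0.
  rewrite /y mulmxBl; under eq_bigr do rewrite mxE [X in _ + X]mxE.
  by rewrite sumrB (sum_lump_cell_set cp) (sum_lump_cell_set cp') subrr.
by rewrite -(eta_prob_mx y0) /y -[_ *m Cm *m _]mulmxA mulmxBl h subrr mul0mx.
Qed.

Section Lift.
Variable q : R -> 'rV[R]_m.+1.
Variable gamma : R -> M.
Hypothesis q_smooth : @smooth_on R R^o 'rV[R]_m.+1 setT q.
Hypothesis gammaE : forall r, iota (gamma r) = q r *m Km + frozen_row cl.
Hypothesis q_curv : forall r l l', log_curvature q r l = log_curvature q r l'.

Let qE r : iota (gamma r) *m Cm = q r.
Proof. by rewrite gammaE mulmxDl frozen_lump addr0 -mulmxA split_lump mulmx1. Qed.

(** [gamma] comes from surjectivity point by point, with no continuity known in the topology of [M].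
    Lifting the masses [q] through the chart gives a smooth [c], and injectivity of [iota] and of
    the masses identifies [phi (c r)] with [gamma r]. *)
Lemma lift_geodesic (U : set 'rV[R]_m) phi u s : parametrization iota U phi -> U u ->
  phi u = gamma s -> exists c, geodesic_near iota gamma s U phi c /\ c s = u.
Proof.
move=> par Uu us; have sP := smooth_point iota_simplex par.
have oU : open U by case: par.
pose y u := iota (phi u) *m E + 0; pose z r := q r *m eta_mx R m + 0.
have sy : smooth_on U y by exact: smooth_on_affine.
have sz : @smooth_on R R^o 'rV[R]_m setT z.
  exact: (smooth_on_affine (eta_mx R m) 0 openT q_smooth).
have zs : z s = y u by rewrite /z /y us mulmxA qE.
have cz r : {for r, continuous z}.
  exact: differentiable_continuous (smooth_on_differentiable sz (I : setT r)).
have [J [c [oJ Js cs cP]]] := local_lift oU Uu sy (flat_chart_unit par Uu) cz zs.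
have cU r : J r -> U (c r) by move=> /cP[].
have yc r : J r -> y (c r) = z r by move=> /cP[].
have cc r : J r -> {for r, continuous c} by move=> /cP[].
have sc : @smooth_on R R^o 'rV[R]_m J c.
  apply: (lift_smooth oJ sy (fun u Uu => flat_chart_unit par Uu) _ cU yc cc).
  exact: smooth_on_sub sz.
have gc r : J r -> gamma r = phi (c r).
  move=> Jr; apply: iota_inj; apply: flat_chart_inj => //.
  by have := yc r Jr; rewrite /y /z !addr0 => ->; rewrite mulmxA qE.
exists c; split=> //; exists J; split=> // r Jr; split; [exact: cU|exact: gc|].
apply: (cell_acceleration_eq0 iota_cell par oJ sc cU Jr).2 => l l'.
have nq t : J t -> \forall t' \near t, iota (phi (c t')) *m Cm = q t'.
  by move=> Jt; apply: filterS (open_nbhs_nbhs (conj oJ Jt)) => t' Jt'; rewrite -gc.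
have nDq t : J t -> D1 (fun t => iota (phi (c t)) *m Cm) t = D1 q t.
  by move=> Jt; exact: near_eq_derive (1 : R^o) (nq t Jt).
have nDDq : D1 (D1 (fun t => iota (phi (c t)) *m Cm)) r = D1 (D1 q) r.
  by apply: near_eq_derive; apply: filterS (open_nbhs_nbhs (conj oJ Jr)) => t; exact: nDq.
have H l1 : log_curvature (fun t => iota (phi (c t)) *m Cm) r l1 = log_curvature q r l1.
  by rewrite /log_curvature (nDq r Jr) nDDq (nbhs_singleton (nq r Jr)).
by rewrite !H.
Qed.

End Lift.

Lemma onto_complete : complete_connection m iota.
Proof.
move=> U phi par u Uu v.
pose p := iota (phi u); pose q0 := p *m Cm.
have sg0 : 0 < sg := cell_weight_gt0 (iota_cell (phi u)).
have q0_gt0 l : 0 < q0 0 l by exact: lump_iota_gt0.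
have q0_sum : \sum_l q0 0 l = sg by exact: (sum_lump_cell_set (iota_cell _)).
pose T := tangent_mx (coord_expr iota phi) u.
have TE : T = T *m Cm *m Km := tangent_cell iota_cell par Uu.
pose vq := v *m T *m Cm.
have vq0 : \sum_l vq 0 l = 0.
  by rewrite -(sum_split cl) /vq -(mulmxA v) -(mulmxA v) -TE mean_tangent.
(* The rates are the lumped scores of the prescribed velocity. *)
pose th l := vq 0 l / q0 0 l.
pose q := exp_curve sg q0 th.
have gex r : exists t, iota t = q r *m Km + frozen_row cl.
  apply: onto; apply: cell_set_of_lump => [l|]; first exact: exp_curve_gt0.
  exact: sum_exp_curve.
have [gamma gammaE] := choice gex.
have q_smooth := exp_curve_smooth sg th q0_gt0 : @smooth_on R R^o 'rV[R]_m.+1 setT q.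
have q_curv := exp_curve_curvature th sg0 q0_gt0 : forall r l l', log_curvature q r l = log_curvature q r l'.
have g0 : phi u = gamma 0.
  apply: iota_inj; rewrite gammaE /q exp_curve0//.
  by case: (iota_cell (phi u)).
have [c [gn c0]] := lift_geodesic q_smooth gammaE q_curv par Uu g0.
exists gamma, c; split=> //.
  move=> s; have [_ _ /(_ (gamma s))[U' [phi' [u' [par' Uu' us]]]]] := M_sub.
  have [c' [gn' _]] := lift_geodesic q_smooth gammaE q_curv par' Uu' us.
  by exists U', phi', c'.
have [J [oJ J0 sc cE]] := gn.
have cU r : J r -> U (c r) by move=> /cE[].
have nq : \forall t \near 0, iota (phi (c t)) *m Cm = q t.
  apply: filterS (open_nbhs_nbhs (conj oJ J0)) => t Jt; have [_ <- _] := cE t Jt.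
  by rewrite gammaE mulmxDl frozen_lump addr0 -mulmxA split_lump mulmx1.
(* Lumping loses nothing on tangent vectors: splitting again recovers [D1 c 0 *m T = v *m T], and
   [T] has independent rows. *)
have : D1 c 0 *m T *m Cm = vq.
  rewrite -(exp_curve_velocity0 sg0 q0_gt0 q0_sum vq0 (fun l => erefl (th l))) -/q.
  rewrite -(near_eq_derive (1 : R^o) nq) (lump_derive iota_cell par sc cU J0).
  by rewrite (curve_derive iota_simplex par sc cU J0) c0.
move=> /(congr1 (mulmx^~ Km)).
rewrite /vq -(mulmxA _ T) -(mulmxA _ (T *m Cm)) -[v *m T *m Cm]mulmxA -(mulmxA v) -TE.
by move=> h; rewrite derive1E; apply: (row_free_inj (row_free_tangent iota_simplex par Uu)).
Qed.

End OntoComplete.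

(** * Dimension bound and conclusion *)

Lemma submanifold_leq (R : realType) n m (M : topologicalType)
    (iota : M -> 'rV[R]_n.+1) (t : M) : submanifold m iota -> (m <= n)%N.
Proof.
move=> [_ _ /(_ t)[U [phi [u [[_ _ _ _ [_ rJ]] Uu _]]]]].
by rewrite -(eqP (rJ u Uu)); exact: rank_leq_col.
Qed.

Unset Implicit Arguments.
Set Strict Implicit.

Theorem theorem4p6 (R : realType) (n m : nat) (m_ge2 : (2 <= m)%N)
    (M : topologicalType) (iota : M -> 'rV[R]_n.+1)
    (M_sub : submanifold m iota)
    (M_neq0 : [set: M] !=set0) (M_conn : connected [set: M]) :
  (doubly_umbilical m iota <->
     exists X : xi_data R n m,
       [/\ submanifold m (Xi_incl X),
           autoparallel m (Xi_incl X) mconn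
         & range iota `<=` Xi X]) /\
  (forall X : xi_data R n m, range iota `<=` Xi X ->
     [/\ submanifold m (Xi_incl X)
           /\ autoparallel m (Xi_incl X) mconn,
         (doubly_autoparallel m iota <-> xi_B X = 0%N),
         (doubly_autoparallel m iota ->
            exists f : 'rV[R]_m.+1 -> set_type (Xi X),
              statistical_diffeo (Xi_incl X) f /\
              markov_embedding (Xi_incl X \o f)),
         (xi_B X <> 0%N ->
            exists f : 'rV[R]_m.+2 -> 'rV[R]_n.+1,
              [/\ @markov_embedding R m.+1 n f,
                  Xi X `<=` f @` simplex m.+1
                & exists j : set_type (Xi X) -> 'rV[R]_m.+2,
                  [/\ forall q, simplex m.+1 (j q) /\ f (j q) = Xi_incl X q,
                      @submanifold R m.+1 m (set_type (Xi X)) j,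
                      @statistical_immersion R n m.+1 m (set_type (Xi X))
                        (Xi_incl X) j
                    & @doubly_umbilical R m.+1 m (set_type (Xi X)) j]])
       & (complete_connection m iota <-> range iota = Xi X)]).
Proof.
have [t0 _] := M_neq0; have m_gt0 : (0 < m)%N by exact: leq_trans m_ge2.
have mn := submanifold_leq t0 M_sub; have n_gt0 := leq_trans m_gt0 mn.
have [iota_s _ charts] := M_sub.
have Xi_sub (X : xi_data R n m) : range iota `<=` Xi X ->
    submanifold m (Xi_incl X) /\ autoparallel m (Xi_incl X) mconn.
  move=> rX; have [c [XE _]] := Xi_cells X mn.
  have X0 : iota t0 \in Xi X by rewrite inE; apply: rX; exists t0.
  split; first exact: (cell_submanifold XE m_gt0 (exist _ (iota t0) X0 : set_type (Xi X))).
  by apply: (cell_mconn_autoparallel (c := c)); exact: inc_cell.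
split.
  split=> [umb|[X [_ _ rX]]].
    have [X rX] := umbilical_in_Xi m_ge2 iota_s umb M_sub M_conn t0.
    by exists X; have [] := Xi_sub X rX.
  have [c [XE _]] := Xi_cells X mn.
  apply: (cell_doubly_umbilical (c := c)) => // t.
  by rewrite -XE; apply: rX; exists t.
move=> X rX; have [c [XE BE]] := Xi_cells X mn.
have iota_c t : cell_set c (iota t) by rewrite -XE; apply: rX; exists t.
have X0 : iota t0 \in Xi X by rewrite inE; apply: rX; exists t0.
pose x0 : set_type (Xi X) := exist _ (iota t0) X0.
have ap_none : doubly_autoparallel m iota -> forall w, cell c w != None.
  move=> [ap _]; have [U [phi [u [par Uu _]]]] := charts t0.
  exact: (cell_autoparallel_none iota_c m_gt0 par Uu ap).
split.
- exact: Xi_sub.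
- split=> [/ap_none/BE//|/BE cN]; split.
    exact: (cell_econn_autoparallel iota_c cN).
  exact: (cell_mconn_autoparallel iota_c).
- move=> /ap_none cN; exists (cell_lift c x0); split.
    exact: (cell_statistical_diffeo XE m_gt0 x0 cN).
  exact: (cell_markov XE m_gt0 x0 cN).
(* A frozen outcome keeps the mass of the merged cell positive, so that its conditional
   probabilities make sense. *)
- move=> B0; have [w cw] : exists w, cell c w = None.
    apply: contrapT => h; apply: B0; apply/BE => w; apply/eqP => cw.
    by apply: h; exists w.
  exact: (slice_embedding cw XE m_gt0 x0).
- split=> [comp|rE].
    apply/seteqP; split => // p; rewrite XE => cp.
    by have [t <-] := complete_onto iota_c M_sub t0 comp cp; exists t.
  apply: (onto_complete n_gt0 iota_c M_sub) => p.
  by rewrite -XE -rE => -[t _ <-]; exists t.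
Qed.
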